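(* Up to isomorphism, the potential Zariski pairs among all ten-line configurations are exactly the following nine, each given by its list of triple points (a string $ijk$ denotes the triple point $L_i\cap L_j\cap L_k$, where the digit $0$ stands for $L_{10}$): (1) $123,159,168,247,289,348,357,456,679,250,360,140$; (2) $123,159,168,247,289,348,357,456,679,580,360,140$; (3) $123,147,169,248,257,359,368,456,789,340,670,290$; (4) $123,147,169,248,257,359,368,456,789,490,370,150$; (5) $124,157,168,258,269,360,345,379,590,780,467,489$; (6) $124,135,160,279,258,389,367,780,490,457,468,569$; (7) $124,135,260,178,279,367,389,490,580,457,468,569$; (8) $124,135,260,179,278,367,389,490,580,457,468,569$; (9) $124,135,236,167,189,259,270,378,390,458,460$.
   Context: A ten-line configuration (combinatorial arrangement of ten lines with only double and triple points) is a set of ten symbols $L_1,\dots,L_{10}$ (''lines'') together with a collection of $3$-element subsets of it (''triple points'') such that any two lines lie together in at most one triple point and every line belongs to at least three triple points. (Two lines not sharing a triple point are understood to meet in a double point.) Two configurations are isomorphic if a bijection of the lines carries the triple points of one onto those of the other. A configuration $C$ is geometrically realizable if there are ten distinct lines $L_1,\dots,L_{10}$ in $\mathbb{CP}^2$ such that $L_i\cap L_j\cap L_k\neq\emptyset$ (for distinct $i,j,k$) exactly when $\{L_i,L_j,L_k\}$ is a triple point of $C$; such an arrangement $\mathcal{A}$ is called a realization. The moduli space is $\mathcal{M}_{\mathcal{A}}=\mathcal{T}_{\mathcal{A}}/PGL(3,\mathbb{C})$, where $\mathcal{T}_{\mathcal{A}}\subset((\mathbb{CP}^2)^* )^{10}$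 is the set of $10$-tuples $(P_1,\dots,P_{10})$ of distinct points of the dual plane such that, for distinct $i,j,k$, $\det(P_i,P_j,P_k)=0$ if $\{L_i,L_j,L_k\}$ is a triple point of $C$ and $\det(P_i,P_j,P_k)\neq0$ otherwise. Let $\mathcal{M}^{\mathbb{C}}_{\mathcal{A}}$ be the quotient of $\mathcal{M}_{\mathcal{A}}$ by complex conjugation. A configuration is called a potential Zariski pair if it is geometrically realizable and $\mathcal{M}^{\mathbb{C}}_{\mathcal{A}}$ is not irreducible, i.e. $\mathcal{M}_{\mathcal{A}}$ is neither irreducible nor the union of two complex conjugate irreducible components. *)

(* Defs.v *)
From HB Require Import structures.
From mathcomp Require Import all_boot all_order all_fingroup all_algebra.
From mathcomp Require Import generic_quotient complex mpoly.
From mathcomp Require Import all_classical reals.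
From mathcomp Require Import topology.

Set Implicit Arguments.
Unset Strict Implicit.
Unset Printing Implicit Defensive.

Import GRing.Theory Num.Theory.

(* The line L_(i+1) is represented by i : 'I_10, and a triple point by the    *)
(* set of the three lines through it.                                         *)
Notation triples := {set {set 'I_10}} (only parsing).

Local Open Scope set_scope.

Definition ten_line_configuration (T : triples) : bool :=
  [&& [forall t in T, #|t| == 3%N],
      [forall i, forall j, (i != j) ==>
         (#|[set t in T | (i \in t) && (j \in t)]| <= 1)%N]
    & [forall i, (3 <= #|[set t in T | i \in t]|)%N]].

Definition isomorphic (T T' : triples) : bool :=
  [exists s : {perm 'I_10}, [set s @: (t : {set 'I_10}) | t in T] == T'].

Definition triple_point (T : triples) (i j k : 'I_10) : bool :=
  [set i; j; k] \in T.

(* The line denoted by the digit d, 0 standing for L_10.                      *)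
Definition line_of_digit (d : nat) : 'I_10 := inord ((d + 9) %% 10).

(* The triple point denoted by the three-digit string n.                      *)
Definition triple_of (n : nat) : {set 'I_10} :=
  [set line_of_digit (n %/ 100); line_of_digit ((n %/ 10) %% 10);
       line_of_digit (n %% 10)].

Definition triples_of (s : seq nat) : triples :=
  [set t in [seq triple_of n | n <- s]].

Definition nine_configurations : seq triples := map triples_of
  [:: [:: 123; 159; 168; 247; 289; 348; 357; 456; 679; 250; 360; 140];
      [:: 123; 159; 168; 247; 289; 348; 357; 456; 679; 580; 360; 140];
      [:: 123; 147; 169; 248; 257; 359; 368; 456; 789; 340; 670; 290];
      [:: 123; 147; 169; 248; 257; 359; 368; 456; 789; 490; 370; 150];
      [:: 124; 157; 168; 258; 269; 360; 345; 379; 590; 780; 467; 489];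
      [:: 124; 135; 160; 279; 258; 389; 367; 780; 490; 457; 468; 569];
      [:: 124; 135; 260; 178; 279; 367; 389; 490; 580; 457; 468; 569];
      [:: 124; 135; 260; 179; 278; 367; 389; 490; 580; 457; 468; 569];
      [:: 124; 135; 236; 167; 189; 259; 270; 378; 390; 458; 460]].

Local Close Scope set_scope.
Local Open Scope classical_set_scope.
Local Open Scope ring_scope.
Local Open Scope quotient_scope.

Definition irreducible_space (X : topologicalType) : Prop :=
  [set: X] !=set0 /\
  forall A B : set X, closed A -> closed B -> A `|` B = setT ->
    A = setT \/ B = setT.

Definition proj_point (F : fieldType) : Type :=
  {V : {vspace 'rV[F]_3} | \dim V == 1%N}.
Definition proj_line (F : fieldType) : Type :=
  {V : {vspace 'rV[F]_3} | \dim V == 2%N}.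

HB.instance Definition _ (F : fieldType) := Choice.on (proj_point F).
HB.instance Definition _ (F : fieldType) := Choice.on (proj_line F).

Definition incident (F : fieldType) (p : proj_point F) (l : proj_line F) :=
  (val p <= val l)%VS.

Definition realizable (R : realType) (T : triples) : Prop :=
  exists L : 'I_10 -> proj_line R[i], injective L /\
    forall i j k : 'I_10, i != j -> i != k -> j != k ->
      (exists p, [/\ incident p (L i), incident p (L j) & incident p (L k)])
      <-> triple_point T i j k.

(* The space ((CP^2)^* )^10: a point [a : b : c] of the dual plane is the     *)
(* line of C^3 spanned by the coefficient vector (a, b, c).                   *)
Definition dual_tuple (R : realType) : Type := {ffun 'I_10 -> proj_point R[i]}.
HB.instance Definition _ (R : realType) := Choice.on (dual_tuple R).

(* Row i consists of homogeneous coordinates of the point P i.                *)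
Definition hcoord (R : realType) (P : dual_tuple R) : 'M[R[i]]_(10, 3) :=
  \matrix_(i < 10, j < 3) vpick (val (P i)) 0 j.

(* Polynomials in the 10 * 3 homogeneous coordinates; the variable attached   *)
(* to the coordinate j of the point i has index mxvec_index i j.              *)
Definition multihomogeneous (R : realType) (f : {mpoly R[i][10 * 3]}) : Prop :=
  exists d : 'I_10 -> nat, forall m, m \in msupp f ->
    forall i, (\sum_(j < 3) m (mxvec_index i j) = d i)%N.

Definition eval_at (R : realType) (f : {mpoly R[i][10 * 3]}) (P : dual_tuple R) : R[i] :=
  f.@[fun k => mxvec (hcoord P) 0 k].

Definition zariski_closed (R : realType) (Z : set (dual_tuple R)) : Prop :=
  exists F : set {mpoly R[i][10 * 3]}, (forall f, F f -> multihomogeneous f) /\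
    Z = [set P | forall f, F f -> eval_at f P = 0].

Definition zariski_open (R : realType) (U : set (dual_tuple R)) : Prop :=
  zariski_closed (~` U).

Section ZariskiTopology.
Variable R : realType.
Implicit Types (f g : {mpoly R[i][10 * 3]}) (U V : set (dual_tuple R)).

Lemma multihomogeneous1 : multihomogeneous (1 : {mpoly R[i][10 * 3]}).
Proof.
exists (fun=> 0%N) => m; rewrite msupp1 inE => /eqP -> i.
by rewrite big1 // => j _; rewrite mnm0E.
Qed.

Lemma multihomogeneousM f g :
  multihomogeneous f -> multihomogeneous g -> multihomogeneous (f * g).
Proof.
move=> [d hd] [e he]; exists (fun i => (d i + e i)%N) => m.
move=> /msuppM_le /allpairsP[[m1 m2] /= [m1f m2g ->]] i.
rewrite -(hd _ m1f) -(he _ m2g) -big_split /=.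
by apply: eq_bigr => j _; rewrite mnmDE.
Qed.

Lemma zariski_openT : zariski_open [set: dual_tuple R].
Proof.
exists [set 1]; split=> [f ->|]; first exact: multihomogeneous1.
apply/seteqP; split=> P //= /(_ 1 erefl) /eqP.
by rewrite /eval_at meval1 oner_eq0.
Qed.

Lemma zariski_openI U V :
  zariski_open U -> zariski_open V -> zariski_open (U `&` V).
Proof.
move=> [F [hF UE]] [G [hG VE]].
exists [set h | exists f g, [/\ F f, G g & h = f * g]]; split.
  by move=> _ [f [g [Ff Gg ->]]]; apply: multihomogeneousM; [apply: hF|apply: hG].
rewrite setCI UE VE; apply/seteqP; split=> P /=.
  move=> [hP|hP] _ [f [g [Ff Gg ->]]]; rewrite /eval_at mevalM.
    by move: (hP f Ff); rewrite /eval_at => ->; rewrite mul0r.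
  by move: (hP g Gg); rewrite /eval_at => ->; rewrite mulr0.
move=> hP; have [hF0|/existsNP[f /not_implyP[Ff f0]]] :=
  pselect (forall f, F f -> eval_at f P = 0); first by left.
right=> g Gg; have /eqP := hP (f * g) (ex_intro _ f (ex_intro _ g (And3 Ff Gg erefl))).
rewrite /eval_at mevalM mulf_eq0 => /orP[/eqP|/eqP //].
by move/f0.
Qed.

Lemma zariski_open_bigU (I : Type) (U : I -> set (dual_tuple R)) :
  (forall i, zariski_open (U i)) -> zariski_open (\bigcup_i U i).
Proof.
move=> oU; exists [set f | multihomogeneous f /\
  exists i, forall P, ~ U i P -> eval_at f P = 0]; split=> [f []//|].
apply/seteqP; split=> P /=.
  by move=> hP f [_ [i hf]]; apply: hf => UP; apply: hP; exists i.
move=> hP [i _ UP]; have [F [hF UE]] := oU i.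
suff : (~` U i) P by apply.
rewrite UE => f Ff; apply: hP; split; first exact: hF.
by exists i => Q; rewrite -[~ _]/((~` U i) Q) UE; apply.
Qed.

HB.instance Definition _ := isOpenTopological.Build (dual_tuple R)
  zariski_openT zariski_openI zariski_open_bigU.

End ZariskiTopology.

Fact conj_point_subproof (R : realType) (p : proj_point R[i]) :
  \dim <[map_mx Num.conj (vpick (val p))]>%VS == 1%N.
Proof.
by rewrite dim_vline eqb1 map_mx_eq0 vpick0 -dimv_eq0 (eqP (valP p)).
Qed.

Definition conj_point (R : realType) (p : proj_point R[i]) : proj_point R[i] :=
  exist (fun V => \dim V == 1%N) _ (conj_point_subproof p).

Definition conj_tuple (R : realType) (P : dual_tuple R) : dual_tuple R :=
  [ffun i => conj_point (P i)].

Definition realization_space (R : realType) (T : triples) : set (dual_tuple R) :=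
  [set P : dual_tuple R | injective P /\
    forall i j k : 'I_10, i != j -> i != k -> j != k ->
      \det (rowsub (tnth [tuple i; j; k]) (hcoord P)) = 0
      <-> triple_point T i j k].

Section Conjugation.
Variable R : realType.
Implicit Types (p : proj_point R[i]) (P : dual_tuple R).

Lemma proj_pointE p : val p = <[vpick (val p)]>%VS.
Proof.
apply/esym/eqP; rewrite eqEdim -memvE memv_pick dim_vline vpick0 -dimv_eq0.
by rewrite (eqP (valP p)).
Qed.

Lemma conj_pointE p v :
  val p = <[v]>%VS -> val (conj_point p) = <[map_mx Num.conj v]>%VS.
Proof.
move=> pE; rewrite /=; have /vlineP[c cE] : vpick (val p) \in <[v]>%VS.
  by rewrite -pE memv_pick.
rewrite cE map_mxZ; apply/eqP; rewrite eqEdim -memvE memvZ ?memv_line //=.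
rewrite -map_mxZ -cE (eqP (conj_point_subproof p)).
by rewrite dim_vline leq_b1.
Qed.

Lemma conj_pointK : involutive (@conj_point R).
Proof.
move=> p; apply: val_inj; rewrite (conj_pointE (v := map_mx Num.conj (vpick (val p)))) //.
rewrite [RHS]proj_pointE; congr <[_]>%VS.
by apply/matrixP => i j; rewrite !mxE conjCK.
Qed.

Lemma conj_tupleK : involutive (@conj_tuple R).
Proof. by move=> P; apply/ffunP => i; rewrite !ffunE conj_pointK. Qed.

Lemma hcoord_conj P : exists2 c : 'rV[R[i]]_10, (forall i, c 0 i != 0) &
  hcoord (conj_tuple P) = diag_mx c *m map_mx Num.conj (hcoord P).
Proof.
have h i : exists c : R[i], c != 0 /\
    vpick (val (conj_point (P i))) = c *: map_mx Num.conj (vpick (val (P i))).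
  have /vlineP[c cE] : vpick (val (conj_point (P i))) \in
      <[map_mx Num.conj (vpick (val (P i)))]>%VS by exact: memv_pick.
  exists c; split=> //; apply/eqP => c0; move/eqP: cE.
  by rewrite c0 scale0r vpick0 -dimv_eq0 (eqP (valP (conj_point (P i)))).
have [c hc] := choice h.
exists (\row_i c i) => [i|]; first by rewrite mxE; case: (hc i).
apply/matrixP => i j; rewrite mul_diag_mx !mxE ffunE.
by have [_ ->] := hc i; rewrite !mxE.
Qed.

Lemma realization_space_conj T P :
  realization_space T P -> realization_space T (conj_tuple P).
Proof.
move=> [Pinj Pdet]; split=> [i j|i j k ij ik jk].
  by rewrite !ffunE => /(inv_inj conj_pointK); apply: Pinj.
rewrite -Pdet //; have [c c0 ->] := hcoord_conj P.
set f := tnth _.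
have -> : rowsub f (diag_mx c *m map_mx Num.conj (hcoord P)) =
    diag_mx (\row_a c 0 (f a)) *m map_mx Num.conj (rowsub f (hcoord P)).
  by apply/matrixP => a b; rewrite mxE !mul_diag_mx !mxE.
rewrite det_mulmx det_diag det_map_mx; split=> [/eqP|->]; last by rewrite rmorph0 mulr0.
rewrite mulf_eq0 fmorph_eq0 prodf_seq_eq0 => /orP[/hasP[a _]|/eqP //].
by rewrite mxE (negPf (c0 _)).
Qed.

End Conjugation.

Section Moduli.
Variables (R : realType) (T : triples).
Local Notation TA := (set_type (@realization_space R T)).
Implicit Types P Q : TA.

(* The matrix g acts by v |-> v *m g on the coefficient vectors of lines; as  *)
(* g runs over a group, this gives the same orbits as the action on lines     *)
(* induced by the action of PGL(3, C) on CP^2.                                *)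
Definition pgl_equiv P Q : bool :=
  `[< exists2 g : 'M[R[i]]_3, g \in unitmx &
      forall i, val (val Q i) = (linfun (mulmxr g) @: val (val P i))%VS >].

Lemma pgl_equiv_refl : reflexive pgl_equiv.
Proof.
move=> P; apply/asboolP; exists 1%:M; first exact: unitmx1.
move=> i; rewrite -[LHS]lim1g; congr (_ @: _)%VS.
by apply/lfunP => v; rewrite id_lfunE lfunE /= mulmx1.
Qed.

Lemma pgl_equiv_sym : ssrbool.symmetric pgl_equiv.
Proof.
suff h P Q : pgl_equiv P Q -> pgl_equiv Q P.
  by move=> P Q; apply/idP/idP; apply: h.
move=> /asboolP[g gu h]; apply/asboolP; exists (invmx g).
  by rewrite unitmx_inv.
move=> i; rewrite h -limg_comp -[LHS]lim1g; congr (_ @: _)%VS.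
by apply/lfunP => v; rewrite id_lfunE comp_lfunE !lfunE /= mulmxK.
Qed.

Lemma pgl_equiv_trans : transitive pgl_equiv.
Proof.
move=> Q P S /asboolP[g gu h] /asboolP[g' gu' h']; apply/asboolP.
exists (g *m g'); first by rewrite unitmx_mul gu.
move=> i; rewrite h' h -limg_comp; congr (_ @: _)%VS.
by apply/lfunP => v; rewrite comp_lfunE !lfunE /= mulmxA.
Qed.

Canonical pgl_equiv_rel :=
  EquivRel pgl_equiv pgl_equiv_refl pgl_equiv_sym pgl_equiv_trans.

Definition moduli_space :=
  quotient_topology {eq_quot pgl_equiv_rel}.

Definition conj_realization P : TA :=
  exist _ (conj_tuple (val P)) (mem_set (realization_space_conj (set_valP P))).

(* The involution induced by complex conjugation on the moduli space.         *)
Definition conj_moduli (x : moduli_space) : moduli_space :=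
  \pi_moduli_space (conj_realization (repr x)).

Lemma pgl_equiv_conj P Q :
  pgl_equiv P Q -> pgl_equiv (conj_realization P) (conj_realization Q).
Proof.
move=> /asboolP[g gu h]; apply/asboolP; exists (map_mx Num.conj g).
  by rewrite map_unitmx.
move=> i; rewrite !ffunE [in RHS](conj_pointE (proj_pointE _)).
rewrite (@conj_pointE _ _ (vpick (val (val P i)) *m g)).
  by rewrite limg_line lfunE /= map_mxM.
by rewrite h [in LHS]proj_pointE limg_line lfunE.
Qed.

Lemma conj_moduli_pi P :
  conj_moduli (\pi_moduli_space P) = \pi_moduli_space (conj_realization P).
Proof.
apply/eqmodP; apply: pgl_equiv_conj; apply/(@eqmodP _ pgl_equiv_rel).
by rewrite reprK.
Qed.

Lemma conj_realizationK : involutive conj_realization.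
Proof. by move=> P; apply: val_inj; rewrite /= conj_tupleK. Qed.

Lemma conj_moduliK : involutive conj_moduli.
Proof.
by move=> x; rewrite conj_moduli_pi conj_realizationK reprK.
Qed.

Definition conj_equiv (x y : moduli_space) : bool :=
  (x == y) || (x == conj_moduli y).

Lemma conj_equiv_refl : reflexive conj_equiv.
Proof. by move=> x; rewrite /conj_equiv eqxx. Qed.

Lemma conj_equiv_sym : ssrbool.symmetric conj_equiv.
Proof.
move=> x y; rewrite /conj_equiv eq_sym; congr (_ || _).
by rewrite [RHS]eq_sym (can2_eq conj_moduliK conj_moduliK).
Qed.

Lemma conj_equiv_trans : transitive conj_equiv.
Proof.
move=> y x z; rewrite /conj_equiv => /orP[]/eqP-> /orP[]/eqP->.
- by rewrite eqxx.
- by rewrite eqxx orbT.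
- by rewrite eqxx orbT.
- by rewrite conj_moduliK eqxx.
Qed.

Canonical conj_equiv_rel :=
  EquivRel conj_equiv conj_equiv_refl conj_equiv_sym conj_equiv_trans.

Definition moduli_space_conj :=
  quotient_topology {eq_quot conj_equiv_rel}.

End Moduli.

Definition potential_zariski_pair (R : realType) (T : triples) : Prop :=
  realizable R T /\ ~ irreducible_space (moduli_space_conj R T).

(* Main.v *)
(** A configuration is a potential Zariski pair iff its realizations are covered
by two proper closed subsets stable under projectivities and conjugation.

Every ten-line configuration is reached by choosing, up to relabelling, the
triple points on one line after another; this leaves 65 configurations.

When four lines in general position are sent to a projective frame, the other
lines of each configuration are determined by at most three parameters, which
satisfy at most one further equation. For 56 of the configurations there is no
solution, or there is no equation, or the equation is irreducible (it is linear
in the last parameter, or quadratic with a discriminant of odd degree), or it is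
quadratic with complex conjugate roots; in these cases the realizations cannot
be covered as above. For each of the nine remaining ones, a parameter is a
quotient of products of 3 x 3 determinants which is a root of a separable
integral polynomial f with a real root alpha and another root: the realizations
where this quotient is alpha, and those where it is a root of f / (X - alpha),
form the two closed subsets. *)

From Stdlib Require List.
From Stdlib Require Import BinInt.
Require Import Defs.
From HB Require Import structures.
From mathcomp Require Import all_boot all_order all_fingroup all_algebra.
From mathcomp Require Import generic_quotient complex mpoly.
From mathcomp Require Import all_classical reals topology.
From mathcomp Require Import ssrZ zify ring.

Set Implicit Arguments.
Unset Strict Implicit.
Unset Printing Implicit Defensive.

Import Order.TTheory GRing.Theory Num.Theory.

Local Open Scope classical_set_scope.
Local Open Scope ring_scope.
Local Open Scope quotient_scope.

(** * Zariski-closed subsets of the moduli space *)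

Section ModuliTopology.
Variables (R : realType) (T : {set {set 'I_10}}).
Local Notation TA := (set_type (@realization_space R T)).
Implicit Types (Z : set (dual_tuple R)).

(** Closed subsets are known only through multihomogeneous polynomials in thirty coordinates, and
    the moduli space has no coordinates of its own. Polynomials are therefore pulled back to the
    parameters: a cover by two closed sets becomes a product of two polynomials vanishing on an open
    part of a hypersurface in affine 3-space, and primality of its equation, away from the zeros of
    the leading coefficient, makes one factor vanish. For complex conjugate roots the hypersurface
    is replaced by one half, X = w: a stable set that misses a realization also misses one with X =
    w. In the reducible case alpha must be real, so that both factors have real coefficients and
    their loci are stable under conjugation. Facts about a single configuration are integral
    polynomial identities, given as certificates and tested on coefficient lists. The relabellings
    used in the classification are searched for without proof and checked afterwards; only the
    non-isomorphism of the nine requires a search proved complete. *)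

Definition stable Z : Prop :=
  (forall P Q : TA, pgl_equiv P Q -> Z (val P) -> Z (val Q)) /\
  (forall P : TA, Z (val P) -> Z (conj_tuple (val P))).

Definition moduli_class (P : TA) : moduli_space_conj R T :=
  \pi_(moduli_space_conj R T) (\pi_(moduli_space R T) P).

Lemma moduli_class_surj x : exists P, x = moduli_class P.
Proof.
exists (repr (repr x : moduli_space R T)).
by rewrite /moduli_class !reprK.
Qed.

Lemma moduli_class_pgl P Q : pgl_equiv P Q -> moduli_class P = moduli_class Q.
Proof.
move=> PQ; rewrite /moduli_class; congr (\pi _).
exact/(@eqmodP _ (pgl_equiv_rel R T)).
Qed.

Lemma moduli_class_conj P : moduli_class (conj_realization P) = moduli_class P.
Proof.
apply/(@eqmodP _ (conj_equiv_rel R T)).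
by rewrite /= /conj_equiv conj_moduli_pi eqxx orbT.
Qed.

Lemma moduli_classP P Q : moduli_class P = moduli_class Q ->
  pgl_equiv P Q \/ pgl_equiv P (conj_realization Q).
Proof.
move/(@eqmodP _ (conj_equiv_rel R T)); rewrite /= /conj_equiv.
by case/orP=> /eqP; rewrite ?conj_moduli_pi;
  move/(@eqmodP _ (pgl_equiv_rel R T)); [left|right].
Qed.

(** Open sets pass through both quotients by preimage and through the subspace by restriction, so
    only the trace of [Z] on the realization space matters. *)
Lemma closed_moduliP (A : set (moduli_space_conj R T)) : closed A <->
  exists2 Z, zariski_closed Z & forall P, A (moduli_class P) <-> Z (val P).
Proof.
rewrite -openC; split.
  case=> U oU UE; exists (~` U); first by move: oU; rewrite /open /= /zariski_open.
  move=> P; have UP : U (val P) = (~ A (moduli_class P)).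
    exact: (congr1 (fun B : set TA => B P) UE).
  by rewrite /setC /= UP notK.
case=> Z cZ AZ; exists (~` Z); first by rewrite /open /= /zariski_open setCK.
apply/seteqP; split=> P /= nZ.
  by move=> /AZ.
by move=> /AZ; apply: nZ.
Qed.

Lemma irreducible_moduli : (exists P : dual_tuple R, realization_space T P) ->
  (forall Z Z', zariski_closed Z -> zariski_closed Z' -> stable Z -> stable Z' ->
    realization_space (R := R) T `<=` Z `|` Z' ->
    realization_space (R := R) T `<=` Z \/ realization_space (R := R) T `<=` Z') ->
  irreducible_space (moduli_space_conj R T).
Proof.
move=> [P TP] irr; split; first by exists (moduli_class (exist _ P (mem_set TP))).
have stableE (A : set (moduli_space_conj R T)) Z :
    (forall P, A (moduli_class P) <-> Z (val P)) -> stable Z.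
  move=> AZ; split=> [Q Q' QQ' /AZ|Q /AZ]; first by rewrite (moduli_class_pgl QQ') => /AZ.
  by rewrite -moduli_class_conj => /AZ.
have fullE (A : set (moduli_space_conj R T)) Z :
    (forall P, A (moduli_class P) <-> Z (val P)) ->
    realization_space T `<=` Z -> A = setT.
  move=> AZ TZ; apply/seteqP; split=> // x _.
  have [Q ->] := moduli_class_surj x; apply/AZ; apply: TZ; exact: set_valP.
move=> A B /closed_moduliP[Z cZ AZ] /closed_moduliP[Z' cZ' BZ'] AB.
have [||||Q TQ|TZ|TZ'] := irr Z Z' => //; try exact: stableE; last 2 first.
- by left; apply: fullE TZ.
- by right; apply: fullE TZ'.
have : (A `|` B) (moduli_class (exist _ Q (mem_set TQ))) by rewrite AB.
by case=> [/AZ|/BZ']; [left|right].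
Qed.

Lemma reducible_moduli Z Z' : zariski_closed Z -> zariski_closed Z' ->
  stable Z -> stable Z' -> realization_space T `<=` Z `|` Z' ->
  (exists2 P, realization_space T P & ~ Z P) ->
  (exists2 P, realization_space T P & ~ Z' P) ->
  ~ irreducible_space (moduli_space_conj R T).
Proof.
move=> cZ cZ' sZ sZ' TZZ' [P TP nZP] [P' TP' nZP'] [_ irr].
pose cl Y : set (moduli_space_conj R T) :=
  [set x | exists2 Q, x = moduli_class Q & Y (val Q)].
(* Stability makes the trace of [Y] saturated, so membership of a class can be read off any
   representative. *)
have clE Y : stable Y -> forall Q, cl Y (moduli_class Q) <-> Y (val Q).
  move=> [sY sYc] Q; split=> [[Q' /moduli_classP QQ' YQ']|YQ]; last by exists Q.
  case: QQ' => [|QQ']; first by rewrite pgl_equiv_sym => /sY; apply.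
  apply: (sY (conj_realization Q')); first by rewrite pgl_equiv_sym.
  exact: sYc.
have {irr} := irr (cl Z) (cl Z') _ _ _.
case.
- by apply/closed_moduliP; exists Z => //; apply: clE.
- by apply/closed_moduliP; exists Z' => //; apply: clE.
- apply/seteqP; split=> // x _; have [Q ->] := moduli_class_surj x.
  by case: (TZZ' (val Q)); [exact: set_valP|left; apply/clE|right; apply/clE].
- move/(congr1 (fun B => B (moduli_class (exist _ P (mem_set TP))))) => /= e.
  by apply: nZP; apply/(clE Z sZ (exist _ P (mem_set TP))); rewrite e.
- move/(congr1 (fun B => B (moduli_class (exist _ P' (mem_set TP'))))) => /= e.
  by apply: nZP'; apply/(clE Z' sZ' (exist _ P' (mem_set TP'))); rewrite e.
Qed.

End ModuliTopology.

(** * Coordinates *)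

Local Notation vec F := (F * F * F)%type.

Section Determinants.

(** Vectors are triples rather than rows, so that [ring] sees an explicit polynomial and [pdet] can
    mirror it. *)
Definition vdet (F : comNzRingType) (u v w : vec F) : F :=
  u.1.1 * (v.1.2 * w.2 - v.2 * w.1.2) - u.1.2 * (v.1.1 * w.2 - v.2 * w.1.1)
  + u.2 * (v.1.1 * w.1.2 - v.1.2 * w.1.1).

Definition vscale (F : comNzRingType) (c : F) (u : vec F) : vec F :=
  (c * u.1.1, c * u.1.2, c * u.2).

Definition mrow (F : Type) m (A : 'M[F]_(m, 3)) (i : 'I_m) : vec F :=
  (A i 0, A i 1, A i 2%:R).

Definition row_of (F : Type) (u : vec F) : 'rV[F]_3 :=
  \row_(j < 3) if j == 0 then u.1.1 else if j == 1 then u.1.2 else u.2.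

Definition vmul (F : comNzRingType) (u : vec F) (M : 'M[F]_3) : vec F :=
  mrow (row_of u *m M) 0.

Lemma row_ofK (F : Type) (u : vec F) : mrow (row_of u) 0 = u.
Proof. by case: u => [[x y] z]; rewrite /mrow !mxE. Qed.

Lemma ord3P (P : 'I_3 -> Prop) : P 0 -> P 1 -> P 2%:R -> forall j, P j.
Proof.
by move=> P0 P1 P2 [[|[|[|//]]] lj]; [move: P0|move: P1|move: P2];
  congr P; apply: val_inj.
Qed.

Lemma mrowK (F : Type) m (A : 'M[F]_(m, 3)) i : row_of (mrow A i) = row i A.
Proof. by apply/rowP; apply: ord3P; rewrite !mxE. Qed.

Lemma row_of_inj (F : Type) : injective (@row_of F).
Proof. by move=> u v /(congr1 (fun A => mrow A 0)); rewrite !row_ofK. Qed.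

Lemma row_of_scale (F : comNzRingType) (c : F) u :
  row_of (vscale c u) = c *: row_of u.
Proof. by apply/rowP; apply: ord3P; rewrite !mxE. Qed.

Lemma row_of_vmul (F : comNzRingType) (u : vec F) M :
  row_of (vmul u M) = row_of u *m M.
Proof. by rewrite mrowK; apply/rowP => j; rewrite mxE. Qed.

Lemma sum_ord3 (F : nmodType) (f : 'I_3 -> F) : \sum_j f j = f 0 + f 1 + f 2%:R.
Proof.
rewrite !big_ord_recl big_ord0 addr0 addrA.
by congr (f _ + f _ + f _); apply: val_inj.
Qed.

Lemma vmulE (F : comNzRingType) (u : vec F) M : vmul u M =
  let c j := u.1.1 * M 0 j + u.1.2 * M 1 j + u.2 * M 2%:R j in (c 0, c 1, c 2%:R).
Proof. by rewrite /vmul /mrow !mxE !sum_ord3 !mxE. Qed.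

Lemma det_mx3 (F : comNzRingType) (A : 'M[F]_3) :
  \det A = vdet (mrow A 0) (mrow A 1) (mrow A 2%:R).
Proof.
rewrite (expand_det_row _ 0) sum_ord3 /cofactor.
have det2 (B : 'M[F]_2) : \det B = B 0 0 * B 1 1 - B 0 1 * B 1 0.
  rewrite (expand_det_row _ 0) big_ord_recl big_ord1 /cofactor !det_mx11 !mxE /=.
  rewrite expr0 expr1 mul1r mulN1r mulrN.
  by congr (_ * B _ _ - B _ _ * B _ _); apply: val_inj.
rewrite !det2 !mxE /vdet /= expr0 expr1 sqrrN expr1n !mulN1r.
have l00 : lift 0 0 = 1 :> 'I_3 by apply: val_inj.
have l01 : lift 0 1 = 2%:R :> 'I_3 by apply: val_inj.
have l10 : lift 1 0 = 0 :> 'I_3 by apply: val_inj.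
have l11 : lift 1 1 = 2%:R :> 'I_3 by apply: val_inj.
have l20 : lift 2%:R 0 = 0 :> 'I_3 by apply: val_inj.
have l21 : lift 2%:R 1 = 1 :> 'I_3 by apply: val_inj.
by rewrite l00 l01 l10 l11 l20 l21; ring.
Qed.

Lemma det_rowsub (F : comNzRingType) m (A : 'M[F]_(m, 3)) i j k :
  \det (rowsub (tnth [tuple i; j; k]) A) = vdet (mrow A i) (mrow A j) (mrow A k).
Proof. by rewrite det_mx3 /mrow !mxE. Qed.

Lemma vdet_vmul (F : comNzRingType) (u v w : vec F) M :
  vdet (vmul u M) (vmul v M) (vmul w M) = vdet u v w * \det M.
Proof. by rewrite det_mx3 !vmulE /vdet /=; ring. Qed.

Lemma vdet_scale (F : comNzRingType) (a b c : F) u v w :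
  vdet (vscale a u) (vscale b v) (vscale c w) = a * b * c * vdet u v w.
Proof. by rewrite /vdet /=; ring. Qed.

Lemma vscaleA (F : comNzRingType) (a b : F) u :
  vscale a (vscale b u) = vscale (a * b) u.
Proof. by rewrite /vscale /= !mulrA. Qed.

(** Four vectors of a 3-space satisfy the linear relation given by Cramer's rule; its coefficient at
    [k] is [vdet u v w]. *)
Lemma vdet_cramer (F : comNzRingType) (u v w k : vec F) : vdet u v w = 0 ->
  vscale (vdet u v k) w =
  (vdet w v k * u.1.1 + vdet u w k * v.1.1,
   vdet w v k * u.1.2 + vdet u w k * v.1.2,
   vdet w v k * u.2 + vdet u w k * v.2).
Proof.
move=> uvw0; rewrite /vscale; congr (_, _, _); apply/eqP; rewrite -subr_eq0; apply/eqP.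
- by transitivity (vdet u v w * k.1.1); [rewrite /vdet; ring|rewrite uvw0 mul0r].
- by transitivity (vdet u v w * k.1.2); [rewrite /vdet; ring|rewrite uvw0 mul0r].
- by transitivity (vdet u v w * k.2); [rewrite /vdet; ring|rewrite uvw0 mul0r].
Qed.

Lemma vdet_conj (F F' : comNzRingType) (f : {rmorphism F -> F'}) (u v w : vec F) :
  let g x := (f x.1.1, f x.1.2, f x.2) in
  vdet (g u) (g v) (g w) = f (vdet u v w).
Proof. by rewrite /vdet /= rmorphD !rmorphB !rmorphM !rmorphB !rmorphM. Qed.

Lemma vdet_perm (F : comNzRingType) (u v w : vec F) :
  (vdet v u w = - vdet u v w) * (vdet u w v = - vdet u v w).
Proof. by split; rewrite /vdet; ring. Qed.

End Determinants.

(** * Realizations given by coordinate vectors *)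

Section Realizations.
Variable R : realType.
Local Notation C := R[i].
Implicit Types (T : {set {set 'I_10}}) (P Q : dual_tuple R).

Definition realizes (F : comNzRingType) T (a : 'I_10 -> vec F) : Prop :=
  forall i j k, i != j -> i != k -> j != k ->
    vdet (a i) (a j) (a k) = 0 <-> triple_point T i j k.

(** This nondegeneracy lets the determinant conditions alone imply that the vectors are nonzero and
    pairwise non-proportional. *)
Definition spread T : Prop :=
  forall i j, i != j -> exists k, [/\ i != k, j != k & ~~ triple_point T i j k].

Fact base_point_subproof : \dim <[const_mx 1 : 'rV[C]_3]>%VS == 1%N.
Proof.
rewrite dim_vline eqb1; apply/eqP => /rowP /(_ 0) /eqP.
by rewrite !mxE oner_eq0.
Qed.

(** Default value for [insubd], reached only from the zero vector, which [spread] rules out for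
    realizations. *)
Definition base_point : proj_point C :=
  exist (fun V => \dim V == 1%N) _ base_point_subproof.

Definition tuple_of (a : 'I_10 -> vec C) : dual_tuple R :=
  [ffun i => insubd base_point <[row_of (a i)]>%VS].

Lemma val_tuple_of a i : row_of (a i) != 0 -> val (tuple_of a i) = <[row_of (a i)]>%VS.
Proof. by move=> ai0; rewrite ffunE insubdK // unfold_in /= dim_vline ai0. Qed.

Lemma vpick_neq0 (p : proj_point C) : vpick (val p) != 0.
Proof. by rewrite vpick0 -dimv_eq0 (eqP (valP p)). Qed.

Lemma hcoord_neq0 P i : row_of (mrow (hcoord P) i) != 0.
Proof.
rewrite mrowK; suff -> : row i (hcoord P) = vpick (val (P i)) by exact: vpick_neq0.
by apply/rowP => j; rewrite !mxE.
Qed.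

Lemma val_hcoord P i : val (P i) = <[row_of (mrow (hcoord P) i)]>%VS.
Proof.
rewrite mrowK {1}proj_pointE; congr <[_]>%VS.
by apply/rowP => j; rewrite !mxE.
Qed.

Lemma eq_vline (u v : 'rV[C]_3) : u != 0 -> v != 0 ->
  <[u]>%VS = <[v]>%VS -> exists2 c : C, c != 0 & u = c *: v.
Proof.
move=> u0 v0 uv; have /vlineP[c uE] : u \in <[v]>%VS by rewrite -uv memv_line.
by exists c => //; apply: contraNneq u0 => c0; rewrite uE c0 scale0r.
Qed.

Lemma vline_scale (c : C) (u : 'rV[C]_3) : c != 0 -> <[c *: u]>%VS = <[u]>%VS.
Proof.
move=> c0; apply/eqP; rewrite eqEdim -memvE memvZ ?memv_line //=.
by rewrite !dim_vline scaler_eq0 (negPf c0).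
Qed.

(** [vpick] selects an unspecified generator of each line, so coordinates are recovered only up to
    one scalar per index. *)
Lemma hcoord_tuple_of a : (forall i, row_of (a i) != 0) ->
  exists2 c : 'I_10 -> C, forall i, c i != 0 &
    forall i, mrow (hcoord (tuple_of a)) i = vscale (c i) (a i).
Proof.
move=> a0; have h i : exists c : C, c != 0 /\
    mrow (hcoord (tuple_of a)) i = vscale c (a i).
  have [|c c0 cE] := eq_vline (hcoord_neq0 (tuple_of a) i) (a0 i).
    by rewrite -val_hcoord val_tuple_of.
  by exists c; split=> //; apply: row_of_inj; rewrite row_of_scale.
by have [c hc] := choice h; exists c => i; case: (hc i).
Qed.

Lemma realization_spaceP T P :
  realization_space T P <-> injective P /\ realizes T (mrow (hcoord P)).
Proof.
by split=> -[Pinj h]; split=> // i j k ij ik jk; have := h i j k ij ik jk; rewrite det_rowsub.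
Qed.

Lemma realizes_scale T (c : 'I_10 -> C) a :
  (forall i, c i != 0) -> realizes T a -> realizes T (fun i => vscale (c i) (a i)).
Proof.
move=> c0 aT i j k ij ik jk; rewrite -aT // vdet_scale.
split=> [/eqP|->]; last by rewrite mulr0.
by rewrite !mulf_eq0 !(negPf (c0 _)) => /eqP.
Qed.

Lemma realizes_mul T (M : 'M[C]_3) a :
  M \in unitmx -> realizes T a -> realizes T (fun i => vmul (a i) M).
Proof.
rewrite unitmxE unitfE => M0 aT i j k ij ik jk; rewrite -aT // vdet_vmul.
by split=> [/eqP|->]; rewrite ?mul0r // mulf_eq0 (negPf M0) orbF => /eqP.
Qed.

Lemma vdet_dep (c : C) (u v w : vec C) : row_of u = c *: row_of v -> vdet u v w = 0.
Proof. by rewrite -row_of_scale => /row_of_inj ->; rewrite /vdet /=; ring. Qed.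

Lemma realizes_neq0 T (a : 'I_10 -> vec C) : spread T -> realizes T a -> forall i, row_of (a i) != 0.
Proof.
move=> sT aT i; apply/eqP => ai0.
have [j ij] : exists j : 'I_10, i != j.
  by have [->|i0] := eqVneq i ord0; [exists ord_max | exists ord0].
have [k [ik jk /negP]] := sT i j ij; apply; apply/aT => //.
by apply: (@vdet_dep 0); rewrite scale0r.
Qed.

(** If points [i] and [j] coincided, every determinant containing both would vanish, while [spread]
    provides a [k] for which it must not. *)
Lemma tuple_of_realizes T (a : 'I_10 -> vec C) :
  spread T -> realizes T a -> realization_space T (tuple_of a).
Proof.
move=> sT aT; have a0 := realizes_neq0 sT aT; apply/realization_spaceP; split=> [i j|].
  move=> /(congr1 val); rewrite !val_tuple_of // => /(eq_vline (a0 _) (a0 _))[c _ cE].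
  apply/eqP/negPn/negP => ij; have [k [ik jk /negP]] := sT i j ij.
  by apply; apply/aT => //; apply: vdet_dep cE.
have [c c0 cE] := hcoord_tuple_of a0.
by rewrite (_ : mrow _ = fun i => vscale (c i) (a i)); [apply: realizes_scale|apply/funext].
Qed.

End Realizations.

(** * Lines of the plane and their coefficient vectors *)

Section Realizability.
Variable R : realType.
Local Notation C := R[i].
Implicit Types (T : {set {set 'I_10}}).

Definition normal_to (V : {vspace 'rV[C]_3}) (n : vec C) : Prop :=
  forall v : vec C, (row_of v \in V) =
    (v.1.1 * n.1.1 + v.1.2 * n.1.2 + v.2 * n.2 == 0).

Definition cross (u v : vec C) : vec C :=
  (u.1.2 * v.2 - u.2 * v.1.2, u.2 * v.1.1 - u.1.1 * v.2, u.1.1 * v.1.2 - u.1.2 * v.1.1).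

Lemma exists_normal (V : {vspace 'rV[C]_3}) : \dim V = 2 -> exists n, normal_to V n.
Proof.
move=> dV; have := vbasisP V; move: (vbasis V); rewrite dV => -[[|x [|y []]] //= _] B.
have /andP[xy y0] : (x \notin <[y]>%VS) && (y != 0).
  by rewrite -span_seq1 -seq1_free -free_cons (basis_free B).
pose u := mrow x 0; pose w := mrow y 0; exists (cross u w) => v.
have rowE (z : 'rV_3) : row_of (mrow z 0) = z.
  by rewrite mrowK; apply/rowP => j; rewrite mxE.
have dotE : v.1.1 * (cross u w).1.1 + v.1.2 * (cross u w).1.2 + v.2 * (cross u w).2
    = vdet u w v by rewrite /vdet /=; ring.
rewrite dotE -(span_basis B); apply/idP/eqP.
  rewrite span_cons span_seq1 => /memv_addP[_ /vlineP[a ->] [_ /vlineP[b ->] vE]].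
  have -> : v = mrow (a *: x + b *: y) 0 by rewrite -vE row_ofK.
  by rewrite /vdet /= !mxE; ring.
(* Cramer's rule puts [v] in the plane once some [k] is independent of [u] and [w]. Otherwise the
   unit vectors show that all 2 x 2 minors vanish, and [x] is a multiple of [y]. *)
move=> uwv0; have [k k0] : exists k, vdet u w k != 0.
  apply/not_existsP => h; have {}h k : vdet u w k = 0.
    by apply/eqP/negPn/negP => /h.
  have h0 := h (1, 0, 0); have h1 := h (0, 1, 0); have h2 := h (0, 0, 1).
  have crossE j l : x 0 j * y 0 l = x 0 l * y 0 j.
    apply/eqP; rewrite -subr_eq0; apply/eqP.
    move: j l; apply: ord3P; apply: ord3P => //=; rewrite ?subrr //.
    - by rewrite -h2 /vdet /=; ring.
    - by rewrite -[RHS]oppr0 -h1 /vdet /=; ring.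
    - by rewrite -[RHS]oppr0 -h2 /vdet /=; ring.
    - by rewrite -h0 /vdet /=; ring.
    - by rewrite -h1 /vdet /=; ring.
    - by rewrite -[RHS]oppr0 -h0 /vdet /=; ring.
  case/rV0Pn: y0 => j yj0; case/negP: xy; apply/vlineP; exists (x 0 j / y 0 j).
  by apply/rowP => l; rewrite mxE mulrAC (crossE j l) mulfK.
have := vdet_cramer k uwv0; set d := vdet u w k in k0 *.
move=> /(congr1 (@row_of _)); rewrite row_of_scale => /(canRL (scalerK k0)) ->.
rewrite memvZ //; set a := vdet v w k; set b := vdet u v k.
suff -> : row_of (a * u.1.1 + b * w.1.1, a * u.1.2 + b * w.1.2, a * u.2 + b * w.2)
    = a *: x + b *: y.
  by rewrite rpredD // memvZ // memv_span // !inE eqxx ?orbT.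
by apply/rowP; apply: ord3P; rewrite !mxE.
Qed.

Definition normal_line (n : vec C) : {vspace 'rV[C]_3} :=
  lker (linfun (mulmxr (row_of n)^T) : 'Hom('rV[C]_3, 'rV[C]_1)).

Lemma normal_lineP n : normal_to (normal_line n) n.
Proof.
move=> v; rewrite memv_ker lfunE /=; apply/eqP/eqP.
  by move/rowP => /(_ 0); rewrite !mxE sum_ord3 !mxE.
by move=> h; apply/rowP => j; rewrite !mxE sum_ord3 !mxE.
Qed.

Lemma dim_normal_line n : row_of n != 0 -> \dim (normal_line n) = 2.
Proof.
move=> n0; have := limg_ker_dim (linfun (mulmxr (row_of n)^T) : 'Hom('rV[C]_3, 'rV[C]_1)) fullv.
rewrite capfv dimvf -/(normal_line n).
set g := linfun _; suff -> : \dim (g @: fullv) = 1 by rewrite addn1 => -[].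
apply/eqP; rewrite eqn_leq; apply/andP; split.
  by have := dimvS (subvf (g @: fullv)); rewrite dimvf /dim /= muln1.
rewrite lt0n dimv_eq0; apply: contraNneq n0 => g0; apply/eqP/rowP => j.
have : g (delta_mx 0 j) \in (g @: fullv)%VS by rewrite memv_img ?memvf.
rewrite g0 memv0 lfunE /= => /eqP/rowP/(_ 0).
rewrite !mxE (bigD1 j) //= big1 ?addr0; first by rewrite !mxE !eqxx mul1r => ->.
by move=> l lj; rewrite !mxE (negPf lj) andbF mul0r.
Qed.

(** A common point is a nonzero vector killed by the three coefficient vectors, and it exists
    exactly when their matrix is singular. *)
Lemma concurrentP (L : 'I_10 -> proj_line C) (a : 'I_10 -> vec C) i j k :
  (forall i, normal_to (val (L i)) (a i)) ->
  (exists p, [/\ incident p (L i), incident p (L j) & incident p (L k)]) <->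
  vdet (a i) (a j) (a k) = 0.
Proof.
move=> La; pose N : 'M[C]_3 := \matrix_(x, y) row_of (a (tnth [tuple i; j; k] x)) 0 y.
have <- : \det N^T = vdet (a i) (a j) (a k).
  by rewrite det_tr det_mx3 /mrow !mxE /=; case: (a i) => [[]]; case: (a j) => [[]];
    case: (a k) => [[]].
have inL l v : (v \in val (L l)) = (v *m (row_of (a l))^T == 0).
  have -> : v = row_of (mrow v 0) by rewrite mrowK; apply/rowP => y; rewrite mxE.
  rewrite La; apply/eqP/eqP => [h|/rowP/(_ 0)]; last by rewrite !mxE sum_ord3 !mxE.
  by apply/rowP => y; rewrite !mxE sum_ord3 !mxE.
have mulN v : v *m N^T = \row_x (v *m (row_of (a (tnth [tuple i; j; k] x)))^T) 0 0.
  by apply/rowP => x; rewrite !mxE; apply: eq_bigr => y _; rewrite !mxE.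
split=> [[p [pi pj pk]]|/eqP/det0P[v v0 vN]].
  apply/eqP/det0P; exists (vpick (val p)); first exact: vpick_neq0.
  have inp l : incident p (L l) -> vpick (val p) *m (row_of (a l))^T = 0.
    by move=> pl; apply/eqP; rewrite -inL; apply: (subvP pl); apply: memv_pick.
  by rewrite mulN; apply/rowP; apply: ord3P; rewrite mxE /= inp // !mxE.
pose p : proj_point C := insubd (base_point R) <[v]>%VS.
have pE : val p = <[v]>%VS by rewrite insubdK // unfold_in /= dim_vline v0.
have inp (x : 'I_3) : incident p (L (tnth [tuple i; j; k] x)).
  rewrite /incident pE -memvE inL; apply/eqP/rowP => y; rewrite ord1.
  by have /rowP/(_ x) := vN; rewrite mulN mxE => ->; rewrite !mxE.
by exists p; split; [exact: (inp 0)|exact: (inp 1)|exact: (inp 2%:R)].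
Qed.

Lemma realizableP T : spread T ->
  realizable R T <-> exists a : 'I_10 -> vec C, realizes T a.
Proof.
move=> sT; split=> [[L [_ LT]]|[a aT]].
  have [a ha] := choice (fun i => exists_normal (eqP (valP (L i)))).
  by exists a => i j k ij ik jk; rewrite -LT //; split; move/(concurrentP i j k ha).
have a0 := realizes_neq0 sT aT.
pose L i : proj_line C := exist (fun V => \dim V == 2) _ (introT eqP (dim_normal_line (a0 i))).
have La i : normal_to (val (L i)) (a i) by exact: normal_lineP.
exists L; split=> [i j Lij|i j k ij ik jk]; last by rewrite -aT //; exact: concurrentP.
(* If lines [i] and [j] were equal, the cross product of [a i] and [a k] would also lie on [j],
   making [i], [j], [k] concurrent. *)
apply/eqP/negPn/negP => ij; have [k [ik jk /negP]] := sT i j ij; apply; apply/aT => //.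
have : row_of (cross (a i) (a k)) \in val (L i).
  by rewrite La; apply/eqP; rewrite /=; ring.
by rewrite Lij La => /eqP h; rewrite -[RHS]oppr0 -h /vdet /=; ring.
Qed.

Definition reducible_realizations T : Prop :=
  exists Z Z' : set (dual_tuple R), [/\ [/\ zariski_closed Z, zariski_closed Z',
    stable T Z & stable T Z'], @realization_space R T `<=` Z `|` Z',
    (exists2 P, realization_space T P & ~ Z P) &
    (exists2 P, realization_space T P & ~ Z' P)].

(** Realizability is contained in the right hand side, which exhibits a realization outside [Z]. *)
Lemma potential_zariski_pairP T : spread T ->
  potential_zariski_pair R T <-> reducible_realizations T.
Proof.
move=> sT; split=> [[/(realizableP sT)[a aT]]|]; last first.
  case=> Z [Z' [[cZ cZ' sZ sZ'] TZZ' nZ nZ']]; split; last exact: (reducible_moduli cZ cZ').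
  apply/realizableP => //; case: nZ => P /realization_spaceP[_ PT] _.
  by exists (mrow (hcoord P)).
move=> nirr; apply: contra_notP nirr => nred; apply: irreducible_moduli.
  by exists (tuple_of a); apply: tuple_of_realizes.
move=> Z Z' cZ cZ' sZ sZ' TZZ'; apply: contra_notP nred => /not_orP[nZ nZ'].
exists Z, Z'; split=> //.
  by move/existsNP: nZ => [P /not_implyP[]]; exists P.
by move/existsNP: nZ' => [P /not_implyP[]]; exists P.
Qed.

End Realizability.

(** * Relabelling *)

Section Relabelling.
Variable R : realType.
Local Notation C := R[i].
Implicit Types (T : {set {set 'I_10}}) (s : {perm 'I_10}).

Definition relabel T s : {set {set 'I_10}} := [set s @: (t : {set 'I_10}) | t in T]%SET.

Lemma isomorphicP T T' : reflect (exists s, relabel T s = T') (isomorphic T T').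
Proof. by apply: (iffP existsP) => -[s /eqP]; exists s => //; apply/eqP. Qed.

Lemma imset_set3 s i j k : s @: [set i; j; k]%SET = [set s i; s j; s k]%SET.
Proof. by rewrite !imsetU !imset_set1. Qed.

Lemma relabel_comp T s s' : relabel (relabel T s) s' = relabel T (s * s')%g.
Proof.
rewrite /relabel -imset_comp; apply: eq_imset => t /=.
by rewrite -imset_comp; apply: eq_imset => i; rewrite permM.
Qed.

Lemma relabel1 T : relabel T 1%g = T.
Proof.
rewrite /relabel -[RHS]imset_id; apply: eq_imset => t.
by rewrite -[RHS]imset_id; apply: eq_imset => i; rewrite perm1.
Qed.

Lemma relabelK T s : relabel (relabel T s) s^-1%g = T.
Proof. by rewrite relabel_comp mulgV relabel1. Qed.

Lemma isomorphic_sym T T' : isomorphic T T' -> isomorphic T' T.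
Proof. by case/isomorphicP=> s <-; apply/isomorphicP; exists s^-1%g; rewrite relabelK. Qed.

Lemma triple_point_relabel T s i j k :
  triple_point (relabel T s) (s i) (s j) (s k) = triple_point T i j k.
Proof.
rewrite /triple_point -imset_set3 mem_imset //; apply: imset_inj; exact: perm_inj.
Qed.

Definition ffun_perm s (P : dual_tuple R) : dual_tuple R := [ffun i => P (s i)].

Lemma ffun_permK s : cancel (ffun_perm s^-1%g) (ffun_perm s).
Proof. by move=> P; apply/ffunP => i; rewrite !ffunE permK. Qed.

Lemma realization_space_relabel T s P :
  realization_space (relabel T s) P <-> realization_space T (ffun_perm s P).
Proof.
have hE i : mrow (hcoord (ffun_perm s P)) i = mrow (hcoord P) (s i).
  by rewrite /mrow !mxE !ffunE.
split=> /realization_spaceP[Pinj PT]; apply/realization_spaceP; split.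
- by move=> i j; rewrite !ffunE => /Pinj/perm_inj.
- by move=> i j k ij ik jk; rewrite !hE PT ?(inj_eq perm_inj) // triple_point_relabel.
- move=> i j ij; apply: (perm_inj (s := s^-1%g)); apply: Pinj.
  by rewrite !ffunE !permKV.
- move=> i j k ij ik jk; rewrite -(permKV s i) -(permKV s j) -(permKV s k).
  by rewrite triple_point_relabel -!hE PT ?(inj_eq perm_inj).
Qed.

(** Closed sets are given by polynomials, so a relabelling has to act on the variables: it permutes
    the ten groups of three coordinates. *)
Definition index_perm_fun s (k : 'I_(10 * 3)) : 'I_(10 * 3) :=
  let ij := enum_val (cast_ord (esym (mxvec_cast 10 3)) k) in mxvec_index (s ij.1) ij.2.

Lemma index_perm_funE s i j : index_perm_fun s (mxvec_index i j) = mxvec_index (s i) j.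
Proof. by rewrite /index_perm_fun /mxvec_index cast_ordK enum_rankK. Qed.

Lemma index_perm_inj s : injective (index_perm_fun s).
Proof.
apply: (can_inj (g := index_perm_fun s^-1%g)) => k.
by case/mxvec_indexP: k => i j; rewrite !index_perm_funE permK.
Qed.

Definition index_perm s : {perm 'I_(10 * 3)} := perm (@index_perm_inj s).

Lemma eval_msym s f (P : dual_tuple R) :
  eval_at (msym (index_perm s) f) P = eval_at f (ffun_perm s P).
Proof.
rewrite /eval_at /msym /mmap raddf_sum mevalE; apply: eq_bigr => m _.
rewrite /= mevalM mevalC; congr (_ * _); rewrite /mmap1 rmorph_prod.
apply: eq_bigr => k _; rewrite rmorphXn /= mevalXU; congr (_ ^+ _).
by case/mxvec_indexP: k => i j; rewrite permE index_perm_funE !mxvecE !mxE ffunE.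
Qed.

Lemma multihomogeneous_msym s (f : {mpoly C[10 * 3]}) :
  multihomogeneous f -> multihomogeneous (msym (index_perm s) f).
Proof.
move=> [d fd]; exists (fun i => d (s^-1%g i)) => m.
rewrite mcoeff_msupp mcoeff_sym -mcoeff_msupp => /fd fm i.
rewrite -(fm (s^-1%g i)); apply: eq_bigr => j _.
by rewrite mnmE permE index_perm_funE permKV.
Qed.

Lemma zariski_closed_perm s (Z : set (dual_tuple R)) :
  zariski_closed Z -> zariski_closed [set P | Z (ffun_perm s P)].
Proof.
move=> [F [Fh ->]]; exists [set msym (index_perm s) f | f in F]; split.
  by move=> _ [f Ff <-]; apply: multihomogeneous_msym; exact: Fh.
apply/seteqP; split=> P /= h.
  by move=> _ [f Ff <-]; rewrite eval_msym; exact: h.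
by move=> f Ff; rewrite -eval_msym; apply: h; exists f.
Qed.

Let realization T P (TP : realization_space T P) : set_type (@realization_space R T) :=
  exist _ P (mem_set TP).

Lemma stable_perm T s Z :
  stable T Z -> stable (relabel T s) [set P : dual_tuple R | Z (ffun_perm s P)].
Proof.
move=> [sZ sZc]; split=> [P Q /asboolP[g gu PQ]|P] /= ZP.
  have [TP TQ] := (set_valP P, set_valP Q).
  move: TP TQ => /realization_space_relabel TP /realization_space_relabel TQ.
  refine (sZ (realization TP) (realization TQ) _ ZP).
  by apply/asboolP; exists g => // i; rewrite /= !ffunE; exact: PQ.
have TP := set_valP P; move: TP => /realization_space_relabel TP.
have -> : ffun_perm s (conj_tuple (val P)) = conj_tuple (ffun_perm s (val P)).
  by apply/ffunP => i; rewrite !ffunE.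
exact: (sZc (realization TP) ZP).
Qed.

Lemma reducible_relabel T s :
  reducible_realizations R T -> reducible_realizations R (relabel T s).
Proof.
move=> [Z [Z' [[cZ cZ' sZ sZ'] TZZ' [P TP nZP] [P' TP' nZP']]]].
exists [set P | Z (ffun_perm s P)], [set P | Z' (ffun_perm s P)]; split.
- by split; [exact: zariski_closed_perm|exact: zariski_closed_perm| |]; apply: stable_perm.
- by move=> Q /realization_space_relabel /TZZ'.
- exists (ffun_perm s^-1%g P); last by rewrite /= ffun_permK.
  by apply/realization_space_relabel; rewrite ffun_permK.
- exists (ffun_perm s^-1%g P'); last by rewrite /= ffun_permK.
  by apply/realization_space_relabel; rewrite ffun_permK.
Qed.

Lemma reducible_isomorphic T T' : isomorphic T T' ->
  reducible_realizations R T -> reducible_realizations R T'.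
Proof. by case/isomorphicP=> s <-; apply: reducible_relabel. Qed.

End Relabelling.

(** * Polynomial identities by reflection *)

Section PolynomialExpressions.

Inductive pexpr :=
  | Const of Z
  | Var of nat
  | Opp of pexpr
  | Add of pexpr & pexpr
  | Mul of pexpr & pexpr.

(** One interpreter serves both the semantics in a ring and the computation on coefficient lists,
    and soundness becomes a morphism between the two. *)
Record ring_ops (K : Type) := RingOps {
  op_const : Z -> K;
  op_opp : K -> K;
  op_add : K -> K -> K;
  op_mul : K -> K -> K;
  op_is0 : K -> bool }.

Fixpoint interp K (o : ring_ops K) (env : nat -> K) (e : pexpr) : K :=
  match e with
  | Const z => op_const o z
  | Var i => env i
  | Opp e1 => op_opp o (interp o env e1)
  | Add e1 e2 => op_add o (interp o env e1) (interp o env e2)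
  | Mul e1 e2 => op_mul o (interp o env e1) (interp o env e2)
  end.

Definition scalar (F : nzRingType) (z : Z) : F := (int_of_Z z)%:~R.

Lemma scalar0 (F : comNzRingType) : scalar F Z0 = 0.
Proof. by rewrite /scalar rmorph0. Qed.

Lemma scalar1 (F : comNzRingType) : scalar F (Zpos xH) = 1.
Proof. by rewrite /scalar rmorph1. Qed.

Definition ops_of (F : comNzRingType) : ring_ops F :=
  RingOps (@scalar F) -%R +%R *%R (fun x => x == 0).

Definition peval (F : comNzRingType) : (nat -> F) -> pexpr -> F := interp (ops_of F).

(** The zero test is only required to be sound in one direction, so coefficient lists need not be
    normalized. *)
Definition sound_ops K (o : ring_ops K) (F : comNzRingType) (f : K -> F) : Prop :=
  [/\ forall z, f (op_const o z) = scalar F z,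
      forall a, f (op_opp o a) = - f a,
      forall a b, f (op_add o a b) = f a + f b,
      forall a b, f (op_mul o a b) = f a * f b
    & forall a, op_is0 o a -> f a = 0].

Lemma interp_sound K (o : ring_ops K) (F : comNzRingType) (f : K -> F) env e :
  sound_ops o f -> f (interp o env e) = peval (f \o env) e.
Proof.
case=> fc fo fa fm _; elim: e => [z|i|e IH|e IH e' IH'|e IH e' IH'] //=.
- by rewrite fo IH.
- by rewrite fa IH IH'.
- by rewrite fm IH IH'.
Qed.

Definition Z_ops : ring_ops Z := RingOps id Z.opp Z.add Z.mul (Z.eqb Z0).

Lemma Z_ops_sound (F : comNzRingType) : sound_ops Z_ops (@scalar F).
Proof.
rewrite /scalar; split=> //= [a|a b|a b|a].
- by rewrite -[Z.opp a]/(- a) !rmorphN.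
- by rewrite -[Z.add a b]/(a + b) !rmorphD.
- by rewrite -[Z.mul a b]/(a * b) !rmorphM.
- by case: a => // _; rewrite rmorph0.
Qed.

Section DensePolynomials.
Variables (K : Type) (o : ring_ops K).

Fixpoint ladd (p q : seq K) : seq K :=
  match p, q with
  | [::], _ => q
  | _, [::] => p
  | a :: p', b :: q' => op_add o a b :: ladd p' q'
  end.

Fixpoint lmul (p q : seq K) : seq K :=
  if p is a :: p' then
    ladd [seq op_mul o a b | b <- q] (if p' is [::] then [::] else op_const o Z0 :: lmul p' q)
  else [::].

Definition poly_ops : ring_ops (seq K) :=
  RingOps (fun z => [:: op_const o z]) (map (op_opp o)) ladd lmul (all (op_is0 o)).

Definition leval (F : comNzRingType) (f : K -> F) (x : F) (p : seq K) : F :=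
  foldr (fun a s => f a + s * x) 0 p.

Lemma poly_ops_sound (F : comNzRingType) (f : K -> F) (x : F) :
  sound_ops o f -> sound_ops poly_ops (leval f x).
Proof.
case=> fc fo fa fm f0.
have addE p q : leval f x (ladd p q) = leval f x p + leval f x q.
  elim: p q => [|a p IH] [|b q] /=; rewrite ?add0r ?addr0 // fa IH; ring.
split=> //=.
- by move=> z; rewrite mul0r addr0.
- by elim=> [|a p IH] /=; rewrite ?oppr0 // fo IH; ring.
- elim=> [|a p IH] q /=; first by rewrite mul0r.
  rewrite addE mulrDl; congr (_ + _).
    by elim: q => [|b q IHq] /=; rewrite ?mulr0 // fm IHq; ring.
  case: p IH => [|b p] IH; first by rewrite /= !mul0r.
  rewrite [LHS]/= IH fc /scalar rmorph0 /=; ring.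
- elim=> [|a p IH] //= /andP[/f0 -> /IH ->]; ring.
Qed.

End DensePolynomials.

Definition P1_ops := poly_ops Z_ops.
Definition P2_ops := poly_ops P1_ops.
Definition P3_ops := poly_ops P2_ops.

Definition P1_var : seq Z := [:: Z0; Zpos xH].
Definition P2_var (i : nat) : seq (seq Z) :=
  if i is 0%N then [:: P1_var] else [:: [::]; [:: Zpos xH]].
Definition P3_var (i : nat) : seq (seq (seq Z)) :=
  if i is (0 | 1)%N then [:: P2_var i] else [:: [::]; [:: [:: Zpos xH]]].

Definition P1_eval (F : comNzRingType) (x : F) : seq Z -> F := leval (@scalar F) x.
Definition P2_eval (F : comNzRingType) (x : nat -> F) : seq (seq Z) -> F :=
  leval (P1_eval (x 0)) (x 1).
Definition P3_eval (F : comNzRingType) (x : nat -> F) : seq (seq (seq Z)) -> F :=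
  leval (P2_eval x) (x 2%N).

Lemma P1_sound (F : comNzRingType) (x : F) : sound_ops P1_ops (P1_eval x).
Proof. exact/poly_ops_sound/Z_ops_sound. Qed.

Lemma P2_sound (F : comNzRingType) (x : nat -> F) : sound_ops P2_ops (P2_eval x).
Proof. exact/poly_ops_sound/P1_sound. Qed.

Lemma P3_sound (F : comNzRingType) (x : nat -> F) : sound_ops P3_ops (P3_eval x).
Proof. exact/poly_ops_sound/P2_sound. Qed.

Fixpoint all_vars (p : pred nat) (e : pexpr) : bool :=
  match e with
  | Const _ => true
  | Var i => p i
  | Opp e1 => all_vars p e1
  | Add e1 e2 | Mul e1 e2 => all_vars p e1 && all_vars p e2
  end.

Lemma eq_peval (F : comNzRingType) (p : pred nat) (x y : nat -> F) e :
  all_vars p e -> (forall i, p i -> x i = y i) -> peval x e = peval y e.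
Proof.
move=> + xy; rewrite /peval.
elim: e => [z|i|e IH|e IH e' IH'|e IH e' IH'] //=.
- exact: xy.
- by move/IH ->.
- by case/andP=> /IH -> /IH' ->.
- by case/andP=> /IH -> /IH' ->.
Qed.

Lemma peval_morph (F G : comNzRingType) (f : {rmorphism F -> G}) x e :
  f (peval x e) = peval (f \o x) e.
Proof.
rewrite /peval; elim: e => [z|i|e IH|e IH e' IH'|e IH e' IH'] //=.
- exact: rmorph_int.
- by rewrite rmorphN IH.
- by rewrite rmorphD IH IH'.
- by rewrite rmorphM IH IH'.
Qed.

Lemma peval_opp (F : comNzRingType) (x : nat -> F) e : peval x (Opp e) = - peval x e.
Proof. by []. Qed.

Lemma peval_add (F : comNzRingType) (x : nat -> F) e e' :
  peval x (Add e e') = peval x e + peval x e'.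
Proof. by []. Qed.

Lemma peval_mul (F : comNzRingType) (x : nat -> F) e e' :
  peval x (Mul e e') = peval x e * peval x e'.
Proof. by []. Qed.

Lemma peval_const (F : comNzRingType) (x : nat -> F) z : peval x (Const z) = scalar F z.
Proof. by []. Qed.

(** The bound on the variables matters because [P3_var] identifies all those from 2 on. *)
Definition is_zero (e : pexpr) : bool :=
  all_vars (fun i => (i < 3)%N) e && op_is0 P3_ops (interp P3_ops P3_var e).

Lemma is_zeroP (F : comNzRingType) (x : nat -> F) e : is_zero e -> peval x e = 0.
Proof.
case/andP=> e3 e0; have [_ _ _ _ /(_ _ e0)] := P3_sound x.
rewrite (interp_sound _ _ (P3_sound x)) => <-; apply: eq_peval e3 _ => i.
by case: i => [|[|[|//]]] _; rewrite /P3_eval /P2_eval /P1_eval /= ?scalar0 ?scalar1; ring.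
Qed.

Definition Sub e e' := Add e (Opp e').
Definition peq e e' := is_zero (Sub e e').

Lemma peqP (F : comNzRingType) (x : nat -> F) e e' :
  peq e e' -> peval x e = peval x e'.
Proof. by move/(is_zeroP x) => /eqP; rewrite /peval /= subr_eq0 => /eqP. Qed.

Definition pprod : seq pexpr -> pexpr := foldr Mul (Const (Zpos xH)).

Definition pdet (u v w : vec pexpr) : pexpr :=
  Add (Sub (Mul u.1.1 (Sub (Mul v.1.2 w.2) (Mul v.2 w.1.2)))
           (Mul u.1.2 (Sub (Mul v.1.1 w.2) (Mul v.2 w.1.1))))
      (Mul u.2 (Sub (Mul v.1.1 w.1.2) (Mul v.1.2 w.1.1))).

Definition veval (F : comNzRingType) (x : nat -> F) (u : vec pexpr) : vec F :=
  (peval x u.1.1, peval x u.1.2, peval x u.2).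

Lemma peval_det (F : comNzRingType) (x : nat -> F) u v w :
  peval x (pdet u v w) = vdet (veval x u) (veval x v) (veval x w).
Proof. by []. Qed.

End PolynomialExpressions.

(** * Irreducible hypersurfaces *)

Section IrreducibleHypersurface.
Variable C : numClosedFieldType.
Local Notation B2 := {poly {poly C}}.
Local Notation B3 := {poly {poly {poly C}}}.
Implicit Types (x : nat -> C) (a D u v : B2) (F N p q r : B3).

Definition ev2 x : B2 -> C := horner_eval (x 0%N) \o horner_eval (x 1%N)%:P.
HB.instance Definition _ x := GRing.RMorphism.on (ev2 x).
Definition ev3 x : B3 -> C := ev2 x \o horner_eval (x 2%N)%:P%:P.
HB.instance Definition _ x := GRing.RMorphism.on (ev3 x).

Definition gen3 (i : nat) : B3 :=
  match i with 0%N => 'X%:P%:P | 1%N => 'X%:P | _ => 'X end.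

Lemma ev3_gen x i : (i < 3)%N -> ev3 x (gen3 i) = x i.
Proof.
by case: i => [|[|[|//]]] _; rewrite /ev3 /ev2 /= /horner_eval ?(hornerC, hornerX).
Qed.

Lemma ev3C x a : ev3 x a%:P = ev2 x a.
Proof. by rewrite /ev3 /= /horner_eval hornerC. Qed.

Lemma ev2CC x (c : C) : ev2 x c%:P%:P = c.
Proof. by rewrite /ev2 /= /horner_eval !hornerC. Qed.

(** The natural numbers provide more roots than the size of [p] allows. Used one variable at a time,
    this turns vanishing functions into zero polynomials. *)
Lemma poly_vanish (S : idomainType) (p : {poly S}) :
  injective (fun n : nat => n%:R : S) -> (forall n : nat, p.[n%:R] = 0) -> p = 0.
Proof.
move=> inj p0; apply/eqP/negPn/negP => pn0.
have := @max_poly_roots _ p (mkseq (fun n => n%:R) (size p)) pn0.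
rewrite size_mkseq ltnn => h; suff: false by []; apply: h; last exact: mkseq_uniq.
by apply/allP => _ /mapP[n _ ->]; apply/eqP.
Qed.

Lemma natr_inj0 : injective (fun n : nat => n%:R : C).
Proof. by move=> m n /eqP; rewrite eqr_nat => /eqP. Qed.

Lemma natr_inj1 : injective (fun n : nat => n%:R : {poly C}).
Proof.
by move=> m n mn; apply: natr_inj0; apply: (@polyC_inj C); rewrite !polyC_natr.
Qed.

Lemma natr_inj2 : injective (fun n : nat => n%:R : B2).
Proof.
by move=> m n mn; apply: natr_inj1; apply: (@polyC_inj {poly C}); rewrite !polyC_natr.
Qed.

Lemma ev2_eq0 a : (forall x, ev2 x a = 0) -> a = 0.
Proof.
move=> a0; apply: (poly_vanish natr_inj1) => n; apply: (poly_vanish natr_inj0) => m.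
by have := a0 (fun i => if i is 0%N then m%:R else n%:R);
  rewrite /ev2 /= /horner_eval polyC_natr.
Qed.

Lemma ev3_eq0 p : (forall x, ev3 x p = 0) -> p = 0.
Proof.
move=> p0; apply: (poly_vanish natr_inj2) => n; apply: ev2_eq0 => x.
have := p0 (fun i => if i is 2%N then n%:R else x i).
by rewrite /ev3 /ev2 /= /horner_eval !polyC_natr.
Qed.

(* If a is the leading coefficient of F, this says that the part of the     *)
(* hypersurface F = 0 where a does not vanish is irreducible.                *)
Definition prime_on F a : Prop := forall p q,
  (forall x, ev3 x F = 0 -> ev3 x p * ev3 x q = 0) ->
  (forall x, ev3 x F = 0 -> ev2 x a != 0 -> ev3 x p = 0) \/
  (forall x, ev3 x F = 0 -> ev2 x a != 0 -> ev3 x q = 0).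

Lemma prime_on0 : prime_on 0 1.
Proof.
move=> p q pq0; have /eqP : p * q = 0.
  by apply: ev3_eq0 => x; rewrite rmorphM pq0 // rmorph0.
by rewrite mulf_eq0 => /orP[] /eqP ->; [left|right] => x _ _; rewrite rmorph0.
Qed.

(** The coefficients form a polynomial ring, so division costs a power of the leading coefficient;
    this is why primality is claimed only where that coefficient does not vanish. *)
Lemma pseudo_division F p : F != 0 -> exists k r,
  (size r < size F)%N /\
  forall x, ev3 x F = 0 -> ev2 x (lead_coef F) ^+ k * ev3 x p = ev3 x r.
Proof.
move=> F0; exists (scalp p F), (p %% F); split; first exact: ltn_modpN0.
move=> x xF; have /(congr1 (ev3 x)) := Pdiv.Idomain.divp_eq p F.
by rewrite -mul_polyC !(rmorphD, rmorphM) /= xF mulr0 add0r -ev3C rmorphXn /= rmorphXn.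
Qed.

Lemma pseudo_division0 F p k : (forall x, ev3 x F = 0 ->
    ev2 x (lead_coef F) ^+ k * ev3 x p = 0) ->
  forall x, ev3 x F = 0 -> ev2 x (lead_coef F) != 0 -> ev3 x p = 0.
Proof.
move=> h x xF xa; have /eqP := h x xF.
by rewrite mulf_eq0 expf_eq0 (negPf xa) andbF => /eqP.
Qed.

Let point (y : nat -> C) (t : C) : nat -> C := fun i => if i is 2%N then t else y i.

Let ev2_point y t a : ev2 (point y t) a = ev2 y a. Proof. by []. Qed.

Lemma ev3_linear r x : (size r <= 2)%N -> ev3 x r = ev2 x r`_0 + ev2 x r`_1 * x 2%N.
Proof.
move=> r2; rewrite /ev3 /= /horner_eval (horner_coef_wide _ r2).
by rewrite !big_ord_recl big_ord0 addr0 expr0 mulr1 expr1 rmorphD rmorphM /= ev2CC.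
Qed.

Lemma ev3_quadratic r x : (size r <= 3)%N ->
  ev3 x r = ev2 x r`_0 + ev2 x r`_1 * x 2%N + ev2 x r`_2 * x 2%N ^+ 2.
Proof.
move=> r3; rewrite /ev3 /= /horner_eval (horner_coef_wide _ r3).
rewrite !big_ord_recl big_ord0 addr0 expr0 mulr1 expr1 !rmorphD !rmorphM /=.
by rewrite ?rmorphXn /= !ev2CC addrA.
Qed.

(** Modulo [F] both polynomials reduce to remainders free of the last variable. A root exists above
    every [y] where the leading coefficient is nonzero, so the product of the remainders vanishes
    there, and the ring is a domain. *)
Lemma prime_on_linear F : size F = 2 -> prime_on F (lead_coef F).
Proof.
move=> F2 p q pq0; have F0 : F != 0 by rewrite -size_poly_eq0 F2.
have [[k [r [rF pr]]] [l [s [sF qs]]]] := (pseudo_division p F0, pseudo_division q F0).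
rewrite F2 !ltnS in rF sF; have {rF}rE := size1_polyC rF; have {sF}sE := size1_polyC sF.
have /eqP : r`_0 * s`_0 * lead_coef F = 0.
  apply: ev2_eq0 => y; rewrite !rmorphM /=.
  have [->|a0] := eqVneq (ev2 y (lead_coef F)) 0; first by rewrite mulr0.
  pose x := point y (- ev2 y F`_0 / ev2 y (lead_coef F)).
  have xF : ev3 x F = 0.
    rewrite ev3_linear ?F2 // !ev2_point /= /lead_coef F2 /= mulrC divfK ?subrr //.
    by move: a0; rewrite /lead_coef F2.
  have := pr x xF; have := qs x xF; rewrite rE sE !coefC /= !ev3C !ev2_point => <- <-.
  by rewrite mulrACA pq0 // mulr0 mul0r.
rewrite !mulf_eq0 lead_coef_eq0 (negPf F0) orbF => /orP[] /eqP rs0; [left|right].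
  by apply: (@pseudo_division0 F p k) => x xF; rewrite pr // rE rs0 !rmorph0.
by apply: (@pseudo_division0 F q l) => x xF; rewrite qs // sE rs0 !rmorph0.
Qed.

Definition nonsquare D : Prop := forall u v, D * v ^+ 2 = u ^+ 2 -> v = 0.

(** Compare degrees modulo 2 in the last variable: nonzero squares have odd size, whereas an even
    size of [D] means odd degree. *)
Lemma nonsquare_odd_degree D : D != 0 -> ~~ odd (size D) -> nonsquare D.
Proof.
move=> D0 oD u v Dv; apply/eqP/negPn/negP => v0.
have v20 : v ^+ 2 != 0 by rewrite expf_neq0.
have u0 : u != 0.
  by apply: contraNneq v20 => u0; move/eqP: Dv; rewrite u0 expr0n /= mulf_eq0 (negPf D0).
have sq (w : B2) : w != 0 -> odd (size (w ^+ 2)).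
  move=> w0; rewrite expr2 size_mul //; rewrite -size_poly_gt0 in w0.
  by case: (size w) w0 => // n _; rewrite addnn doubleS /= odd_double.
have := sq u u0; rewrite -Dv size_mul // => odd_u.
have := sq v v0; move: odd_u oD; rewrite -size_poly_gt0 in v20.
by case: (size (v ^+ 2)) v20 => // n _; rewrite addnS /= oddD; case: (odd _); case: (odd _).
Qed.

Definition discr F := F`_1 ^+ 2 - 4%:R * (F`_2 * F`_0).

(* With r = v X + u the remainder of p modulo F = a X^2 + b X + c, the norm *)
(* n = a u^2 - b u v + c v^2 of r satisfies 4 a n = (2 a u - b v)^2 -       *)
(* (b^2 - 4 a c) v^2, so it vanishes only if r does.                        *)
Lemma prime_on_quadratic F : size F = 3%N -> nonsquare (discr F) ->
  prime_on F (lead_coef F).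
Proof.
move=> F3 nsq p q pq0; have F0 : F != 0 by rewrite -size_poly_eq0 F3.
have aE : lead_coef F = F`_2 by rewrite /lead_coef F3.
have a0 : F`_2 != 0 by rewrite -aE lead_coef_eq0.
have [[k [r [rF pr]]] [l [s [sF qs]]]] := (pseudo_division p F0, pseudo_division q F0).
rewrite F3 !ltnS in rF sF.
pose norm r := F`_2 * r`_0 ^+ 2 - F`_1 * (r`_0 * r`_1) + F`_0 * r`_1 ^+ 2.
have norm0 (w : B3) : (size w <= 2)%N -> norm w = 0 -> w = 0.
  move=> w2 nw; have w1 : w`_1 = 0.
    apply: (nsq (2%:R * F`_2 * w`_0 - F`_1 * w`_1)); apply/esym/eqP.
    rewrite -subr_eq0; apply/eqP; transitivity (4%:R * F`_2 * norm w).
      by rewrite /norm /discr; ring.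
    by rewrite nw mulr0.
  move/eqP: nw; rewrite /norm w1 !mulr0 expr0n /= mulr0 subr0 addr0.
  rewrite mulf_eq0 (negPf a0) expf_eq0 /= => /eqP w0.
  by apply/polyP => -[|[|i]]; rewrite coef0 // nth_default // (leq_trans w2).
(* Above every [y] with nonzero leading coefficient the quadratic formula gives a root [t]; there
   the product of the remainders vanishes, hence so does the product of their norms. *)
have /eqP : norm r * norm s * F`_2 = 0.
  apply: ev2_eq0 => y; rewrite !rmorphM /=.
  have [->|ya0] := eqVneq (ev2 y F`_2) 0; first by rewrite mulr0.
  set a := ev2 y F`_2 in ya0 *; pose b := ev2 y F`_1; pose c := ev2 y F`_0.
  pose t := (- b + sqrtC (b ^+ 2 - 4%:R * (a * c))) / (2%:R * a).
  have tE : c + b * t + a * t ^+ 2 = 0.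
    have d2 : (2%:R * a * t + b) ^+ 2 = b ^+ 2 - 4%:R * (a * c).
      rewrite /t mulrC divfK ?mulf_neq0 ?pnatr_eq0 // addrAC addNr add0r.
      exact: sqrtCK.
    have : 4%:R * a * (c + b * t + a * t ^+ 2) = 0.
      transitivity ((2%:R * a * t + b) ^+ 2 - (b ^+ 2 - 4%:R * (a * c))); first by ring.
      by rewrite d2 subrr.
    by move/eqP; rewrite !mulf_eq0 (negPf ya0) pnatr_eq0 /= => /eqP.
  pose x := point y t.
  have xF : ev3 x F = 0 by rewrite ev3_quadratic ?F3.
  have normE (w : B3) : (size w <= 2)%N -> exists z, ev2 y (norm w) = ev3 x w * z.
    move=> w2; rewrite ev3_linear // !ev2_point /=.
    set u := ev2 y w`_0; set v := ev2 y w`_1.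
    (* This is [a] times the value of [w] at the other root [- b / a - t]. *)
    exists (a * u - b * v - a * v * t); rewrite /norm !(rmorphD, rmorphB, rmorphM, rmorphN).
    rewrite /= ?rmorphXn /= -/u -/v -/a -/b -/c.
    apply/eqP; rewrite -subr_eq0; apply/eqP.
    by transitivity (v ^+ 2 * (c + b * t + a * t ^+ 2)); [ring|rewrite tE mulr0].
  have [z ->] := normE r rF; have [z' ->] := normE s sF.
  have rs0 : ev3 x r * ev3 x s = 0 by rewrite -pr // -qs // mulrACA pq0 // mulr0.
  by rewrite mulrACA rs0 !mul0r.
rewrite !mulf_eq0 (negPf a0) orbF => /orP[] /eqP rs0; [left|right].
  by apply: (@pseudo_division0 F p k) => x xF; rewrite pr // (norm0 _ rF rs0) rmorph0.
by apply: (@pseudo_division0 F q l) => x xF; rewrite qs // (norm0 _ sF rs0) rmorph0.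
Qed.

(** Multiplying by [N], then by [a], extends the vanishing from the open part [X] to the whole
    hypersurface. Primality is used once to discard [N] and once to separate [p] from [q]. *)
Lemma prime_on_open F a N (X : (nat -> C) -> Prop) p q : prime_on F a ->
  (forall x, X x -> ev3 x F = 0 /\ ev2 x a != 0) ->
  (forall x, X x -> ev3 x N != 0) ->
  (forall x, ev3 x F = 0 -> ev3 x N != 0 -> X x) ->
  (forall x, X x -> ev3 x p * ev3 x q = 0) ->
  (forall x, X x -> ev3 x p = 0) \/ (forall x, X x -> ev3 x q = 0).
Proof.
move=> prF XF XN FX pq0; have [x xF|h|h] := prF (p * q) N.
- have [->|xN] := eqVneq (ev3 x N) 0; first by rewrite mulr0.
  by rewrite rmorphM pq0 ?mul0r //; exact: FX.
- have [x xF|hp|hq] := prF p (q * a%:P).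
  + rewrite rmorphM /= ev3C mulrA; have [->|xa] := eqVneq (ev2 x a) 0; first by rewrite mulr0.
    by rewrite -rmorphM /= h // mul0r.
  + by left=> x /XF[xF xa]; exact: hp.
  + right=> x /XF[xF xa]; have /eqP := hq x xF xa.
    by rewrite rmorphM /= ev3C mulf_eq0 (negPf xa) orbF => /eqP.
- by left=> x Xx; have [xF xa] := XF x Xx; have := XN x Xx; rewrite h ?eqxx.
Qed.

End IrreducibleHypersurface.

(** * Construction of the realizations *)

Section Blocks.

(* The triple point of the lines i, j, k, which are numbered from 0.         *)
Definition block := (nat * nat * nat)%type.

Definition in_block (i : nat) (b : block) : bool :=
  [|| eqn i b.1.1, eqn i b.1.2 | eqn i b.2].

Definition wf_block (b : block) : bool := [&& b.1.1 < b.1.2, b.1.2 < b.2 & b.2 < 10]%N.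

Definition collinear (B : seq block) i j k : bool :=
  has (fun b => [&& in_block i b, in_block j b & in_block k b]) B.

Definition set_of_block (b : block) : {set 'I_10} :=
  [set inord b.1.1; inord b.1.2; inord b.2]%SET.

Definition config_of (B : seq block) : {set {set 'I_10}} :=
  [set t in map set_of_block B]%SET.

Lemma inord_eq (i j : nat) : (i < 10)%N -> (j < 10)%N ->
  (inord i == inord j :> 'I_10) = (i == j).
Proof. by move=> i10 j10; rewrite -val_eqE /= !inordK. Qed.

Lemma in_set_of_block i b : (i < 10)%N -> wf_block b ->
  (inord i \in set_of_block b) = in_block i b.
Proof.
move=> i10 /and3P[b1 b2 b3]; rewrite /set_of_block /in_block !inE !eqnE -orbA.
by rewrite !inord_eq // ?(ltn_trans b2) // (ltn_trans b1) // (ltn_trans b2).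
Qed.

Lemma card_set_of_block b : wf_block b -> #|set_of_block b| = 3%N.
Proof.
move=> /and3P[b1 b2 b3]; have b12 := ltn_trans b1 b2.
by rewrite /set_of_block finset.setUC cardsU1 cards2 !inE !inord_eq //; lia.
Qed.

Lemma card_set3 (i j k : 'I_10) : i != j -> i != k -> j != k ->
  #|[set i; j; k]%SET| = 3%N.
Proof.
move=> ij ik jk; rewrite finset.setUC cardsU1 cards2 !inE ij.
by rewrite ![k == _]eq_sym (negPf ik) (negPf jk).
Qed.

Lemma triple_point_config B i j k : all wf_block B ->
  uniq [:: i; j; k] -> all (fun l => l < 10)%N [:: i; j; k] ->
  triple_point (config_of B) (inord i) (inord j) (inord k) = collinear B i j k.
Proof.
move=> wfB /=; rewrite !inE !negb_or andbT => /andP[/andP[ij ik] jk].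
move=> /and4P[i10 j10 k10 _]; rewrite /triple_point inE.
have s3 : #|[set inord i; inord j; inord k : 'I_10]%SET| = 3%N.
  by rewrite card_set3 ?inord_eq.
apply/mapP/hasP => -[b bB].
  move=> tE; have wb := allP wfB b bB; exists b => //.
  by rewrite -!in_set_of_block // -tE !inE !eqxx !orbT.
move=> bijk; have wb := allP wfB b bB; exists b => //; apply/eqP.
rewrite eqEcard s3 card_set_of_block // andbT; apply/fintype.subsetP => l.
case/and3P: bijk => bi bj bk; have := fun l l10 => @in_set_of_block l b l10 wb.
move: (set_of_block b) => S SE; by rewrite !inE -orbA => /or3P[] /eqP ->; rewrite SE.
Qed.

(** Range and distinctness are tested in both [col] and [noncol], so certificates may apply them to
    arbitrary numbers; the two are not complementary. *)
Definition col (B : seq block) i j k : bool :=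
  [&& uniq [:: i; j; k], all (fun l => l < 10)%N [:: i; j; k] & collinear B i j k].

Definition noncol (B : seq block) i j k : bool :=
  [&& uniq [:: i; j; k], all (fun l => l < 10)%N [:: i; j; k] & ~~ collinear B i j k].

Definition realizes_blocks (F : comNzRingType) (B : seq block) (a : nat -> vec F) : Prop :=
  forall i j k, (col B i j k -> vdet (a i) (a j) (a k) = 0) /\
                (noncol B i j k -> vdet (a i) (a j) (a k) <> 0).

Lemma realizes_blocksP (F : comNzRingType) B (a : 'I_10 -> vec F) : all wf_block B ->
  realizes (config_of B) a <-> realizes_blocks B (fun i => a (inord i)).
Proof.
move=> wfB; split=> [aB i j k|aB i j k ij ik jk].
  have neq : uniq [:: i; j; k] -> all (fun l => l < 10)%N [:: i; j; k] ->
      [/\ inord i != inord j :> 'I_10, inord i != inord k :> 'I_10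
        & inord j != inord k :> 'I_10].
    rewrite /= !inE !negb_or andbT => /andP[/andP[ij ik] jk] /and4P[i10 j10 k10 _].
    by rewrite !inord_eq.
  split=> /and3P[u lt c]; have [ij ik jk] := neq u lt.
    by apply/aB => //; rewrite triple_point_config.
  by move/(aB _ _ _ ij ik jk); rewrite triple_point_config //; exact/negP.
have u : uniq [:: val i; val j; val k] by rewrite /= !inE !negb_or ij ik jk.
have lt : all (fun l => l < 10)%N [:: val i; val j; val k] by rewrite /= !ltn_ord.
have := aB i j k; rewrite /col /noncol u lt -triple_point_config // !inord_val /=.
by case: triple_point => -[h h']; [split=> // _; exact: h|split=> // /(h' isT)].
Qed.

End Blocks.

(** * Step-by-step parametrization from a projective frame *)

Section Parametrization.
Variable B : seq block.

(* [One x a b i]: the line x belongs to the triple point abx; the variable i *)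
(* parametrizes the pencil.                                                  *)
(* [Two x a b c d V g]: the line x belongs to the triple points abx and cdx. *)
(* Its coordinates V are those of the line through these points, up to the   *)
(* common factor g.                                                          *)
Inductive step :=
  | One of nat & nat & nat & nat
  | Two of nat & nat & nat & nat & nat & vec pexpr & pexpr.

Definition table := seq (nat * vec pexpr).

Definition known (t : table) x : bool := has (fun e => e.1 == x) t.

Definition lookup (t : table) (x : nat) : vec pexpr :=
  (nth (0%N, (Const Z0, Const Z0, Const Z0)) t (find (fun e => e.1 == x) t)).2.

Definition vscale_expr (g : pexpr) (u : vec pexpr) : vec pexpr :=
  (Mul g u.1.1, Mul g u.1.2, Mul g u.2).

Definition vadd_expr (u v : vec pexpr) : vec pexpr :=
  (Add u.1.1 v.1.1, Add u.1.2 v.1.2, Add u.2 v.2).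

Definition veq_expr (u v : vec pexpr) : bool :=
  [&& peq u.1.1 v.1.1, peq u.1.2 v.1.2 & peq u.2 v.2].

Definition vall_vars (p : pred nat) (u : vec pexpr) : bool :=
  [&& all_vars p u.1.1, all_vars p u.1.2 & all_vars p u.2].

(** The lines [k] found by [has] make the coefficients in Cramer's rule nonzero. In [One] the
    variable must be fresh, so that assigning it leaves the earlier lines unchanged. In [Two],
    [noncol B a b d] makes the points abx and cdx distinct, and the last test compares [V] with the
    line joining them, det(a, b, d) c - det(a, b, c) d. *)
Definition step_ok (t : table) (s : step) : bool :=
  match s with
  | One x a b i =>
      [&& known t a, known t b, col B a b x,
          all (fun e => vall_vars (fun j => j != i) e.2) t
        & has (fun k => noncol B a b k && noncol B x b k) (iota 0 10)]
  | Two x a b c d V g =>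
      let va := lookup t a in let vb := lookup t b in
      let vc := lookup t c in let vd := lookup t d in
      [&& all (known t) [:: a; b; c; d], col B a b x, col B c d x, noncol B a b d,
          has (fun k => noncol B c d k && noncol B x d k) (iota 0 10)
        & veq_expr (vscale_expr g V)
            (vadd_expr (vscale_expr (pdet va vb vd) vc)
                       (vscale_expr (Opp (pdet va vb vc)) vd))]
  end.

Definition add_line (t : table) (s : step) : table :=
  match s with
  | One x a b i => (x, vadd_expr (lookup t a) (vscale_expr (Var i) (lookup t b))) :: t
  | Two x _ _ _ _ V _ => (x, V) :: t
  end.

Fixpoint steps_ok (t : table) (ss : seq step) : bool :=
  if ss is s :: ss' then step_ok t s && steps_ok (add_line t s) ss' else true.

Definition frame_table (q : nat * nat * nat * nat) : table :=
  let o := Const Z0 in let l := Const (Zpos xH) in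
  [:: (q.1.1.1, (l, o, o)); (q.1.1.2, (o, l, o)); (q.1.2, (o, o, l)); (q.2, (l, l, l))].

Definition frame_ok (q : nat * nat * nat * nat) : bool :=
  let: (q0, q1, q2, q3) := q in
  [&& noncol B q0 q1 q2, noncol B q3 q1 q2, noncol B q3 q2 q0 & noncol B q3 q0 q1].

Definition construction (q : nat * nat * nat * nat) (ss : seq step) : table :=
  foldl add_line (frame_table q) ss.

Definition construction_ok q ss : bool :=
  [&& frame_ok q, steps_ok (frame_table q) ss,
      all (known (construction q ss)) (iota 0 10)
    & all (fun e => vall_vars (fun i => i < 3)%N e.2) (construction q ss)].

Variable F : fieldType.
Implicit Types (a : nat -> vec F) (x : nat -> F) (t : table).

(** Equality up to one scalar per line; [List.In] is used as [pexpr] carries no decidable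
    equality. *)
Definition matches a x t : Prop :=
  forall e, List.In e t -> exists2 c, c != 0 & a e.1 = vscale c (veval x e.2).

Lemma lookup_in t y : known t y -> List.In (y, lookup t y) t.
Proof.
rewrite /known /lookup; elim: t => //= -[z u] t IH /=.
by case: eqP => [-> _|_ /IH]; [left|right].
Qed.

Lemma matches_lookup a x t y : matches a x t -> known t y ->
  exists2 c, c != 0 & a y = vscale c (veval x (lookup t y)).
Proof. by move=> m /lookup_in /m. Qed.

Lemma veval_ext (x x' : nat -> F) p u :
  vall_vars p u -> (forall i, p i -> x i = x' i) -> veval x u = veval x' u.
Proof.
by move=> /and3P[u1 u2 u3] xx'; rewrite /veval !(eq_peval _ xx').
Qed.

Definition vadd (u v : vec F) : vec F := (u.1.1 + v.1.1, u.1.2 + v.1.2, u.2 + v.2).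

Lemma veval_add x u v : veval x (vadd_expr u v) = vadd (veval x u) (veval x v).
Proof. by []. Qed.

Lemma veval_scale x g u : veval x (vscale_expr g u) = vscale (peval x g) (veval x u).
Proof. by []. Qed.

Lemma vscale1 (u : vec F) : vscale 1 u = u.
Proof. by case: u => [[y z] w]; rewrite /vscale /= !mul1r. Qed.

Lemma step_sound a x t s : realizes_blocks B a -> matches a x t -> step_ok t s ->
  exists x', matches a x' (add_line t s).
Proof.
move=> aB m; case: s => [y b c i|y b c d e V g]; rewrite /step_ok.
  case/and5P=> kb kc bcy fresh /hasP[k _ /andP[bck yck]].
  have [[cb cb0 bE] [cc cc0 cE]] := (matches_lookup m kb, matches_lookup m kc).
  have bcy0 := (aB b c y).1 bcy.
  have d1 : vdet (a b) (a c) (a k) != 0 by apply/eqP; exact: (aB b c k).2.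
  have d2 : vdet (a y) (a c) (a k) != 0 by apply/eqP; exact: (aB y c k).2.
  (* Quotient of the Cramer coefficients of [a y] with respect to [a c] and [a b], corrected by the
     scalars between [a] and the table. *)
  pose w := vdet (a b) (a y) (a k) * cc / (vdet (a y) (a c) (a k) * cb).
  pose x' j := if j == i then w else x j; exists x'.
  have xx' u : List.In u t -> veval x' u.2 = veval x u.2.
    move=> ut; apply: (@veval_ext _ _ (fun j => j != i)).
      by elim: t fresh ut {m kb kc bE cE} => //= h t IH /andP[h1 /IH h2] [<-|/h2].
    by move=> j; rewrite /x' => /negPf ->.
  move=> u [<-|ut]; last by have [z z0 zE] := m _ ut; exists z; rewrite ?xx'.
  exists (vdet (a y) (a c) (a k) * cb / vdet (a b) (a c) (a k)).
    by rewrite !mulf_neq0 ?invr_eq0.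
  have xb : veval x' (lookup t b) = veval x (lookup t b) by exact: (xx' _ (lookup_in kb)).
  have xc : veval x' (lookup t c) = veval x (lookup t c) by exact: (xx' _ (lookup_in kc)).
  have := vdet_cramer (a k) bcy0.
  set v := vdet _ _ (a k) in d1 *; set v' := vdet _ _ (a k) in d2 w x' xx' xb xc *.
  set v'' := vdet _ _ (a k) in w x' xx' xb xc *.
  rewrite bE cE -xb -xc => /(congr1 (vscale v^-1)); rewrite vscaleA mulVf //.
  rewrite vscale1 => ->; rewrite veval_add veval_scale /vscale /vadd /=.
  have -> : peval x' (Var i) = w by rewrite /peval /= /x' eqxx.
  by congr (_, _, _); rewrite /w; field; rewrite d1 d2 cb0.
case/and5P=> /and5P[kb kc kd ke _] bcy dey bce /andP[/hasP[k _ /andP[dek yek]] /and3P[e1 e2 e3]].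
have [[cb cb0 bE] [cc cc0 cE]] := (matches_lookup m kb, matches_lookup m kc).
have [[cd cd0 dE] [ce ce0 eE]] := (matches_lookup m kd, matches_lookup m ke).
have bcy0 := (aB b c y).1 bcy; have dey0 := (aB d e y).1 dey.
have d1 : vdet (a b) (a c) (a e) != 0 by apply/eqP; exact: (aB b c e).2.
have d2 : vdet (a d) (a e) (a k) != 0 by apply/eqP; exact: (aB d e k).2.
have d3 : vdet (a y) (a e) (a k) != 0 by apply/eqP; exact: (aB y e k).2.
have cramer := vdet_cramer (a k) dey0.
(* Substituting Cramer's expression for [a y] into [vdet (a b) (a c) (a y) = 0] relates its two
   coefficients, so that only one of them remains. *)
have rel : vdet (a y) (a e) (a k) * vdet (a b) (a c) (a d) +
    vdet (a d) (a y) (a k) * vdet (a b) (a c) (a e) = 0.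
  transitivity (vdet (a b) (a c) (vscale (vdet (a d) (a e) (a k)) (a y))).
    by rewrite cramer /vdet /=; ring.
  by rewrite -[RHS](mulr0 (vdet (a d) (a e) (a k))) -bcy0 /vdet /=; ring.
have gV : vscale (peval x g) (veval x V) =
    veval x (vadd_expr
      (vscale_expr (pdet (lookup t b) (lookup t c) (lookup t e)) (lookup t d))
      (vscale_expr (Opp (pdet (lookup t b) (lookup t c) (lookup t d))) (lookup t e))).
  by rewrite /veval -(peqP x e1) -(peqP x e2) -(peqP x e3).
pose r := vdet (a y) (a e) (a k) * cb * cc * cd * ce /
  (vdet (a d) (a e) (a k) * vdet (a b) (a c) (a e)).
have r0 : r != 0 by rewrite !mulf_neq0 ?invr_eq0 ?mulf_neq0.
have yE : a y = vscale (r * peval x g) (veval x V).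
  rewrite -vscaleA gV.
  have := congr1 (vscale (vdet (a b) (a c) (a e))) cramer; rewrite vscaleA.
  move/(congr1 (vscale (vdet (a b) (a c) (a e) * vdet (a d) (a e) (a k))^-1)).
  rewrite vscaleA mulVf ?mulf_neq0 // vscale1 => ->.
  have relE : vdet (a d) (a y) (a k) =
      - (vdet (a y) (a e) (a k) * vdet (a b) (a c) (a d)) / vdet (a b) (a c) (a e).
    by apply: (mulIf d1); rewrite divfK //; apply/eqP; rewrite -addr_eq0 addrC rel.
  rewrite relE /r; set z := vdet (a y) _ _; set z' := vdet (a d) _ _ in d2 *.
  have bcdE u cu w : a u = vscale cu w -> vdet (a b) (a c) (a u) =
      cb * cc * cu * vdet (veval x (lookup t b)) (veval x (lookup t c)) w.
    by move=> ->; rewrite bE cE vdet_scale.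
  have := d1; rewrite (bcdE _ _ _ dE) (bcdE _ _ _ eE) => {}d1.
  have {}d1 : vdet (veval x (lookup t b)) (veval x (lookup t c)) (veval x (lookup t e)) != 0.
    by apply: contraNneq d1 => ->; rewrite mulr0.
  rewrite veval_add !veval_scale peval_opp !peval_det.
  rewrite dE eE /vscale /vadd /=.
  set p := vdet _ _ _ in d1 *; set q := vdet _ _ _.
  by congr (_, _, _); field; rewrite d1 d2 cb0 cc0 ce0.
(* If the common factor vanished, [a y] would be zero, against [d3]. *)
have g0 : peval x g != 0.
  apply: contraNneq d3 => g0; rewrite yE g0 mulr0 /vdet /=; apply/eqP; ring.
by exists x => u [<-|/m //] /=; exists (r * peval x g) => //; exact: mulf_neq0.
Qed.

Lemma steps_sound a x t ss : realizes_blocks B a -> matches a x t -> steps_ok t ss ->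
  exists x', matches a x' (foldl add_line t ss).
Proof.
move=> aB; elim: ss t x => [|s ss IH] t x m /=; first by exists x.
by case/andP=> /(step_sound aB m)[x' m'] /(IH _ x' m').
Qed.

Lemma frame_sound a q : realizes_blocks B a -> frame_ok q ->
  exists2 M : 'M[F]_3, M \in unitmx &
    forall x, matches (fun i => vmul (a i) M) x (frame_table q).
Proof.
move=> aB; case: q => [[[q0 q1] q2] q3] /and4P[d d0 d1 d2].
have {}d : vdet (a q0) (a q1) (a q2) != 0 by apply/eqP; exact: (aB q0 q1 q2).2.
have {}d0 : vdet (a q3) (a q1) (a q2) != 0 by apply/eqP; exact: (aB q3 q1 q2).2.
have {}d1 : vdet (a q3) (a q2) (a q0) != 0 by apply/eqP; exact: (aB q3 q2 q0).2.
have {}d2 : vdet (a q3) (a q0) (a q1) != 0 by apply/eqP; exact: (aB q3 q0 q1).2.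
pose e (i : 'I_3) : vec F :=
  if i == 0 then (1, 0, 0) else if i == 1 then (0, 1, 0) else (0, 0, 1).
(* The columns are the coordinate forms of the basis [a q0], [a q1], [a q2], normalized to take the
   value 1 at [a q3]. *)
pose M : 'M[F]_3 := \matrix_(i, j)
  (if j == 0 then vdet (e i) (a q1) (a q2) / vdet (a q3) (a q1) (a q2) else
   if j == 1 then vdet (e i) (a q2) (a q0) / vdet (a q3) (a q2) (a q0) else
   vdet (e i) (a q0) (a q1) / vdet (a q3) (a q0) (a q1)).
have ME u : vmul u M = (vdet u (a q1) (a q2) / vdet (a q3) (a q1) (a q2),
    vdet u (a q2) (a q0) / vdet (a q3) (a q2) (a q0),
    vdet u (a q0) (a q1) / vdet (a q3) (a q0) (a q1)).
  rewrite vmulE /= !mxE /= /e /=; congr (_, _, _); rewrite !mulrA -!mulrDl; congr (_ / _).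
  - by rewrite /vdet /=; ring.
  - by rewrite /vdet /=; ring.
  - by rewrite /vdet /=; ring.
have cyc (u v w : vec F) : vdet u v w = vdet v w u by rewrite /vdet; ring.
have dup (u v : vec F) : vdet u v u = 0 by rewrite /vdet; ring.
have dup' (u v : vec F) : vdet u u v = 0 by rewrite /vdet; ring.
have diag p r s : vdet (p, 0, 0) (0, r, 0) (0, 0, s) = p * r * s :> F.
  by rewrite /vdet /=; ring.
have d' : vdet (a q1) (a q2) (a q0) != 0 by rewrite -cyc.
have d'' : vdet (a q2) (a q0) (a q1) != 0 by rewrite -cyc.
exists M.
  rewrite unitmxE unitfE; have := vdet_vmul (a q0) (a q1) (a q2) M.
  rewrite !ME !dup !dup' !mul0r => h; apply: contraTneq isT => M0.
  by move: h => /eqP; rewrite M0 mulr0 diag !mulf_eq0 !invr_eq0 (negPf d) (negPf d') (negPf d'') (negPf d0) (negPf d1) (negPf d2).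
move=> x u.
rewrite /frame_table /= => -[<-|[<-|[<-|[<-|[]]]]];
  rewrite [X in a X]/= /veval !peval_const ?scalar0 scalar1 ME ?dup ?dup' ?mul0r.
- exists (vdet (a q0) (a q1) (a q2) / vdet (a q3) (a q1) (a q2)); first by rewrite mulf_neq0 ?invr_eq0.
  by rewrite /vscale !mulr0 mulr1.
- exists (vdet (a q1) (a q2) (a q0) / vdet (a q3) (a q2) (a q0)); first by rewrite mulf_neq0 ?invr_eq0.
  by rewrite /vscale !mulr0 mulr1.
- exists (vdet (a q2) (a q0) (a q1) / vdet (a q3) (a q0) (a q1)); first by rewrite mulf_neq0 ?invr_eq0.
  by rewrite /vscale !mulr0 mulr1.
- by exists 1; rewrite ?oner_eq0 // vscale1 !divff.
Qed.

End Parametrization.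

(** * Irreducible families *)

Section ProjectiveEquivalence.
Variable R : realType.
Local Notation C := R[i].
Implicit Types (T : {set {set 'I_10}}) (b : 'I_10 -> vec C).

Definition mx_of (F : comNzRingType) (b : 'I_10 -> vec F) : 'M[F]_(10, 3) :=
  \matrix_(i, j) row_of (b i) 0 j.

Lemma mx_of_mrow (F : comNzRingType) (A : 'M[F]_(10, 3)) : mx_of (mrow A) = A.
Proof. by apply/matrixP => i j; rewrite mxE mrowK mxE. Qed.

Definition meval_mx (F : comNzRingType) (f : {mpoly F[10 * 3]}) (A : 'M[F]_(10, 3)) : F :=
  f.@[fun k => mxvec A 0 k].

Lemma eval_atE (f : {mpoly C[10 * 3]}) (P : dual_tuple R) :
  eval_at f P = meval_mx f (mx_of (mrow (hcoord P))).
Proof. by rewrite mx_of_mrow. Qed.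

(** Every monomial is multiplied by the same nonzero scalar, the product of the [c i ^+ d i]. *)
Lemma multihomogeneous_scale (f : {mpoly C[10 * 3]}) (c : 'I_10 -> C) b :
  multihomogeneous f -> (forall i, c i != 0) ->
  (meval_mx f (mx_of (fun i => vscale (c i) (b i))) == 0) = (meval_mx f (mx_of b) == 0).
Proof.
move=> [d fd] c0; pose K := \prod_i c i ^+ d i.
have K0 : K != 0 by apply/prodf_neq0 => i _; rewrite expf_neq0.
suff -> : meval_mx f (mx_of (fun i => vscale (c i) (b i))) = K * meval_mx f (mx_of b).
  by rewrite mulf_eq0 (negPf K0).
rewrite /meval_mx !mevalE mulr_sumr [LHS]big_seq [RHS]big_seq; apply: eq_bigr => m mf.
rewrite mulrCA; congr (_ * _).
have prodE (g : 'I_(10 * 3) -> C) : \prod_k g k = \prod_i \prod_j g (mxvec_index i j).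
  rewrite (reindex _ (curry_mxvec_bij _ _)) /= pair_bigA /=.
  by apply: eq_bigr => -[i j].
rewrite !prodE -big_split; apply: eq_bigr => i _ /=.
rewrite -(fd m mf i) -prodrXr -big_split; apply: eq_bigr => j _ /=.
rewrite !mxvecE -exprMn; congr (_ ^+ _).
by rewrite !mxE; case: ifP => // _; case: ifP.
Qed.

Lemma eval_at_tuple_of T b (f : {mpoly C[10 * 3]}) : spread T -> realizes T b ->
  multihomogeneous f -> (eval_at f (tuple_of b) == 0) = (meval_mx f (mx_of b) == 0).
Proof.
move=> sT bT fh; have [c c0 cE] := hcoord_tuple_of (realizes_neq0 sT bT).
rewrite eval_atE (_ : mrow _ = fun i => vscale (c i) (b i)); last exact/funext.
exact: multihomogeneous_scale.
Qed.

Lemma stable_tuple_of T (Z : set (dual_tuple R)) P (M : 'M[C]_3) (c : 'I_10 -> C) b :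
  spread T -> stable T Z -> realization_space T P -> realizes T b -> M \in unitmx ->
  (forall i, c i != 0 /\ vmul (mrow (hcoord P) i) M = vscale (c i) (b i)) ->
  Z P <-> Z (tuple_of b).
Proof.
move=> sT [sZ _] TP bT Mu h; have TQ := tuple_of_realizes sT bT.
pose P' : set_type (@realization_space R T) := exist _ P (mem_set TP).
pose Q' : set_type (@realization_space R T) := exist _ (tuple_of b) (mem_set TQ).
have PQ : pgl_equiv P' Q'.
  apply/asboolP; exists M => // i; rewrite /= val_tuple_of; last exact: (realizes_neq0 sT bT).
  rewrite val_hcoord limg_line lfunE /= -row_of_vmul; have [ci0 ->] := h i.
  by rewrite row_of_scale vline_scale.
by split; [exact: (sZ P' Q')|apply: (sZ Q' P'); rewrite pgl_equiv_sym].
Qed.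

Lemma stable_conj T (Z : set (dual_tuple R)) P :
  stable T Z -> realization_space T P -> Z (conj_tuple P) <-> Z P.
Proof.
move=> [_ sZ] TP; pose real Q TQ : set_type (@realization_space R T) :=
  exist (fun Q => Q \in @realization_space R T) Q (mem_set TQ).
split=> [ZP|ZP]; last exact: (sZ (real P TP)).
rewrite -[P]conj_tupleK.
exact: (sZ (real (conj_tuple P) (realization_space_conj TP))).
Qed.

End ProjectiveEquivalence.

(** * Algebraic certificates on a parametrized family *)

Section Family.
Variables (R : realType) (B : seq block) (t : table).
Local Notation C := R[i].
Local Notation T := (config_of B).
Implicit Types (x : nat -> C).

Definition member (F : comNzRingType) (x : nat -> F) (i : nat) : vec F :=
  veval x (lookup t i).

Definition good x : Prop := realizes_blocks B (member x).

Definition detv (b : block) : pexpr :=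
  pdet (lookup t b.1.1) (lookup t b.1.2) (lookup t b.2).

Definition colv (b : block) := col B b.1.1 b.1.2 b.2.
Definition noncolv (b : block) := noncol B b.1.1 b.1.2 b.2.

Lemma peval_detv (F : comNzRingType) (x : nat -> F) b :
  peval x (detv b) = vdet (member x b.1.1) (member x b.1.2) (member x b.2).
Proof. by []. Qed.

Lemma good_col x b : good x -> colv b -> peval x (detv b) = 0.
Proof. by move=> gx /(gx _ _ _).1. Qed.

Lemma good_noncol x b : good x -> noncolv b -> peval x (detv b) != 0.
Proof. by move=> gx bB; apply/eqP; exact: (gx _ _ _).2. Qed.

Lemma good_prod x (K : seq block) : good x -> all noncolv K ->
  peval x (pprod (map detv K)) != 0.
Proof.
move=> gx; elim: K => [|b K IH] /=.
  by rewrite peval_const scalar1 oner_eq0.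
by case/andP=> /(good_noncol gx) b0 /IH K0; rewrite peval_mul mulf_neq0.
Qed.

Lemma scalar_neq0 (z : Z) : ~~ Z.eqb Z0 z -> scalar C z != 0.
Proof.
move=> z0; rewrite /scalar intr_eq0; apply: contra z0 => /eqP /(congr1 Z_of_int).
by rewrite int_of_ZK => ->.
Qed.

(* Both sides of the identity tested by [vanishing_ok] are evaluated at a    *)
(* realization: the determinants of the left hand side vanish, those of the  *)
(* right hand side do not.                                                   *)
Definition vanishing_ok (us : seq (block * pexpr)) (m : Z) (G : pexpr) (K : seq block) :=
  [&& all (fun u => colv u.1) us, all noncolv K, ~~ Z.eqb Z0 m
    & peq (foldr (fun u e => Add (Mul u.2 (detv u.1)) e) (Const Z0) us)
          (Mul (Const m) (Mul G (pprod (map detv K))))].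

Lemma vanishing x us m G K : good x -> vanishing_ok us m G K -> peval x G = 0.
Proof.
move=> gx /and4P[us0 K0 m0 /(peqP x)].
have -> : peval x (foldr (fun u e => Add (Mul u.2 (detv u.1)) e) (Const Z0) us) = 0.
  elim: us us0 => [|u us IH] /=; first by rewrite peval_const scalar0.
  by case/andP=> /(good_col gx) u0 /IH us0; rewrite peval_add peval_mul u0 us0 mulr0 addr0.
move/esym/eqP; rewrite !peval_mul !mulf_eq0 (negPf (good_prod gx K0)) orbF.
by rewrite peval_const (negPf (scalar_neq0 m0)) => /eqP.
Qed.

(** A Nullstellensatz certificate: where [E] vanishes, [a] divides a multiple of a product of
    determinants that are nonzero at realizations. *)
Definition nonvanishing_ok (E v a u : pexpr) (m : Z) (K : seq block) :=
  [&& all noncolv K, ~~ Z.eqb Z0 m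
    & peq (Add (Mul a u) (Mul E v)) (Mul (Const m) (pprod (map detv K)))].

Lemma nonvanishing x E v a u m K : good x -> peval x E = 0 ->
  nonvanishing_ok E v a u m K -> peval x a != 0.
Proof.
move=> gx E0 /and3P[K0 m0 /(peqP x)].
rewrite peval_add !peval_mul E0 mul0r addr0 => e; apply/eqP => a0; move/esym/eqP: e.
by rewrite a0 mul0r mulf_eq0 (negPf (good_prod gx K0)) orbF (negPf (scalar_neq0 m0)).
Qed.

(** The construction already enforces all triple points other than [d], so a single equation is
    left, up to the cofactor [w]. *)
Definition equation_ok (E : pexpr) (d : block) (w : pexpr) : bool :=
  all (fun b => peq (detv b)
    (if [&& eqn b.1.1 d.1.1, eqn b.1.2 d.1.2 & eqn b.2 d.2] then Mul E w else Const Z0)) B.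

Lemma equation x E d w i j k : equation_ok E d w -> peval x E = 0 -> col B i j k ->
  vdet (member x i) (member x j) (member x k) = 0.
Proof.
move=> eB E0 /and3P[u lt /hasP[b bB /and3P[ib jb kb]]].
have {eB} : peval x (detv b) = 0.
  rewrite (peqP x (allP eB b bB)); case: ifP => _; last by rewrite peval_const scalar0.
  by rewrite peval_mul E0 mul0r.
move: b ib jb kb {bB lt} => [[b1 b2] b3]; rewrite /in_block peval_detv /= !eqnE.
have s1 (p q r : vec C) : vdet p q r = 0 -> vdet q p r = 0.
  by move=> h; rewrite (vdet_perm _ _ _).1 h oppr0.
have s2 (p q r : vec C) : vdet p q r = 0 -> vdet p r q = 0.
  by move=> h; rewrite (vdet_perm _ _ _).2 h oppr0.
move: u; rewrite /= !inE !negb_or andbT => /andP[/andP[ij ik] jk].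
case/or3P=> /eqP i_ /or3P[] /eqP j_ /or3P[] /eqP k_; move: ij ik jk;
  rewrite i_ j_ k_ ?eqxx // => _ _ _ h;
  first [exact: (s1 _ _ _ h)|exact: (s2 _ _ _ h)|exact: (s1 _ _ _ (s2 _ _ _ h))|
         exact: (s2 _ _ _ (s1 _ _ _ h))|exact: (s1 _ _ _ (s2 _ _ _ (s1 _ _ _ h)))].
Qed.

Hypotheses (wfB : all wf_block B) (sT : spread T).

Let member_ord x (i : 'I_10) : vec C := member x i.

Lemma realizes_member x : good x -> realizes T (member_ord x).
Proof.
move=> gx; apply/(realizes_blocksP _ wfB) => i j k.
have e l : (l < 10)%N -> member_ord x (inord l) = member x l.
  by move=> l10; rewrite /member_ord inordK.
by split=> /and3P[u /and4P[i10 j10 k10 _] c]; rewrite !e //;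
  [apply: (gx i j k).1|apply: (gx i j k).2]; rewrite /col /noncol u c /= i10 j10 k10.
Qed.

(** The frame determines the projectivity, and the steps then determine parameters; both fix the
    vectors only up to scalars. *)
Lemma family_matches q ss (P : dual_tuple R) : t = construction q ss ->
  construction_ok B q ss -> realization_space T P ->
  exists2 x, good x & exists (M : 'M[C]_3) (c : 'I_10 -> C), M \in unitmx /\
    forall i, c i != 0 /\ vmul (mrow (hcoord P) i) M = vscale (c i) (member_ord x i).
Proof.
move=> tE /and4P[fr st kn _] TP; have /realization_spaceP[_] := TP.
move/(realizes_blocksP _ wfB) => PB; have [M Mu frM] := frame_sound PB fr.
pose b i := vmul (mrow (hcoord P) (inord i)) M.
have bB : realizes_blocks B b.
  apply/(realizes_blocksP (fun i : 'I_10 => vmul (mrow (hcoord P) i) M) wfB).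
  apply: realizes_mul => //; exact/(realizes_blocksP _ wfB).
have [x m] := steps_sound bB (frM (fun=> 0)) st; rewrite -/(construction q ss) -tE in m.
have mE (i : 'I_10) : exists c : C, c != 0 /\
    vmul (mrow (hcoord P) i) M = vscale c (member_ord x i).
  have /(matches_lookup m)[c c0 cE] : known t i.
    by rewrite tE; apply: (allP kn); rewrite mem_iota ltn_ord.
  by exists c; split=> //; move: cE; rewrite /b inord_val.
have [c cE] := choice mE; exists x; last by exists M, c.
(* Dividing the transformed coordinates by the scalars [c] gives exactly the members of the
   family. *)
have xT : realizes T (member_ord x).
  have := realizes_scale (c := fun i => (c i)^-1) (T := T) (a := fun i => vmul (mrow (hcoord P) i) M).
  rewrite (_ : (fun i => vscale _ _) = member_ord x).
    move=> h; apply: h => [i|]; first by rewrite invr_eq0; case: (cE i).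
    by apply: realizes_mul => //; exact/(realizes_blocksP _ wfB).
  apply/funext => i; have [ci0 ->] := cE i.
  by rewrite vscaleA mulVf // vscale1.
move=> i j k; have [h1 h2] := (realizes_blocksP _ wfB).1 xT i j k.
by split=> h; have /and3P[_ /and4P[i10 j10 k10 _] _] := h;
  move: (h1) (h2); rewrite /member_ord !inordK // => {}h1 {}h2; [exact: h1|exact: h2].
Qed.

Lemma family_complete q ss (P : dual_tuple R) : t = construction q ss ->
  construction_ok B q ss -> realization_space T P ->
  exists2 x, good x &
    forall Z, stable T Z -> Z P <-> Z (tuple_of (member_ord x)).
Proof.
move=> tE cok TP; have [x gx [M [c [Mu cE]]]] := family_matches tE cok TP.
exists x => // Z sZ; exact: (stable_tuple_of sT sZ TP (realizes_member gx) Mu cE).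
Qed.

End Family.

Lemma ev3_peval (C : numClosedFieldType) (x : nat -> C) e :
  all_vars (fun i => i < 3)%N e -> ev3 x (peval (@gen3 C) e) = peval x e.
Proof.
move=> ve; rewrite (peval_morph (ev3 x : {rmorphism {poly {poly {poly C}}} -> C})).
by apply: (eq_peval ve) => j /(ev3_gen x).
Qed.

(** * Pulling closed sets back to the parameters *)

Section Irreducibility.
Variables (R : realType) (B : seq block) (q : nat * nat * nat * nat) (ss : seq step).
Local Notation C := R[i].
Local Notation B2 := {poly {poly C}}.
Local Notation B3 := {poly {poly {poly C}}}.
Local Notation T := (config_of B).
Local Notation t := (construction q ss).
Implicit Types (x : nat -> C).

Hypotheses (wfB : all wf_block B) (sT : spread T) (cok : construction_ok B q ss).

Lemma conj_tuple_of (b : 'I_10 -> vec C) : (forall i, row_of (b i) != 0) ->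
  conj_tuple (tuple_of b) =
  tuple_of (fun i => (((b i).1.1)^*, ((b i).1.2)^*, ((b i).2)^*)).
Proof.
move=> b0; apply/ffunP => i; apply: val_inj.
have bE : row_of (((b i).1.1)^*, ((b i).1.2)^*, ((b i).2)^*) = map_mx Num.conj (row_of (b i)).
  by apply/rowP; apply: ord3P; rewrite !mxE.
rewrite [RHS]val_tuple_of bE; last by rewrite map_mx_eq0.
by rewrite ffunE; apply: conj_pointE; rewrite val_tuple_of.
Qed.

Lemma member_conj x i : member t (Num.conj \o x) i =
  (((member t x i).1.1)^*, ((member t x i).1.2)^*, ((member t x i).2)^*).
Proof. by rewrite /member /veval /= !(peval_morph (Num.conj : {rmorphism C -> C})). Qed.

Lemma good_conj x : good B t x -> good B t (Num.conj \o x).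
Proof.
move=> gx i j k; have [h h'] := gx i j k; rewrite !member_conj.
rewrite (vdet_conj (Num.conj : {rmorphism C -> C}) (member t x i)).
split=> [/h ->|/h' hn]; first exact: rmorph0.
by move/eqP; rewrite fmorph_eq0 => /eqP.
Qed.

Lemma tuple_of_conj x (Z : set (dual_tuple R)) : good B t x -> stable T Z ->
  Z (tuple_of (fun i : 'I_10 => member t (Num.conj \o x) i)) <->
  Z (tuple_of (fun i : 'I_10 => member t x i)).
Proof.
move=> gx sZ; have xT := realizes_member wfB gx.
have -> : (fun i : 'I_10 => member t (Num.conj \o x) i) = fun i : 'I_10 =>
    (((member t x i).1.1)^*, ((member t x i).1.2)^*, ((member t x i).2)^*).
  by apply/funext => i; exact: member_conj.
rewrite -conj_tuple_of; last exact: (realizes_neq0 sT xT).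
exact: (stable_conj sZ (tuple_of_realizes sT xT)).
Qed.

Lemma ev3_member x i : (i < 10)%N -> let u := member t (@gen3 C) i in
  (ev3 x u.1.1, ev3 x u.1.2, ev3 x u.2) = member t x i.
Proof.
move=> i10; case/and4P: cok => _ _ kn vars.
have /lookup_in ti : known t i by apply: (allP kn); rewrite mem_iota.
have : vall_vars (fun i => i < 3)%N (lookup t i).
  move: (lookup _ i) ti => u; elim: (construction q ss) vars {kn} => //= e t' IH /andP[v /IH{}IH] [eE|/IH //].
  by move: v; rewrite eE.
case/and3P=> v1 v2 v3.
by rewrite /member /veval /= !ev3_peval.
Qed.

Definition pullback (f : {mpoly C[10 * 3]}) : B3 :=
  mmap (polyC \o (polyC \o polyC) : {rmorphism C -> B3})
    (fun k => mxvec (mx_of (fun i : 'I_10 => member t (@gen3 C) i)) 0 k) f.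

Lemma ev3_pullback x f :
  ev3 x (pullback f) = meval_mx f (mx_of (fun i : 'I_10 => member t x i)).
Proof.
rewrite /pullback /meval_mx mevalE /mmap raddf_sum; apply: eq_bigr => m _ /=.
rewrite rmorphM /= ev3C ev2CC; congr (_ * _); rewrite /mmap1 rmorph_prod.
apply: eq_bigr => k _; rewrite rmorphXn /=; congr (_ ^+ _).
case/mxvec_indexP: k => i j; rewrite !mxvecE !mxE.
rewrite /=; have [<- <- <-] := ev3_member x (ltn_ord i).
by case: ifP => // _; case: ifP.
Qed.

(** A single polynomial gathers all the open conditions, in the form needed by [prime_on_open]. *)
Definition noncollinear_prod : B3 :=
  \prod_(i < 10) \prod_(j < 10) \prod_(k < 10 | noncol B i j k)
    vdet (member t (@gen3 C) i) (member t (@gen3 C) j) (member t (@gen3 C) k).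

Lemma noncollinear_prodP x : ev3 x noncollinear_prod != 0 <->
  forall i j k, noncol B i j k ->
    vdet (member t x i) (member t x j) (member t x k) <> 0.
Proof.
have detE (i j k : 'I_10) : ev3 x (vdet (member t (@gen3 C) i) (member t (@gen3 C) j)
    (member t (@gen3 C) k)) = vdet (member t x i) (member t x j) (member t x k).
  rewrite -(vdet_conj (ev3 x : {rmorphism B3 -> C})).
  by congr (vdet _ _ _); exact: ev3_member.
rewrite rmorph_prod; split=> [/prodf_neq0 h i j k ijk|h].
  have /and3P[_ /and4P[i10 j10 k10 _] _] := ijk.
  have := h (Ordinal i10) isT; rewrite rmorph_prod => /prodf_neq0 /(_ (Ordinal j10) isT).
  rewrite rmorph_prod => /prodf_neq0 /(_ (Ordinal k10) ijk).
  by move/eqP => h'; rewrite -(detE (Ordinal i10) (Ordinal j10) (Ordinal k10)).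
apply/prodf_neq0 => i _; rewrite rmorph_prod; apply/prodf_neq0 => j _.
rewrite rmorph_prod; apply/prodf_neq0 => k ijk; apply/eqP.
by have := h _ _ _ ijk; rewrite -detE.
Qed.

(** The family may exceed the hypersurface of [F] by conjugation: this covers two conjugate
    components, of which [F] describes one. *)
Theorem irreducible_family (F : B3) (a : B2) :
  (forall x i j k, ev3 x F = 0 -> col B i j k ->
     vdet (member t x i) (member t x j) (member t x k) = 0) ->
  (forall x, good B t x -> ev3 x F = 0 \/ ev3 (Num.conj \o x) F = 0) ->
  (forall x, good B t x -> ev3 x F = 0 -> ev2 x a != 0) ->
  ((exists2 x, good B t x & ev3 x F = 0) -> prime_on F a) ->
  ~ reducible_realizations R T.
Proof.
(* For each of the two closed sets, [avoid] finds a point of the hypersurface outside it and a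
   polynomial vanishing on the set but not at that point; the product of both polynomials
   contradicts primality. *)
move=> FD gF Fa prF [Z [Z' [[cZ cZ' sZ sZ'] TZZ' [P TP nZP] [P' TP' nZP']]]].
have avoid Y Q : zariski_closed Y -> stable T Y -> realization_space T Q -> ~ Y Q ->
    exists2 x, good B t x /\ ev3 x F = 0 & exists f, [/\ ev3 x (pullback f) != 0 &
      forall x', good B t x' -> Y (tuple_of (fun i : 'I_10 => member t x' i)) ->
      ev3 x' (pullback f) = 0].
  move=> [G [Gh YE]] sY TQ nYQ; have [x gx Yx] := family_complete wfB sT erefl cok TQ.
  have {}nYQ : ~ Y (tuple_of (fun i : 'I_10 => member t x i)) by move/(Yx _ sY).
  have [y [gy Fy] nYy] : exists2 y, good B t y /\ ev3 y F = 0 &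
      ~ Y (tuple_of (fun i : 'I_10 => member t y i)).
    (* On the other component, conjugate the parameters; a stable [Y] misses the conjugate too. *)
    case: (gF x gx) => [xF|xF]; first by exists x.
    by exists (Num.conj \o x); [split=> //; exact: good_conj|move/(tuple_of_conj gx sY)].
  exists y => //; move: nYy; rewrite {1}YE => /existsNP[f /not_implyP[Gf fy]]; exists f.
  have fE z : good B t z -> (ev3 z (pullback f) == 0) =
      (eval_at f (tuple_of (fun i : 'I_10 => member t z i)) == 0).
    move=> gz; rewrite ev3_pullback (eval_at_tuple_of sT (realizes_member wfB gz)) //.
    exact: Gh.
  split=> [|z gz]; first by rewrite fE //; exact/eqP.
  by rewrite YE => /(_ f Gf) fz; apply/eqP; rewrite fE // fz.
have [x [gx xF] [f [fx fZ]]] := avoid Z P cZ sZ TP nZP.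
have [x' [gx' xF'] [f' [fx' fZ']]] := avoid Z' P' cZ' sZ' TP' nZP'.
pose X z := good B t z /\ ev3 z F = 0.
have [|||||h|h] := @prime_on_open _ F a noncollinear_prod X (pullback f) (pullback f').
- by apply: prF; exists x.
- by move=> z [gz zF]; split=> //; exact: Fa.
- by move=> z [gz _]; apply/noncollinear_prodP => i j k ijk; exact: (gz i j k).2.
- move=> z zF /noncollinear_prodP zN; split=> // i j k; split=> [ijk|]; last exact: zN.
  exact: FD.
- move=> z [gz zF].
  case: (TZZ' _ (tuple_of_realizes sT (realizes_member wfB gz))) => [/(fZ _ gz)|/(fZ' _ gz)] ->.
    by rewrite mul0r.
  by rewrite mulr0.
- by move: fx; rewrite h ?eqxx.
- by move: fx'; rewrite h ?eqxx.
Qed.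

End Irreducibility.

(** * The degree of a discriminant from its coefficient list *)

Section BivariateCoefficients.
Variable C : numClosedFieldType.
Local Notation B2 := {poly {poly C}}.

Definition gen2 (i : nat) : B2 := if i is 0%N then 'X%:P else 'X.

Lemma ev2_peval (x : nat -> C) e :
  all_vars (fun i => i < 2)%N e -> ev2 x (peval gen2 e) = peval x e.
Proof.
move=> ve; rewrite (peval_morph (ev2 x : {rmorphism B2 -> C})).
apply: (eq_peval ve) => -[|[|//]] _;
  by rewrite /= /ev2 /= /horner_eval ?(hornerC, hornerX).

Qed.

Lemma peval_gen3 e : all_vars (fun i => i < 2)%N e ->
  peval (@gen3 C) e = (peval gen2 e)%:P.
Proof.
move=> ve; rewrite (peval_morph (polyC : {rmorphism B2 -> {poly B2}})).
by apply: (eq_peval ve) => -[|[|//]].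
Qed.

Lemma P2_eval_gen2 e : all_vars (fun i => i < 2)%N e ->
  P2_eval gen2 (interp P2_ops P2_var e) = peval gen2 e.
Proof.
move=> ve; rewrite (interp_sound _ _ (P2_sound gen2)); apply: (eq_peval ve) => i.
by case: i => [|[|//]] _; rewrite /P2_eval /P1_eval /= ?scalar0 ?scalar1; ring.
Qed.

Lemma leval_Poly (K : Type) (S : comNzRingType) (f : K -> {poly S}) (g : K -> S) p :
  (forall a, f a = (g a)%:P) -> leval f 'X p = Poly (map g p).
Proof.
move=> fg; elim: p => //= a p IH.
by rewrite fg addrC -IH /leval /= cons_poly_def.
Qed.

Lemma P1_eval_Poly p : P1_eval 'X p = Poly (map (@scalar C) p).
Proof. by apply: leval_Poly => z; rewrite /scalar rmorph_int. Qed.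

Lemma P2_eval_Poly p : P2_eval gen2 p = Poly (map (P1_eval ('X : {poly C})) p).
Proof.
apply: leval_Poly => q; rewrite /P1_eval /=.
elim: q => [|z q IH] /=; first by rewrite polyC0.
by rewrite IH polyCD polyCM /scalar rmorph_int.
Qed.

Fixpoint strip K (is0 : K -> bool) (p : seq K) : seq K :=
  if p is a :: p' then
    let q := strip is0 p' in if q is [::] then if is0 a then [::] else [:: a] else a :: q
  else [::].

Lemma Poly_strip (S : nzRingType) K (is0 : K -> bool) (g : K -> S) p :
  (forall a, is0 a -> g a = 0) -> Poly (map g (strip is0 p)) = Poly (map g p).
Proof.
move=> h; elim: p => //= a p IH; case: strip IH => [|b q] IH; rewrite -IH //=.
by case: ifP => // /h ->; rewrite cons_poly_def mul0r add0r polyC0.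
Qed.

(** Even size means odd degree. The degree is taken in the variable 1, and the leading coefficient,
    a polynomial in the variable 0, must be nonzero after stripping. *)
Definition odd_degree (e : pexpr) : bool :=
  let p := strip (op_is0 P1_ops) (interp P2_ops P2_var e) in
  [&& all_vars (fun i => i < 2)%N e, ~~ odd (size p)
    & if p is c :: p' then ~~ op_is0 P1_ops (last c p') else false].

Lemma scalar_eq0 z : (scalar C z == 0) = Z.eqb Z0 z.
Proof.
rewrite /scalar intr_eq0; apply/eqP/idP => [/(congr1 Z_of_int)|].
  by rewrite int_of_ZK => ->.
by case: z.
Qed.

Lemma P1_eval_eq0 p : P1_eval ('X : {poly C}) p = 0 -> op_is0 P1_ops p.
Proof.
rewrite P1_eval_Poly => p0; apply/allP => z /(nthP Z0)[i ip <-].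
have := congr1 (fun q : {poly C} => q`_i) p0.
by rewrite coef0 coef_Poly (nth_map Z0) // => /eqP; rewrite scalar_eq0.
Qed.

Lemma odd_degree_nonsquare e : odd_degree e -> nonsquare (peval gen2 e).
Proof.
case/and3P=> ve; rewrite -P2_eval_gen2 // P2_eval_Poly.
have h0 a : op_is0 P1_ops a -> P1_eval ('X : {poly C}) a = 0.
  by case: (P1_sound ('X : {poly C})) => _ _ _ _; apply.
rewrite -(Poly_strip _ h0); case: strip => // c p; set s := c :: p => os l0.
have sE : Poly (map (P1_eval ('X : {poly C})) s) = map (P1_eval 'X) s :> seq _.
  apply: (@PolyK _ 0); rewrite /= last_map; apply: contra l0 => /eqP; exact: P1_eval_eq0.
apply: nonsquare_odd_degree; last by rewrite sE size_map.
by rewrite -size_poly_gt0 sE size_map.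
Qed.

(** The root [w] is an arbitrary complex number, so this equation cannot be written as a [pexpr]. *)
Lemma exists_root_poly (w : C) : exists F : {poly B2},
  [/\ forall x, ev3 x F = 0 <-> x 2%N = w, size F = 2 & lead_coef F = 1].
Proof.
exists ('X - w%:P%:P%:P); split; [move=> x|exact: size_XsubC|exact: lead_coefXsubC].
have -> : ev3 x ('X - w%:P%:P%:P) = x 2%N - w.
  by rewrite /ev3 /= /horner_eval hornerXsubC -!polyCB ev2CC.
by split=> [/subr0_eq|->] //; rewrite subrr.
Qed.

End BivariateCoefficients.

(** * Checking irreducible and empty families *)

Section FamilyCheck.
Variables (R : realType) (B : seq block) (q : nat * nat * nat * nat) (ss : seq step).
Local Notation C := R[i].
Local Notation t := (construction q ss).

(* The determinant of the block [eq_block] is [eq_cofactor] times the        *)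
(* equation of the family, the other ones vanish identically. Conversely     *)
(* [eq_mult] times this determinant is [eq_scale] times the equation times   *)
(* the determinants of the non-collinear triples [eq_noncol].                *)
Record equation_data := EquationData {
  eq_block : block;
  eq_cofactor : pexpr;
  eq_mult : pexpr;
  eq_scale : Z;
  eq_noncol : seq block }.

(* The families are respectively given, in terms of the last variable X, by  *)
(* a contradiction, by no equation, by b X + c = 0, by a X^2 + b X + c = 0    *)
(* where the discriminant has odd degree, and by an integral equation        *)
(* a X^2 + b X + c = 0 with complex conjugate roots.                         *)
Inductive family :=
  | Empty of seq (block * pexpr) & Z & seq block
  | Free
  | Linear of pexpr & pexpr & equation_data & pexpr & pexpr & Z & seq block
  | Quadratic of pexpr & pexpr & pexpr & equation_data & pexpr & pexpr & Z & seq block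
  | Conjugate of Z & Z & Z & equation_data.

(** The last two tests are the two directions: the equation implies all collinearities, and it holds
    at every realization. *)
Definition data_ok (E : pexpr) (d : equation_data) : bool :=
  [&& all_vars (fun i => i < 3)%N E, equation_ok B t E (eq_block d) (eq_cofactor d)
    & vanishing_ok B t [:: (eq_block d, eq_mult d)] (eq_scale d) E (eq_noncol d)].

Definition linear_expr b c := Add (Mul b (Var 2)) c.
Definition quadratic_expr a b c := Add (Mul (Add (Mul a (Var 2)) b) (Var 2)) c.

(** In the case [Free] the block (0, 0, 0) is a dummy, so every determinant must vanish
    identically. *)
Definition family_ok (f : family) : bool :=
  match f with
  | Empty us m K => vanishing_ok B t us m (Const (Zpos xH)) K
  | Free => equation_ok B t (Const Z0) (0, 0, 0)%N (Const Z0)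
  | Linear b c d v u m K =>
      [&& all (all_vars (fun i => i < 2)%N) [:: b; c], data_ok (linear_expr b c) d
        & nonvanishing_ok B t (linear_expr b c) v b u m K]
  | Quadratic a b c d v u m K =>
      [&& all (all_vars (fun i => i < 2)%N) [:: a; b; c], data_ok (quadratic_expr a b c) d,
          nonvanishing_ok B t (quadratic_expr a b c) v a u m K
        & odd_degree (Sub (Mul b b) (Mul (Const (Zpos 4)) (Mul a c)))]
  | Conjugate a b c d =>
      data_ok (quadratic_expr (Const a) (Const b) (Const c)) d &&
      (if Z.sub (Z.mul b b) (Z.mul (Zpos 4) (Z.mul a c)) is Zneg _ then true else false)
  end.

Definition spread_ok : bool :=
  all (fun i => all (fun j => (i == j) || has (noncol B i j) (iota 0 10)) (iota 0 10))
    (iota 0 10).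

Lemma spread_okP : all wf_block B -> spread_ok -> spread (config_of B).
Proof.
move=> wfB sok i j ij; have m10 (l : 'I_10) : val l \in iota 0 10 by rewrite mem_iota ltn_ord.
have /orP[|/hasP[k _ /and3P[u lt c]]] := allP (allP sok _ (m10 i)) _ (m10 j).
  by rewrite val_eqE (negPf ij).
have /and4P[_ _ k10 _] := lt; exists (Ordinal k10); move: (u) => /=.
rewrite !inE !negb_or andbT => /andP[/andP[_ ik] jk]; split=> //.
have kE : Ordinal k10 = inord k by apply: val_inj; rewrite /= inordK.
by rewrite -(inord_val i) -(inord_val j) kE triple_point_config.
Qed.

Hypotheses (wfB : all wf_block B) (sok : spread_ok) (cok : construction_ok B q ss).

Let sT : spread (config_of B) := spread_okP wfB sok.

Let data_eq (E : pexpr) d x : data_ok E d -> good (R := R) B t x -> peval x E = 0.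
Proof. by case/and3P=> _ _ v gx; exact: (vanishing gx v). Qed.

Let data_col (E : pexpr) d (x : nat -> C) i j k : data_ok E d -> peval x E = 0 ->
  col B i j k -> vdet (member t x i) (member t x j) (member t x k) = 0.
Proof. by case/and3P=> _ e _ E0; exact: (equation e E0). Qed.

Let data_irreducible (E a : pexpr) d v u m K : data_ok E d ->
  all_vars (fun i => i < 2)%N a -> nonvanishing_ok B t E v a u m K ->
  (peval (@gen2 C) a != 0 -> prime_on (peval (@gen3 C) E) (peval (@gen2 C) a)) ->
  ~ reducible_realizations R (config_of B).
Proof.
move=> dok va nv prE; have /and3P[vE _ _] := dok.
apply: (@irreducible_family R B q ss wfB sT cok (peval (@gen3 C) E) (peval (@gen2 C) a)).
- by move=> x i j k; rewrite ev3_peval //; exact: (data_col dok).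
- by move=> x gx; left; rewrite ev3_peval //; exact: (data_eq dok gx).
- move=> x gx; rewrite ev3_peval // ev2_peval // => E0; exact: (nonvanishing gx E0 nv).
- case=> x gx; rewrite ev3_peval // => E0; apply: prE.
  apply: contra_neq (nonvanishing gx E0 nv) => a0.
  by rewrite -ev2_peval // a0 rmorph0.
Qed.

(** A negative discriminant excludes [a = 0] and real roots. Conjugation preserves the integral
    equation, hence exchanges its two roots. *)
Lemma conjugate_roots (a b c : Z) :
  (if Z.sub (Z.mul b b) (Z.mul (Zpos 4) (Z.mul a c)) is Zneg _ then true else false) ->
  exists w : C, forall z, (scalar C a * z + scalar C b) * z + scalar C c = 0 <->
    z = w \/ z^* = w.
Proof.
case disc: (Z.sub _ _) => // [p] _.
have {disc} : scalar C b ^+ 2 - 4%:R * (scalar C a * scalar C c) < 0.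
  have -> : scalar C b ^+ 2 - 4%:R * (scalar C a * scalar C c) = scalar C (Zneg p).
    have [_ /= sN sD sM _] := Z_ops_sound C; rewrite -disc -[Z.sub _ _]/(Z.add _ (Z.opp _)).
    by rewrite sD sN !sM.
  by rewrite /scalar ltrz0.
have conj_scalar z : (scalar C z)^* = scalar C z by rewrite /scalar rmorph_int.
move: (conj_scalar a) (conj_scalar b) (conj_scalar c).
move: (scalar C a) (scalar C b) (scalar C c) => {}a {}b {}c aR bR cR disc.
have a0 : a != 0.
  apply: contraTneq disc => ->; rewrite mul0r mulr0 subr0 -real_leNgt ?real0 //.
    by apply: real_exprn_even_ge0 => //; apply/CrealP.
  by rewrite rpredX //; apply/CrealP.
pose P z := (a * z + b) * z + c.
pose w := (- b + sqrtC (b ^+ 2 - 4%:R * (a * c))) / (2%:R * a).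
have sqE z : 4%:R * a * P z = (2%:R * a * z + b) ^+ 2 - (b ^+ 2 - 4%:R * (a * c)).
  by rewrite /P; ring.
have a40 : 4%:R * a != 0 by rewrite mulf_neq0 ?pnatr_eq0.
have Pw : P w = 0.
  apply: (mulfI a40); rewrite mulr0 sqE /w mulrC divfK ?mulf_neq0 ?pnatr_eq0 //.
  by rewrite addrAC addNr add0r sqrtCK subrr.
have Pconj z : P z = 0 -> P z^* = 0.
  move=> /(congr1 Num.conj); rewrite rmorph0 /P rmorphD rmorphM rmorphD rmorphM /=.
  by rewrite aR bR cR.
have nreal z : P z = 0 -> z^* != z.
  move=> Pz; apply/eqP => /CrealP zR; have := sqE z; rewrite Pz mulr0 => /esym/eqP.
  rewrite subr_eq0 => /eqP sq; move: disc; rewrite -sq; apply/negP.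
  have rR : 2%:R * a * z + b \is Num.real.
    by rewrite rpredD ?rpredM ?realn //; apply/CrealP.
  by rewrite -real_leNgt ?real0 ?rpredX // real_exprn_even_ge0.
(* The sum of the roots is [- b / a]; a nonreal [z] other than [w] and its conjugate must both be
   this second root, unless the conjugate of [z] is [w]. *)
have two y z : P y = 0 -> P z = 0 -> z = y \/ z = - b / a - y.
  move=> Py Pz; have /eqP : (z - y) * (a * (z + y) + b) = 0.
    by transitivity (P z - P y); [rewrite /P; ring|rewrite Py Pz subrr].
  rewrite mulf_eq0 subr_eq0 => /orP[/eqP ->|/eqP h]; [by left|right].
  by apply: (mulfI a0); rewrite mulrBr mulrCA divff // mulr1 -[RHS]add0r -h; ring.
exists w => z; split=> [Pz|[->|zw]]; [|exact: Pw|]; last first.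
  by rewrite -[z]conjCK zw; exact: Pconj.
case: (two w z Pw Pz) => [|zE]; [by left|right].
case: (two w _ Pw (Pconj _ Pz)) => // zcE.
by have := nreal z Pz; rewrite zcE zE eqxx.
Qed.

Theorem family_okP f : family_ok f -> ~ reducible_realizations R (config_of B).
Proof.
case: f => [us m K|| b c d v u m K|a b c d v u m K|a b c d]; rewrite /family_ok.
- move=> vok [_ [_ [_ _ [P TP _] _]]].
  have [x gx _] := family_complete wfB sT erefl cok TP.
  have := vanishing gx vok; rewrite peval_const scalar1 => /eqP.
  by rewrite oner_eq0.
- move=> eok; apply: (@irreducible_family R B q ss wfB sT cok 0 1).
  + move=> x i j k _; apply: (equation eok); exact: scalar0.
  + by move=> x _; left; rewrite rmorph0.
  + by move=> x _ _; rewrite rmorph1 oner_eq0.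
  + by move=> _; exact: prime_on0.
- case/and3P=> /and3P[vb vc _] dok nv; apply: (data_irreducible dok vb nv) => b0.
  have FE : peval (@gen3 C) (linear_expr b c) =
      (peval (@gen2 C) b)%:P * 'X + (peval (@gen2 C) c)%:P.
    by rewrite peval_add peval_mul (peval_gen3 C vb) (peval_gen3 C vc).
  have F2 : size (peval (@gen3 C) (linear_expr b c)) = 2.
    by rewrite FE size_MXaddC polyC_eq0 (negPf b0) size_polyC b0.
  have := prime_on_linear F2; rewrite /lead_coef F2 FE /=.
  by rewrite coefD coefMX !coefC /= addr0.
- case/and4P=> /and4P[va vb vc _] dok nv odd; apply: (data_irreducible dok va nv) => a0.
  have FE : peval (@gen3 C) (quadratic_expr a b c) =
      ((peval (@gen2 C) a)%:P * 'X + (peval (@gen2 C) b)%:P) * 'X + (peval (@gen2 C) c)%:P.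
    by rewrite !(peval_add, peval_mul) (peval_gen3 C va) (peval_gen3 C vb) (peval_gen3 C vc).
  have F2 : size ((peval (@gen2 C) a)%:P * 'X + (peval (@gen2 C) b)%:P) = 2.
    by rewrite size_MXaddC polyC_eq0 (negPf a0) size_polyC a0.
  have F3 : size (peval (@gen3 C) (quadratic_expr a b c)) = 3%N.
    by rewrite FE size_MXaddC F2 -size_poly_eq0 F2.
  have := prime_on_quadratic F3; rewrite /lead_coef F3 /discr FE /=.
  rewrite !(coefD, coefMX, coefC) /= !(addr0, add0r); apply.
  have := @odd_degree_nonsquare C _ odd.
  by rewrite /Sub peval_add peval_opp !peval_mul peval_const expr2.
- case/andP=> dok /conjugate_roots[w wP]; set E := quadratic_expr _ _ _ in dok *.
  have EE (x : nat -> C) : peval x E = 0 <-> x 2%N = w \/ (x 2%N)^* = w by exact: wP.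
  have [F [FE F2 F1]] := exists_root_poly w.
  apply: (@irreducible_family R B q ss wfB sT cok F 1).
  + move=> x i j k /FE xw; apply: (data_col dok); exact: ((EE x).2 (or_introl xw)).
  + by move=> x gx; have [xw|xw] := (EE x).1 (data_eq dok gx); [left|right]; apply/FE.
  + by move=> x _ _; rewrite rmorph1 oner_eq0.
  + by move=> _; rewrite -F1; exact: prime_on_linear.
Qed.

End FamilyCheck.

(** * The configurations with irreducible moduli spaces *)

Declare Scope pexpr_scope.
Delimit Scope pexpr_scope with pexpr.
Bind Scope pexpr_scope with pexpr.
Notation "- p" := (Opp p) : pexpr_scope.
Notation "p + q" := (Add p q) : pexpr_scope.
Notation "p - q" := (Sub p q) : pexpr_scope.
Notation "p * q" := (Mul p q) : pexpr_scope.
Definition pexpr_of_int (z : Number.int) : pexpr := Const (Z.of_num_int z).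
Definition int_of_pexpr (p : pexpr) : option Number.int :=
  if p is Const z then Some (Z.to_num_int z) else None.
Number Notation pexpr pexpr_of_int int_of_pexpr : pexpr_scope.

Record certificate := Certificate {
  cert_blocks : seq block;
  cert_frame : nat * nat * nat * nat;
  cert_steps : seq step;
  cert_family : family }.

Definition certificate_ok (c : certificate) : bool :=
  [&& all wf_block (cert_blocks c), spread_ok (cert_blocks c),
   construction_ok (cert_blocks c) (cert_frame c) (cert_steps c)
    & family_ok (cert_blocks c) (cert_frame c) (cert_steps c) (cert_family c)].

Lemma certificate_okP (R : realType) c : certificate_ok c ->
  ~ reducible_realizations R (config_of (cert_blocks c)).
Proof. by case/and4P=> wf sp co; exact: family_okP. Qed.

Section Certificates.
Local Open Scope nat_scope.
Local Open Scope pexpr_scope.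
Let r := Var 0.
Let s := Var 1.
Let t := Var 2.

(** Parameters are numbered so that the remaining equation is solved for [t]. An [Empty] certificate
    without multipliers records a determinant that should not vanish but is identically zero. The
    last two certificates reach a contradiction because 2, respectively 5, is nonzero. *)
Definition irreducible_certificates : seq certificate := [::
   Certificate [:: (0, 1, 2); (0, 3, 4); (0, 5, 6); (1, 3, 7); (1, 4, 8); (2,
  5, 7); (2, 6, 8); (3, 5, 9); (4, 6, 9); (7, 8, 9)]%N (5, 7, 6, 9)%N
  [:: One 0 5 6 0; One 2 5 7 1; Two 8 9 7 2 6 (1, s, 1) 1; One 1 0 2 2; Two
    3 7 1 9 5 (t + 1, r, r) 1; Two 4 9 6 3 0 (1, 1, r - t) r]
  (Empty [:: ((1, 4, 8)%N, 1)] 1 [:: (0, 4, 9)]%N);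
   Certificate [:: (0, 1, 2); (0, 3, 4); (0, 5, 6); (1, 3, 7); (1, 4, 8); (2,
  5, 7); (2, 6, 9); (3, 6, 8); (4, 5, 9); (7, 8, 9)]%N (5, 2, 0, 3)%N
  [:: One 6 0 5 0; One 7 2 5 2; Two 1 7 3 2 0 (0, t - 1, t) 1; One 9 6 2 1;
    Two 4 0 3 5 9 (s, s, 1) 1; Two 8 6 3 9 7 (r * s * t - r * r - r * t - s
       * t + r, - s * t, - r - t + 1) 1]
  (Quadratic (- r * s * s + 2 * r * s - r) (r * r * s - r * r - r * s + 2 *
    r - s) (r * r - r * s - r + s) (EquationData (1, 4, 8)%N 1 1 1 [::]) 0
    1 1 [:: (3, 4, 6); (2, 3, 4)]%N);
   Certificate [:: (0, 1, 2); (0, 3, 4); (0, 5, 6); (1, 3, 7); (1, 4, 8); (2,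
  5, 8); (2, 6, 7); (3, 5, 9); (4, 6, 9); (7, 8, 9)]%N (1, 2, 7, 4)%N
  [:: One 0 2 1 0; Two 3 1 7 4 0 (r - 1, 0, - 1) 1; One 8 4 1 2; One 6 7 2
    1; Two 5 0 6 8 2 (- r * t - r, - r * s - t - 1, - r) 1; Two 9 4 6 5 3
    (t + 1, r * s + t + 1, r + t + 1) (r * s - r + 1)]
  (Linear 1 (r * s) (EquationData (7, 8, 9)%N (t + 1) (- 1) 1 [:: (1, 5,
    6)]%N) 0 1 1 [::]);
   Certificate [:: (0, 1, 2); (0, 3, 5); (0, 4, 6); (1, 3, 7); (1, 4, 8); (2,
  5, 7); (2, 6, 8); (3, 4, 9); (5, 6, 9); (7, 8, 9)]%N (5, 2, 0, 6)%N
  [:: One 4 6 0 0; One 9 6 5 1; Two 3 0 5 4 9 (- s, 0, r) 1; One 8 6 2 2;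
    Two 1 8 4 2 0 (0, - t, r) 1; Two 7 8 9 5 2 (s, - t, 0) 1]
  (Free);
   Certificate [:: (0, 1, 2); (0, 3, 5); (0, 4, 6); (1, 3, 7); (1, 4, 8); (2,
  5, 7); (2, 6, 8); (3, 4, 9); (5, 8, 9); (6, 7, 9)]%N (9, 2, 6, 4)%N
  [:: One 8 6 2 2; One 7 6 9 0; Two 5 8 9 7 2 (r, t, 1) 1; One 1 8 4 1; Two
    0 6 4 2 1 (- s, - s, - s - 1) 1; Two 3 0 5 1 7 (r + s, s + t, s + 2) (r
       * s * t + r * t - s * t)]
  (Linear 1 (- 2) (EquationData (3, 4, 9)%N 1 1 1 [::]) 0 1 1 [::]);
   Certificate [:: (0, 1, 2); (0, 3, 5); (0, 4, 6); (1, 3, 7); (1, 4, 9); (2,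
  3, 8); (2, 6, 7); (4, 5, 8); (5, 7, 9); (6, 8, 9)]%N (6, 3, 2, 4)%N
  [:: One 8 2 3 2; One 9 8 6 0; One 1 9 4 1; Two 0 6 4 1 2 (r + s, s + t, s
       + t) 1; Two 5 0 3 4 8 (r + s, - r * t + t * t + r + s, s + t) 1; Two 7
    2 6 3 1 (- r - s, 0, - s - 1) 1]
  (Quadratic (r * s + r) (- r * r * s + r * s - r - s) (r * r * s + r * s *
    s - r * s - s * s) (EquationData (5, 7, 9)%N (- 1) (- 1) 1 [::]) 0 t 1
    [:: (7, 8, 9)]%N);
   Certificate [:: (0, 1, 2); (0, 3, 5); (0, 4, 6); (1, 3, 7); (1, 4, 9); (2,
  5, 7); (2, 6, 8); (3, 4, 8); (5, 8, 9); (6, 7, 9)]%N (4, 6, 8, 7)%N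
  [:: One 2 8 6 2; One 0 6 4 0; One 5 7 2 1; Two 3 4 8 0 5 (- r * s * t - r
       + 1, 0, s + 1) 1; Two 1 7 3 2 0 (r * s * t + r, 1, - s) (r * t - r +
    1); Two 9 1 4 7 6 (- s, 1, - s) 1]
  (Linear (s * s) (s + 1) (EquationData (5, 8, 9)%N (- 1) (- 1) 1 [::]) 0 1
    1 [:: (5, 6, 9)]%N);
   Certificate [:: (0, 1, 2); (0, 3, 5); (0, 4, 6); (1, 3, 7); (1, 4, 9); (2,
  5, 8); (2, 6, 7); (3, 4, 8); (5, 7, 9); (6, 8, 9)]%N (8, 0, 1, 4)%N
  [:: One 2 0 1 0; One 6 0 4 2; Two 9 8 6 4 1 (t + 1, t + 1, t) 1; One 5 8
    2 1; Two 3 5 0 8 4 (1, r * s, r * s) 1; Two 7 9 5 2 6 (t, - s + t + 1,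
    - r * s + t) (r * t + r - t)]
  (Linear (r * s - 1) (s - 1) (EquationData (1, 3, 7)%N (- 1) (- 1) 1 [::])
    0 1 1 [:: (0, 3, 4)]%N);
   Certificate [:: (0, 1, 2); (0, 3, 5); (0, 4, 6); (1, 3, 7); (1, 5, 8); (2,
  4, 9); (2, 6, 7); (3, 4, 8); (5, 7, 9); (6, 8, 9)]%N (9, 8, 0, 4)%N
  [:: Two 6 4 0 8 9 (1, 1, 0) 1; One 2 9 4 1; One 1 0 2 0; One 5 1 8 2; Two
    3 8 4 5 0 (- r * s - r, - r * s - t, - r * s - r) 1; Two 7 9 5 6 2 (r *
    s * s + r * s + s * t + 1, r * s * s + s * t, r * s * s + s) 1]
  (Quadratic (r * s * s + s) (r * r * s + 1) (- r * r * s + r * s)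
    (EquationData (1, 3, 7)%N 1 1 1 [::]) 0 (- 1) 1 [:: (6, 7, 8)]%N);
   Certificate [:: (0, 1, 4); (0, 2, 5); (0, 3, 6); (1, 2, 3); (1, 6, 8); (2,
  4, 7); (3, 8, 9); (4, 5, 9); (5, 7, 8); (6, 7, 9)]%N (8, 3, 4, 0)%N
  [:: One 9 8 3 0; One 5 4 9 1; One 2 5 0 2; Two 1 2 3 4 0 (- s - t, - s -
    t, - t - 1) 1; Two 6 1 8 3 0 (t + 1, s + t, t + 1) 1; Two 7 5 8 2 4 (-
    r * s * s - r * s * t, - r * r * s * s - r * s * t, - r * s - t) 1]
  (Quadratic (r * r * s - r * s - r + 1) (- r + s) (- r * r * s + r * s *
    s) (EquationData (6, 7, 9)%N (- 1) (- 1) 1 [::]) 0 (s * t) 1 [:: (0, 2,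
    7)]%N);
   Certificate [:: (0, 1, 2); (0, 3, 4); (0, 5, 7); (1, 3, 8); (1, 5, 9); (2,
  6, 7); (2, 8, 9); (3, 7, 9); (4, 6, 9); (4, 7, 8); (5, 6, 8)]%N (2, 1, 3,
  6)%N
  [:: One 8 3 1 2; One 9 8 2 0; Two 5 6 8 1 9 (r, - r * t + r + t, 1) 1;
    Two 7 6 2 9 3 (- r, - t, - t) 1; Two 0 2 1 5 7 (- r, r * t - t, 0) (t -
    1); Two 4 0 3 8 7 (r, - r * t + t, - r + t) (r * t)]
  (Linear 1 (- r * r - r) (EquationData (4, 6, 9)%N (t - 1) (- 1) 1 [:: (2,
    6, 8)]%N) 0 1 1 [::]);
   Certificate [:: (0, 1, 2); (0, 3, 4); (0, 5, 7); (1, 3, 8); (1, 5, 9); (2,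
  6, 9); (2, 7, 8); (3, 7, 9); (4, 6, 7); (4, 8, 9); (5, 6, 8)]%N (8, 6, 2,
  0)%N
  [:: One 9 2 6 0; One 5 6 8 1; Two 1 2 0 5 9 (r * s, r * s, s - 1) 1; Two
    7 2 8 5 0 (s - 1, 0, - 1) 1; Two 3 8 1 7 9 (s - 1, r * s, s - 1) r; Two
    4 3 0 6 7 (0, 1, 0) (r * s * s - s * s + s)]
  (Empty [::] 1 [:: (0, 3, 6)]%N);
   Certificate [:: (0, 1, 2); (0, 3, 4); (0, 5, 7); (1, 3, 8); (1, 6, 9); (2,
  5, 9); (2, 7, 8); (3, 7, 9); (4, 6, 7); (4, 8, 9); (5, 6, 8)]%N (9, 0, 7,
  8)%N
  [:: One 5 7 0 2; Two 2 7 8 9 5 (t, t, 1) 1; One 3 9 7 0; Two 1 2 0 3 8 (-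
    r * t + t, - r * t + 1, - r + 1) 1; Two 4 9 8 3 0 (- 1, - r, - r) 1;
    Two 6 5 8 9 1 (- 1, r * t - 1, r - 1) (t - 1)]
  (Linear r (r - 1) (EquationData (4, 6, 7)%N (- 1) (- 1) 1 [::]) 0 1 1 [::
    (0, 3, 9)]%N);
   Certificate [:: (0, 1, 2); (0, 3, 4); (0, 5, 7); (1, 3, 8); (1, 6, 9); (2,
  6, 7); (2, 8, 9); (3, 7, 9); (4, 5, 9); (4, 7, 8); (5, 6, 8)]%N (6, 7, 8,
  9)%N
  [:: Two 2 8 9 7 6 (- 1, - 1, 0) 1; One 5 6 8 2; Two 4 9 5 8 7 (0, 1, - t
       + 1) 1; One 3 9 7 0; Two 0 3 4 7 5 (- 1, - r, - t) (t - 1); Two 1 8 3 6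
    9 (1, r + 1, r + 1) 1]
  (Linear r (- r * r + 1) (EquationData (0, 1, 2)%N (- 1) (- 1) 1 [::]) 0 1
    1 [:: (0, 1, 3)]%N);
   Certificate [:: (0, 1, 2); (0, 3, 4); (0, 5, 7); (1, 5, 8); (1, 6, 9); (2,
  5, 9); (2, 7, 8); (3, 6, 7); (3, 8, 9); (4, 6, 8); (4, 7, 9)]%N (4, 3, 8,
  7)%N
  [:: Two 6 8 4 3 7 (- 1, 0, - 1) 1; Two 9 7 4 8 3 (0, 1, 1) 1; One 0 3 4
    2; One 2 8 7 0; Two 1 6 9 2 0 (r + t, r * t + 1, r * t + r + t + 1) 1;
    Two 5 0 7 9 2 (r, r + t - 1, r + t) 1]
  (Linear 1 (- r * r + 2 * r) (EquationData (1, 5, 8)%N (t - 1) (- 1) 1 [::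
    (0, 2, 7)]%N) 0 1 1 [::]);
   Certificate [:: (0, 1, 2); (0, 3, 4); (0, 5, 7); (1, 5, 8); (1, 6, 9); (2,
  6, 7); (2, 8, 9); (3, 5, 9); (3, 7, 8); (4, 6, 8); (4, 7, 9)]%N (1, 8, 7,
  6)%N
  [:: One 5 8 1 0; One 0 7 5 2; Two 2 7 6 1 0 (t, t, 1) 1; Two 9 8 2 1 6 (-
    t, - 1, - 1) 1; Two 3 7 8 9 5 (0, r - t, r) 1; Two 4 6 8 9 7 (- t, - 1,
    - t) 1]
  (Linear r (- r - 1) (EquationData (0, 3, 4)%N (- r * t + t * t) (- 1) 1
    [:: (0, 3, 9)]%N) 0 1 1 [:: (0, 5, 8)]%N);
   Certificate [:: (0, 1, 2); (0, 3, 4); (0, 5, 7); (1, 5, 8); (1, 6, 9); (2,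
  6, 8); (2, 7, 9); (3, 5, 9); (3, 7, 8); (4, 6, 7); (4, 8, 9)]%N (7, 9, 8,
  1)%N
  [:: One 3 8 7 0; Two 5 3 9 1 8 (r, r, 1) 1; One 6 9 1 2; Two 2 9 7 8 6
    (t, t + 1, 0) 1; Two 0 7 5 1 2 (- r * t - 1, - r * t - r, - t - 1) 1;
    Two 4 6 7 8 9 (0, t + 1, t) 1]
  (Linear (r * r) (- r + 1) (EquationData (0, 3, 4)%N (t + 1) (- 1) 1 [::
    (0, 2, 8)]%N) 0 1 1 [:: (3, 5, 8)]%N);
   Certificate [:: (0, 1, 2); (0, 3, 4); (0, 7, 8); (1, 3, 7); (1, 5, 9); (2,
  5, 8); (2, 6, 9); (3, 8, 9); (4, 6, 8); (4, 7, 9); (5, 6, 7)]%N (6, 9, 8,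
  5)%N
  [:: Two 2 9 6 5 8 (- 1, - 1, 0) 1; One 3 8 9 0; One 4 8 6 2; Two 7 9 4 5
    6 (t, 1, 1) 1; Two 0 3 4 8 7 (r * t, r, r + 1) t; Two 1 9 5 7 3 (- t, -
    r * t + r - 1, - t) 1]
  (Linear r (r * r - 1) (EquationData (0, 1, 2)%N (- t + 1) (- 1) 1 [:: (0,
    2, 7)]%N) 0 1 1 [:: (0, 4, 6)]%N);
   Certificate [:: (0, 1, 2); (0, 3, 4); (0, 7, 8); (1, 5, 7); (1, 6, 9); (2,
  5, 9); (2, 6, 8); (3, 5, 8); (3, 7, 9); (4, 6, 7); (4, 8, 9)]%N (8, 7, 5,
  4)%N
  [:: One 3 8 5 0; Two 0 3 4 8 7 (r - 1, r, 0) 1; Two 9 7 3 4 8 (1, r, r)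
    1; One 6 7 4 1; Two 1 6 9 7 5 (0, r * s - s - 1, r * s - s) 1; Two 2 6
    8 1 0 (1, s + 1, s) (r * r * s - r * s)]
  (Empty [:: ((2, 5, 9)%N, 1)] 1 [:: (0, 5, 6)]%N);
   Certificate [:: (0, 1, 2); (0, 3, 7); (0, 4, 8); (1, 3, 8); (1, 6, 9); (2,
  3, 9); (2, 5, 7); (4, 5, 9); (4, 6, 7); (5, 6, 8); (7, 8, 9)]%N (9, 0, 2,
  7)%N
  [:: Two 3 0 7 9 2 (- 1, 0, - 1) 1; One 8 9 7 0; Two 1 0 2 8 3 (0, - r, 1)
    1; One 4 0 8 2; Two 5 7 2 9 4 (- r * t - 1, - r * t - 1, - r * t) 1;
    Two 6 1 9 8 5 (- r * r * t + r * r - r * t - 1, r * r, - r) 1]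
  (Linear (2 * r * r + 2 * r) (- r * r - r + 1) (EquationData (4, 6, 7)%N 1
    1 1 [::]) 0 (- 1) 2 [:: (1, 2, 8)]%N);
   Certificate [:: (0, 1, 2); (0, 3, 7); (0, 4, 8); (1, 3, 8); (1, 7, 9); (2,
  5, 7); (2, 8, 9); (3, 6, 9); (4, 5, 9); (4, 6, 7); (5, 6, 8)]%N (9, 2, 7,
  0)%N
  [:: Two 1 0 2 9 7 (1, 0, 1) 1; One 5 7 2 0; One 8 9 2 2; Two 3 8 1 7 0
    (t, t, t - 1) 1; Two 4 8 0 9 5 (- r - t + 1, - r * t, - t) 1; Two 6 7 4
    8 5 (- r * r - r * t + r, - r * r * t, t * t - t) 1]
  (Linear 1 (r * r) (EquationData (3, 6, 9)%N (t * t - t) 1 1 [:: (2, 6,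
    8)]%N) 0 1 1 [::]);
   Certificate [:: (0, 1, 2); (0, 3, 7); (0, 4, 8); (1, 3, 9); (1, 4, 7); (2,
  5, 8); (2, 6, 9); (3, 6, 8); (4, 5, 9); (5, 6, 7); (7, 8, 9)]%N (9, 8, 4,
  1)%N
  [:: Two 7 8 9 1 4 (- 1, - 1, 0) 1; One 0 4 8 2; Two 3 9 1 7 0 (t - 1, -
    1, - 1) 1; One 5 9 4 0; Two 2 1 0 5 8 (- 1, - r * t + t - 1, - r) 1;
    Two 6 2 9 7 5 (- r * t + t - 2, - r * t + t - 1, - r) r]
  (Linear (2 * r - 1) (- r + 2) (EquationData (3, 6, 8)%N 1 1 1 [::]) 2 (-
    2 * t + 1) 3 [::]);
   Certificate [:: (0, 1, 2); (0, 3, 7); (0, 4, 8); (1, 3, 9); (1, 5, 7); (2,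
  4, 9); (2, 5, 8); (3, 6, 8); (4, 6, 7); (5, 6, 9); (7, 8, 9)]%N (9, 1, 0,
  8)%N
  [:: One 3 1 9 2; Two 7 0 3 8 9 (- t, - 1, - 1) 1; One 6 8 3 0; Two 4 0 8
    6 7 (1, 1, - r + 1) (t - 1); Two 2 9 4 0 1 (0, - 1, r - 1) 1; Two 5 6 9
    2 8 (r, r + 1, 1) r]
  (Linear 1 (- r) (EquationData (1, 5, 7)%N (- 1) (- 1) 1 [::]) 0 1 1 [::]);
   Certificate [:: (0, 1, 2); (0, 3, 7); (0, 4, 8); (1, 4, 7); (1, 5, 9); (2,
  3, 9); (2, 6, 8); (3, 5, 8); (4, 6, 9); (5, 6, 7); (7, 8, 9)]%N (7, 1, 8,
  5)%N
  [:: Two 9 7 8 5 1 (- 1, 0, - 1) 1; One 4 7 1 2; Two 6 7 5 4 9 (- t - 1, -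
    t, - t) 1; One 0 4 8 0; Two 2 6 8 0 1 (t + 1, t, r * t + r) 1; Two 3 0
    7 8 5 (t, t, r) 1]
  (Linear r (- 1) (EquationData (2, 3, 9)%N t (- 1) 1 [:: (0, 7, 8)]%N) 0
    (- 1) 1 [:: (0, 1, 4)]%N);
   Certificate [:: (0, 1, 2); (0, 3, 7); (0, 4, 8); (1, 5, 7); (1, 8, 9); (2,
  5, 8); (2, 7, 9); (3, 4, 9); (3, 6, 8); (4, 6, 7); (5, 6, 9)]%N (9, 2, 1,
  4)%N
  [:: One 8 1 9 0; Two 0 2 1 4 8 (0, r, r - 1) 1; One 5 8 2 2; Two 7 1 5 2
    9 (- r, - t, 0) 1; Two 3 4 9 0 7 (r, - r * t + t, - r * t + t) 1; Two 6
    8 3 7 4 (r * t - r, r * t - t, r * t) (r * t + r - t)]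
  (Linear r (- r + 1) (EquationData (5, 6, 9)%N t (- 1) 1 [:: (1, 5, 9)]%N)
    0 1 1 [:: (0, 1, 4)]%N);
   Certificate [:: (0, 1, 2); (0, 3, 7); (0, 4, 8); (1, 5, 7); (1, 8, 9); (2,
  6, 8); (2, 7, 9); (3, 4, 9); (3, 5, 8); (4, 6, 7); (5, 6, 9)]%N (3, 7, 9,
  1)%N
  [:: One 4 3 9 0; One 6 7 4 2; Two 5 9 6 7 1 (- t, - 1, - t) 1; Two 8 5 3
    9 1 (- 1, - 1, - t) 1; Two 0 8 4 3 7 (r - t, r, 0) 1; Two 2 6 8 7 9 (0,
    - t + 1, r * t - t * t) 1]
  (Conjugate 1 (-1) 1 (EquationData (0, 1, 2)%N (- r + t) 1 1 [:: (0, 1,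
    7)]%N));
   Certificate [:: (0, 1, 2); (0, 3, 7); (0, 4, 8); (1, 5, 7); (1, 8, 9); (2,
  6, 8); (2, 7, 9); (3, 5, 8); (3, 6, 9); (4, 5, 9); (4, 6, 7)]%N (5, 7, 9,
  8)%N
  [:: Two 1 5 7 8 9 (1, 1, 0) 1; One 2 9 7 0; One 0 2 1 2; Two 3 0 7 5 8
    (t, 1, 1) 1; Two 4 9 5 0 8 (- r, 0, - r - t + 1) 1; Two 6 2 8 9 3 (r *
    t, r, r * t - t + 1) 1]
  (Linear 1 1 (EquationData (4, 6, 7)%N (- r * t + r) 1 1 [:: (1, 6, 8)]%N)
    0 1 1 [::]);
   Certificate [:: (0, 1, 2); (0, 3, 7); (0, 6, 8); (1, 4, 8); (1, 6, 9); (2,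
  5, 9); (2, 6, 7); (3, 4, 5); (3, 8, 9); (4, 7, 9); (5, 7, 8)]%N (5, 7, 4,
  2)%N
  [:: Two 9 2 5 4 7 (0, 1, 1) 1; One 3 5 4 1; Two 8 7 5 3 9 (- 1, s, 0) 1;
    One 0 3 7 2; Two 1 4 8 0 2 (t - 1, - s * t + s, - s * s + t) 1; Two 6 9
    1 7 2 (- t + 1, - s * s + s * t - s + 1, - t + 1) 1]
  (Quadratic (- 1) (- s + 1) (s * s * s) (EquationData (0, 6, 8)%N (- 1) (-
    1) 1 [::]) 0 (- 1) 1 [::]);
   Certificate [:: (0, 1, 2); (0, 3, 8); (0, 4, 7); (1, 3, 9); (1, 5, 7); (2,
  4, 9); (2, 5, 8); (3, 6, 7); (4, 6, 8); (5, 6, 9); (7, 8, 9)]%N (9, 3, 7,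
  0)%N
  [:: Two 8 0 3 9 7 (1, 0, 1) 1; One 1 9 3 0; One 5 1 7 1; Two 2 8 5 1 0 (r
       * s - s + 1, r, r * s) 1; Two 4 9 2 0 7 (1, 1, s) r; Two 6 5 9 7 3 (0,
    r, s) 1]
  (Empty [::] 1 [:: (3, 4, 5)]%N);
   Certificate [:: (0, 1, 2); (0, 3, 8); (0, 4, 9); (1, 3, 7); (1, 5, 8); (2,
  4, 7); (2, 6, 9); (3, 5, 9); (4, 6, 8); (5, 6, 7); (7, 8, 9)]%N (0, 4, 2,
  8)%N
  [:: One 9 4 0 0; Two 6 9 2 4 8 (r, 1, r) 1; Two 7 4 2 8 9 (0, r - 1, r)
    1; One 1 2 0 2; Two 3 7 1 8 0 (- t, r - 1, r - 1) 1; Two 5 9 3 8 1 (r -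
    t, r, r - 1) (r + t - 1)]
  (Linear (- r + 2) (r * r - 1) (EquationData (5, 6, 7)%N (- r) 1 1 [:: (0,
    1, 5)]%N) 0 r 1 [:: (0, 6, 7)]%N);
   Certificate [:: (0, 1, 2); (0, 3, 9); (0, 4, 8); (1, 3, 7); (1, 5, 8); (2,
  4, 7); (2, 6, 9); (3, 6, 8); (4, 5, 9); (5, 6, 7); (7, 8, 9)]%N (0, 3, 8,
  1)%N
  [:: One 4 8 0 2; One 9 3 0 0; Two 5 1 8 4 9 (- t, - t, r - 1) 1; Two 7 9
    8 3 1 (r, 1, r) 1; Two 2 7 4 1 0 (- r * t + r + t, 1, 1) 1; Two 6 2 9 5
    7 (r + t, t + 1, 1) (r * r * t - r * t)]
  (Linear 1 r (EquationData (3, 6, 8)%N (- 1) (- 1) 1 [::]) 0 1 1 [::]);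
   Certificate [:: (0, 1, 3); (0, 2, 4); (0, 7, 8); (1, 2, 9); (1, 5, 7); (2,
  5, 8); (3, 6, 7); (3, 8, 9); (4, 6, 8); (4, 7, 9); (5, 6, 9)]%N (4, 0, 1,
  7)%N
  [:: One 2 0 4 0; Two 9 7 4 2 1 (- r, - 1, - 1) 1; One 3 1 0 1; Two 8 9 3
    0 7 (- r, - r * s + s - 1, - r) 1; Two 5 8 2 7 1 (s, s, 1) (r * r - r);
    Two 6 8 4 3 7 (1, r * s - s + 1, r) (s - 1)]
  (Empty [::] 1 [:: (3, 4, 5)]%N);
   Certificate [:: (0, 1, 3); (0, 2, 4); (0, 7, 8); (1, 2, 9); (1, 5, 7); (2,
  5, 8); (3, 6, 8); (3, 7, 9); (4, 6, 7); (4, 8, 9); (5, 6, 9)]%N (1, 8, 2,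
  0)%N
  [:: One 5 8 2 2; Two 7 8 0 5 1 (t, 1, t) 1; One 9 1 2 0; Two 3 1 0 7 9 (r
       * t - t + 1, r, r) 1; Two 4 9 8 0 2 (1, 1, r) 1; Two 6 8 3 7 4 (- r * t
       + t - 1, - r + t - 1, - r) (r * t - t)]
  (Linear 1 (- r * r - 1) (EquationData (5, 6, 9)%N (- t) 1 1 [:: (0, 5,
    8)]%N) 0 1 1 [::]);
   Certificate [:: (0, 1, 3); (0, 2, 4); (0, 7, 8); (1, 2, 9); (1, 5, 7); (2,
  6, 8); (3, 5, 8); (3, 7, 9); (4, 6, 7); (4, 8, 9); (5, 6, 9)]%N (3, 8, 9,
  2)%N
  [:: One 7 3 9 0; One 6 2 8 2; Two 4 8 9 7 6 (0, - t - 1, r - 1) 1; Two 0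
    2 4 7 8 (- 1, t, - r) (r - 1); Two 1 2 9 3 0 (- t, - t, r) 1; Two 5 3 8
    6 9 (1, t + 1, 0) 1]
  (Conjugate 1 1 1 (EquationData (1, 5, 7)%N (- r) 1 1 [:: (0, 3, 8)]%N));
   Certificate [:: (0, 1, 3); (0, 2, 4); (0, 7, 8); (1, 2, 9); (1, 5, 7); (2,
  6, 8); (3, 6, 7); (3, 8, 9); (4, 5, 8); (4, 7, 9); (5, 6, 9)]%N (0, 9, 7,
  1)%N
  [:: One 4 9 7 0; Two 2 4 0 1 9 (r, 1, r) 1; One 8 0 7 2; Two 3 8 9 0 1
    (1, t, t) 1; Two 5 1 7 4 8 (1, 1, r + t) 1; Two 6 7 3 5 9 (1, t, r + t)
    1]
  (Conjugate 1 (-1) 1 (EquationData (2, 6, 8)%N r 1 1 [:: (0, 1, 6)]%N));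
   Certificate [:: (0, 1, 3); (0, 2, 4); (0, 7, 8); (1, 5, 7); (1, 6, 9); (2,
  5, 9); (2, 6, 8); (3, 6, 7); (3, 8, 9); (4, 5, 8); (4, 7, 9)]%N (7, 8, 9,
  6)%N
  [:: Two 3 6 7 9 8 (0, 1, 1) 1; One 4 7 9 2; One 1 9 6 1; Two 0 8 7 3 1
    (s, - 1, 0) 1; Two 2 8 6 0 4 (- s * t, t - 1, - s * t) 1; Two 5 2 9 4 8
    (s * t, - t + 1, s * t * t) 1]
  (Quadratic (s * s) (s + 1) (- s - 1) (EquationData (1, 5, 7)%N 1 1 1
    [::]) 0 t 1 [:: (0, 2, 8)]%N);
   Certificate [:: (0, 1, 3); (0, 2, 7); (0, 4, 8); (1, 5, 9); (1, 6, 8); (2,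
  4, 5); (2, 6, 9); (3, 6, 7); (3, 8, 9); (4, 7, 9); (5, 7, 8)]%N (3, 1, 6,
  9)%N
  [:: Two 8 9 3 1 6 (0, - 1, - 1) 1; One 5 1 9 0; Two 7 5 8 3 6 (- r, 0, 1)
    1; One 0 1 3 2; Two 2 0 7 9 6 (r, r, t - 1) 1; Two 4 9 7 8 0 (- t, r -
    t, r - t + 1) 1]
  (Linear 1 (r * r - 1) (EquationData (2, 4, 5)%N (r - t) 1 1 [:: (0, 5,
    8)]%N) 0 1 1 [::]);
   Certificate [:: (0, 1, 3); (0, 2, 7); (0, 4, 9); (1, 2, 8); (1, 6, 9); (2,
  4, 5); (3, 6, 7); (3, 8, 9); (4, 7, 8); (5, 6, 8); (5, 7, 9)]%N (8, 3, 1,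
  7)%N
  [:: One 0 1 3 2; Two 2 7 0 1 8 (- t, 0, - t + 1) 1; One 9 3 8 0; Two 4 8
    7 9 0 (- r * t + r, 1, 1) 1; Two 5 9 7 2 4 (- r * t + r + t, 1, t) (r *
    t - r + 1); Two 6 5 8 1 9 (r, 1, t) 1]
  (Linear 1 (- r) (EquationData (3, 6, 7)%N 1 1 1 [::]) 0 1 1 [::]);
   Certificate [:: (0, 1, 3); (0, 2, 7); (0, 4, 9); (1, 2, 8); (1, 6, 9); (2,
  4, 5); (3, 6, 8); (3, 7, 9); (4, 7, 8); (5, 6, 7); (5, 8, 9)]%N (8, 0, 9,
  6)%N
  [:: One 4 0 9 2; One 7 4 8 1; Two 3 8 6 7 9 (s, 1, 1) 1; Two 1 3 0 6 9
    (s, s, 1) 1; Two 2 0 7 1 8 (s, s * t, t) 1; Two 5 6 7 9 8 (s - 1, 0, t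
    - 1) 1]
  (Quadratic (s * s - s) 1 (- s) (EquationData (2, 4, 5)%N 1 1 1 [::]) 0 (-
    1) 1 [:: (1, 3, 9)]%N);
   Certificate [:: (0, 1, 3); (0, 2, 7); (0, 6, 8); (1, 4, 8); (1, 5, 9); (2,
  4, 5); (2, 6, 9); (3, 6, 7); (3, 8, 9); (4, 7, 9); (5, 7, 8)]%N (7, 9, 5,
  3)%N
  [:: Two 8 5 7 3 9 (1, 0, 1) 1; One 1 9 5 1; Two 4 9 7 1 8 (s, - 1, 0) 1;
    One 2 5 4 2; Two 0 3 1 7 2 (s * t + 1, s * t - t, - s + 1) 1; Two 6 9 2
    3 7 (s * t, 1, 1) 1]
  (Quadratic (s * s - s) (- 2 * s + 1) (- s) (EquationData (0, 6, 8)%N (-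
    1) (- 1) 1 [::]) 0 (- 1) 1 [:: (0, 4, 9)]%N);
   Certificate [:: (0, 1, 3); (0, 2, 7); (0, 6, 8); (1, 4, 8); (1, 6, 9); (2,
  3, 9); (2, 4, 5); (3, 7, 8); (4, 7, 9); (5, 6, 7); (5, 8, 9)]%N (5, 8, 3,
  2)%N
  [:: Two 9 5 8 2 3 (1, 1, 0) 1; One 4 5 2 1; Two 7 9 4 3 8 (0, 1, - s) 1;
    One 6 7 5 2; Two 0 7 2 8 6 (s * t, s * t + s + t, - s * s) 1; Two 1 8 4
    6 9 (- s - 1, - s - t, - s) s]
  (Quadratic (- s) (2 * s + 1) (s * s + s) (EquationData (0, 1, 3)%N 1 1 1
    [::]) 0 1 1 [:: (1, 5, 8)]%N);
   Certificate [:: (0, 1, 3); (0, 4, 7); (0, 6, 9); (1, 5, 8); (1, 6, 7); (2,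
  3, 9); (2, 4, 5); (2, 6, 8); (3, 7, 8); (4, 8, 9); (5, 7, 9)]%N (7, 3, 9,
  4)%N
  [:: Two 8 9 4 3 7 (- 1, - 1, 0) 1; One 2 9 3 1; Two 5 4 2 7 9 (s, 0, s -
    1) 1; One 1 5 8 2; Two 0 1 3 4 7 (- s + t, - s + 1, - s + 1) 1; Two 6 7
    1 8 2 (s * s - s + t, t, - s + 1) 1]
  (Quadratic 1 (- 1) (s * s * s - 2 * s * s + s) (EquationData (0, 6, 9)%N
    1 1 1 [::]) 0 1 1 [::]);
   Certificate [:: (0, 1, 4); (0, 2, 3); (0, 7, 8); (1, 3, 7); (1, 5, 9); (2,
  5, 8); (2, 6, 9); (3, 8, 9); (4, 6, 8); (4, 7, 9); (5, 6, 7)]%N (6, 8, 9,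
  0)%N
  [:: One 7 0 8 1; Two 4 8 6 9 7 (1, s + 1, 0) 1; One 3 9 8 2; Two 1 7 3 4
    0 (s + t, s * s + s + t, t) 1; Two 2 9 6 0 3 (t, 0, t - 1) 1; Two 5 2 8
    6 7 (t, s * t - s + t - 1, t - 1) 1]
  (Quadratic (- s) (s + 1) (s * s + s) (EquationData (1, 5, 9)%N (- 1) (-
    1) 1 [::]) 0 (- 1) 1 [:: (0, 1, 8)]%N);
   Certificate [:: (0, 1, 2); (0, 4, 5); (0, 6, 7); (1, 4, 8); (1, 5, 9); (2,
  6, 9); (2, 7, 8); (3, 4, 6); (3, 5, 7); (3, 8, 9); (4, 7, 9); (5, 6,
  8)]%N (9, 8, 7, 5)%N
  [:: Two 3 9 8 5 7 (1, 1, 0) 1; One 2 7 8 0; Two 6 9 2 8 5 (1, r, 1) 1;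
    Two 4 9 7 6 3 (r - 1, 0, - 1) 1; Two 0 6 7 5 4 (1, r, r + 1) (r - 1);
    Two 1 4 8 5 9 (- r + 1, 1, 1) 1]
  (Empty [::] 1 [:: (1, 2, 3)]%N);
   Certificate [:: (0, 1, 2); (0, 4, 6); (0, 5, 7); (1, 4, 8); (1, 5, 9); (2,
  6, 9); (2, 7, 8); (3, 4, 5); (3, 6, 7); (3, 8, 9); (4, 7, 9); (5, 6,
  8)]%N (8, 6, 4, 9)%N
  [:: One 5 8 6 0; Two 1 9 5 4 8 (- r + 1, 0, - r) 1; Two 3 4 5 8 9 (1, r,
    r) 1; Two 7 6 3 4 9 (1, 1, r) 1; Two 0 6 4 7 5 (0, - r + 1, r) 1; Two 2
    1 0 9 6 (r, 1, r) (r - 1)]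
  (Free);
   Certificate [:: (0, 1, 4); (0, 2, 5); (0, 6, 7); (1, 6, 8); (1, 7, 9); (2,
  4, 8); (2, 6, 9); (3, 4, 7); (3, 5, 6); (3, 8, 9); (4, 5, 9); (5, 7,
  8)]%N (2, 5, 6, 8)%N
  [:: One 9 6 2 2; Two 3 6 5 8 9 (0, - t, - t + 1) 1; Two 4 9 5 2 8 (t, 1,
    1) 1; Two 7 8 5 3 4 (t, t + 1, t) (t - 1); Two 0 6 7 2 5 (t, t + 1, 0)
    1; Two 1 6 8 4 0 (t * t, t * t, 1) 1]
  (Conjugate 1 1 1 (EquationData (1, 7, 9)%N (t * t - t) 1 1 [:: (0, 3,
    5)]%N));
   Certificate [:: (0, 1, 4); (0, 2, 5); (0, 6, 7); (1, 6, 8); (1, 7, 9); (2,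
  4, 8); (2, 6, 9); (3, 4, 9); (3, 5, 6); (3, 7, 8); (4, 5, 7); (5, 8,
  9)]%N (4, 3, 8, 5)%N
  [:: Two 7 4 5 3 8 (0, 1, 1) 1; Two 9 3 4 8 5 (1, 1, 0) 1; One 6 5 3 2;
    Two 1 7 9 8 6 (1, t + 1, t) 1; Two 0 1 4 7 6 (1, t * t + t, t * t) 1;
    Two 2 6 9 4 8 (- t, 0, 1) 1]
  (Linear 2 (- 1) (EquationData (0, 2, 5)%N (t + 1) 1 1 [:: (1, 2, 4)]%N) 0
    1 2 [::]);
   Certificate [:: (0, 1, 4); (0, 2, 5); (0, 7, 8); (1, 2, 6); (1, 7, 9); (2,
  8, 9); (3, 4, 7); (3, 5, 8); (3, 6, 9); (4, 5, 9); (4, 6, 8); (5, 6,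
  7)]%N (8, 2, 4, 5)%N
  [:: Two 9 4 5 8 2 (1, 1, 0) 1; One 3 5 8 0; Two 6 4 8 9 3 (- r, 0, - 1)
    1; Two 7 6 5 4 3 (r + 1, 1, 2) r; Two 0 7 8 5 2 (2, 1, 2) 1; Two 1 2 6
    9 7 (2 * r, r, 2) 1]
  (Free);
   Certificate [:: (0, 1, 4); (0, 2, 5); (0, 7, 8); (1, 2, 6); (1, 7, 9); (2,
  8, 9); (3, 4, 7); (3, 5, 9); (3, 6, 8); (4, 5, 8); (4, 6, 9); (5, 6,
  7)]%N (6, 5, 3, 4)%N
  [:: Two 7 3 4 6 5 (1, 1, 0) 1; Two 8 3 6 4 5 (1, 0, 1) 1; Two 9 6 4 5 3
    (0, 1, 1) 1; One 2 8 9 0; Two 0 7 8 5 2 (1, - r, r + 1) 1; Two 1 6 2 9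
    7 (1, - r, - r - 1) 1]
  (Empty [::] 1 [:: (0, 1, 3)]%N);
   Certificate [:: (0, 1, 4); (0, 2, 6); (0, 5, 7); (1, 3, 5); (1, 8, 9); (2,
  4, 8); (2, 7, 9); (3, 6, 9); (3, 7, 8); (4, 5, 9); (4, 6, 7); (5, 6,
  8)]%N (4, 3, 6, 2)%N
  [:: One 7 6 4 0; Two 8 2 4 3 7 (- r, - 1, - 1) 1; Two 9 7 2 3 6 (0, r, r
    - 1) 1; Two 5 6 8 9 4 (r * r, r, r - 1) 1; Two 0 2 6 5 7 (1, 1, 0) (r *
    r); Two 1 5 3 0 4 (0, - 1, 0) (r - 1)]
  (Empty [::] 1 [:: (0, 1, 3)]%N);
   Certificate [:: (0, 1, 4); (0, 5, 6); (0, 7, 8); (1, 5, 7); (1, 6, 9); (2,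
  3, 4); (2, 5, 8); (2, 7, 9); (3, 5, 9); (3, 6, 8); (4, 6, 7); (4, 8,
  9)]%N (5, 8, 9, 7)%N
  [:: Two 2 8 5 9 7 (1, 1, 0) 1; One 4 8 9 0; Two 3 5 9 2 4 (- 1, 0, r) 1;
    Two 6 4 7 3 8 (- r, 1, r * r) 1; Two 0 8 7 6 5 (r * r, 1, r * r) 1; Two
    1 9 6 5 7 (- r, 1, 1) 1]
  (Free);
   Certificate [:: (0, 1, 4); (0, 5, 6); (0, 7, 8); (1, 5, 7); (1, 6, 9); (2,
  3, 5); (2, 4, 8); (2, 7, 9); (3, 4, 9); (3, 6, 8); (4, 6, 7); (5, 8,
  9)]%N (5, 2, 8, 6)%N
  [:: Two 3 6 8 5 2 (- 1, - 1, 0) 1; One 9 5 8 0; Two 4 9 3 8 2 (0, 1, - r)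
    1; Two 7 2 9 6 4 (r, 1, r * r) 1; Two 0 6 5 7 8 (- r, - 1, - 1) 1; Two
    1 0 4 7 5 (r * r, 1, r * r) (r + 1)]
  (Empty [::] 1 [:: (1, 2, 6)]%N);
   Certificate [:: (0, 1, 4); (0, 5, 6); (0, 7, 8); (1, 5, 7); (1, 6, 9); (2,
  4, 6); (2, 5, 8); (2, 7, 9); (3, 4, 7); (3, 5, 9); (3, 6, 8); (4, 8,
  9)]%N (4, 2, 9, 5)%N
  [:: Two 8 9 4 5 2 (1, 0, 1) 1; One 6 2 4 2; Two 3 5 9 6 8 (1, 1, - t + 1)
    1; Two 7 9 2 4 3 (0, 1, - t + 1) 1; Two 0 8 7 6 5 (t * t - t + 1, t, 1)
    1; Two 1 4 0 9 6 (- t * t, - t, - 1) 1]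
  (Conjugate 1 0 1 (EquationData (1, 5, 7)%N (t - 1) (- 1) 1 [:: (0, 1,
    2)]%N));
   Certificate [:: (0, 1, 4); (0, 5, 6); (0, 7, 8); (1, 5, 7); (1, 8, 9); (2,
  3, 4); (2, 5, 8); (2, 6, 9); (3, 5, 9); (3, 6, 7); (4, 6, 8); (4, 7,
  9)]%N (2, 4, 9, 8)%N
  [:: Two 6 8 4 9 2 (- 1, 0, - 1) 1; One 3 4 2 0; Two 5 9 3 2 8 (r, 1, 1)
    1; Two 7 3 6 9 4 (0, - 1, r) 1; Two 0 7 8 5 6 (1, r, - r * r + r + 1)
    1; Two 1 7 5 9 8 (- r, - r, r * r - r - 1) 1]
  (Empty [::] 1 [:: (0, 1, 2)]%N);
   Certificate [:: (0, 1, 2); (0, 3, 4); (0, 5, 6); (1, 3, 9); (1, 4, 7); (1,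
  5, 8); (2, 3, 8); (2, 5, 7); (2, 6, 9); (3, 6, 7); (4, 5, 9); (4, 6, 8);
  (7, 8, 9)]%N (3, 7, 5, 1)%N
  [:: One 2 7 5 0; Two 8 2 3 5 1 (1, 1, r) 1; Two 9 3 1 8 7 (- 1, - r, - r)
    1; Two 4 5 9 7 1 (1, r, 1) 1; Two 0 4 3 2 1 (r + 1, r, 1) (r - 1); Two
    6 7 3 9 2 (1, r - 1, 0) r]
  (Empty [:: ((4, 6, 8)%N, - 1)] 2 [:: (0, 1, 3)]%N);
   Certificate [:: (0, 1, 4); (0, 2, 5); (0, 3, 6); (1, 2, 3); (1, 5, 7); (1,
  8, 9); (2, 6, 9); (2, 7, 8); (3, 4, 8); (3, 7, 9); (4, 5, 9); (4, 6, 7);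
  (5, 6, 8)]%N (2, 3, 8, 9)%N
  [:: Two 1 2 3 8 9 (- 1, - 1, 0) 1; Two 7 2 8 3 9 (1, 0, 1) 1; One 5 1 7
    0; Two 4 3 8 5 9 (0, - r, 1) 1; Two 0 1 4 2 5 (r * r - 1, - 1, r) 1;
    Two 6 0 3 2 9 (r * r - 1, r, r) 1]
  (Empty [:: ((5, 6, 8)%N, - r * r - r); ((4, 6, 7)%N, 2 * r - 2)] 5 [::
    (1, 4, 7); (0, 1, 6)]%N)
  ].

End Certificates.

Lemma irreducible_certificates_ok : all certificate_ok irreducible_certificates.
Proof. by vm_compute. Qed.

(** * Reducible families *)

Section Brackets.

(** The multiset of lines in a product of brackets. If two products agree in it and in size,
    rescalings and linear maps cancel in their quotient. *)
Definition flat (K : seq block) : seq nat :=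
  flatten [seq [:: b.1.1; b.1.2; b.2] | b <- K].

Definition bracket (F : comNzRingType) (K : seq block) (a : nat -> vec F) : F :=
  \prod_(b <- K) vdet (a b.1.1) (a b.1.2) (a b.2).

Lemma bracket_scale (F : comNzRingType) K (c : nat -> F) a :
  bracket K (fun i => vscale (c i) (a i)) = (\prod_(i <- flat K) c i) * bracket K a.
Proof.
rewrite /bracket; elim: K => [|b K IH]; first by rewrite !big_nil mulr1.
by rewrite !big_cons IH vdet_scale /flat /= ?big_cons; ring.
Qed.

Lemma bracket_mul (F : comNzRingType) K (M : 'M[F]_3) a :
  bracket K (fun i => vmul (a i) M) = \det M ^+ size K * bracket K a.
Proof.
rewrite /bracket; elim: K => [|b K IH]; first by rewrite !big_nil expr0 mulr1.
by rewrite !big_cons IH vdet_vmul /= exprS; ring.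
Qed.

Lemma bracket_morph (F G : comNzRingType) (f : {rmorphism F -> G}) K (a : nat -> vec F) :
  bracket K (fun i => (f (a i).1.1, f (a i).1.2, f (a i).2)) = f (bracket K a).
Proof.
rewrite /bracket rmorph_prod; apply: eq_bigr => b _.
exact: (vdet_conj f (a b.1.1) (a b.1.2) (a b.2)).
Qed.

Lemma bracket_peval (F : comNzRingType) t K (x : nat -> F) :
  peval x (pprod (map (detv t) K)) = bracket K (member t x).
Proof.
rewrite /bracket; elim: K => [|b K IH]; first by rewrite big_nil peval_const scalar1.
by rewrite big_cons -IH.
Qed.

End Brackets.

(** * Multidegrees of products of determinants *)

Section Multidegree.
Variables (C : comNzRingType).
Implicit Types (f g : {mpoly C[10 * 3]}) (d e : 'I_10 -> nat).

(** The degree is explicit, unlike in [multihomogeneous], because sums are multihomogeneous only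
    when the degrees of their terms agree. *)
Definition multidegree d f : Prop := forall m, m \in msupp f ->
  forall i, (\sum_(j < 3) m (mxvec_index i j) = d i)%N.

Lemma multidegree0 d : multidegree d 0.
Proof. by move=> m; rewrite msupp0. Qed.

Lemma multidegree1 : multidegree (fun=> 0%N) 1.
Proof. by move=> m; rewrite msupp1 inE => /eqP -> i; rewrite big1 // => j _; rewrite mnm0E. Qed.

Lemma multidegreeD d f g : multidegree d f -> multidegree d g -> multidegree d (f + g).
Proof. by move=> df dg m /msuppD_le; rewrite mem_cat => /orP[/df|/dg]. Qed.

Lemma multidegreeN d f : multidegree d f -> multidegree d (- f).
Proof. by move=> df m; rewrite (perm_mem (msuppN _)) => /df. Qed.

Lemma multidegreeZ d (c : C) f : multidegree d f -> multidegree d (c *: f).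
Proof. by move=> df m /msuppZ_le /df. Qed.

Lemma multidegreeM d e f g : multidegree d f -> multidegree e g ->
  multidegree (fun i => d i + e i)%N (f * g).
Proof.
move=> df eg m /msuppM_le /allpairsP[[m1 m2] /= [m1f m2g ->]] i.
by rewrite -(df _ m1f) -(eg _ m2g) -big_split; apply: eq_bigr => j _; rewrite mnmDE.
Qed.

Lemma multidegree_eq d e f : d =1 e -> multidegree d f -> multidegree e f.
Proof. by move=> de df m mf i; rewrite -de; exact: df. Qed.

Lemma multidegreeX d f k : multidegree d f -> multidegree (fun i => k * d i)%N (f ^+ k).
Proof.
move=> df; elim: k => [|k IH]; first by rewrite expr0; exact: multidegree1.
by rewrite exprS; apply: multidegree_eq (multidegreeM df IH) => i; rewrite mulSn.
Qed.

Lemma multidegree_sum d (I : Type) (s : seq I) (F : I -> {mpoly C[10 * 3]}) :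
  (forall i, multidegree d (F i)) -> multidegree d (\sum_(i <- s) F i).
Proof. by move=> dF; apply: big_ind => //; [exact: multidegree0|exact: multidegreeD]. Qed.

Lemma multidegree_var (i : 'I_10) (j : 'I_3) :
  multidegree (fun l => i == l) 'X_(mxvec_index i j).
Proof.
move=> m; rewrite msuppX inE => /eqP -> l.
have idxE j' : (mxvec_index i j == mxvec_index l j') = (i == l) && (j == j').
  by rewrite /mxvec_index (inj_eq (@cast_ord_inj _ _ _)) (inj_eq enum_rank_inj).
rewrite (bigD1 j) //= mnm1E idxE eqxx andbT big1 ?addn0 // => j' jj'.
by rewrite mnm1E idxE [j == _]eq_sym (negPf jj') andbF.
Qed.

Lemma multidegree_vdet (u v w : vec {mpoly C[10 * 3]}) du dv dw :
  let all_multidegree d (x : vec {mpoly C[10 * 3]}) :=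
    [/\ multidegree d x.1.1, multidegree d x.1.2 & multidegree d x.2] in
  all_multidegree du u -> all_multidegree dv v -> all_multidegree dw w ->
  multidegree (fun i => du i + (dv i + dw i))%N (vdet u v w).
Proof.
move=> /= [u1 u2 u3] [v1 v2 v3] [w1 w2 w3].
have minor x y x' y' : multidegree dv x -> multidegree dw y' -> multidegree dv y ->
    multidegree dw x' -> multidegree (fun i => dv i + dw i)%N (x * y' - y * x').
  by move=> *; apply/multidegreeD/multidegreeN; exact: multidegreeM.
apply: multidegreeD; last by apply: multidegreeM => //; exact: minor.
by apply/multidegreeD/multidegreeN; apply: multidegreeM => //; exact: minor.
Qed.

Definition coordinates (i : nat) : vec {mpoly C[10 * 3]} :=
  let X j := 'X_(mxvec_index (inord i) j) in (X 0, X 1, X 2%:R).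

Lemma multidegree_bracket K : multidegree
  (fun i => count (fun l => inord l == i) (flat K)) (bracket K coordinates).
Proof.
rewrite /bracket; elim: K => [|b K IH]; first by rewrite big_nil; exact: multidegree1.
rewrite big_cons; apply: multidegree_eq (multidegreeM (multidegree_vdet _ _ _) IH) => [i|||];
  last by split; exact: multidegree_var.
- by rewrite /flat /= !addnA.
- by split; exact: multidegree_var.
- by split; exact: multidegree_var.
Qed.

End Multidegree.

(** * Projective invariants as quotients of brackets *)

Section CrossRatio.
Variables (R : realType) (K K' : seq block).
Local Notation C := R[i].
Implicit Types (P Q : dual_tuple R) (g : {poly C}).
Hypotheses (sizeK : size K = size K') (flatK : perm_eq (flat K) (flat K')).

Let rows P : nat -> vec C := fun i => mrow (hcoord P) (inord i).
Definition numer P : C := bracket K (rows P).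
Definition denom P : C := bracket K' (rows P).

(** The binary form attached to [g], with the two bracket products substituted for its variables: a
    condition on the quotient without denominators. *)
Definition homogenization g : {mpoly C[10 * 3]} :=
  \sum_(i < size g) g`_i *: (bracket K (@coordinates C) ^+ i *
                             bracket K' (@coordinates C) ^+ ((size g).-1 - i)).

Definition ratio_locus g : set (dual_tuple R) :=
  [set P | eval_at (homogenization g) P = 0].

Lemma eval_at_homogenization g P : eval_at (homogenization g) P =
  \sum_(i < size g) g`_i * (numer P ^+ i * denom P ^+ ((size g).-1 - i)).
Proof.
pose ev : {rmorphism {mpoly C[10 * 3]} -> C} := meval (fun k => mxvec (hcoord P) 0 k).
have brE L : ev (bracket L (@coordinates C)) = bracket L (rows P).
  rewrite -bracket_morph; congr bracket; apply/funext => i.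
  by rewrite /coordinates /rows /mrow /ev /= !mevalXU !mxvecE.
rewrite /eval_at -/ev raddf_sum; apply: eq_bigr => i _ /=.
by rewrite mevalZ mevalM !rmorphXn /= -/ev !brE.
Qed.

Lemma ratio_locusP g P : denom P != 0 ->
  ratio_locus g P <-> g.[numer P / denom P] = 0.
Proof.
move=> d0; rewrite /ratio_locus /= eval_at_homogenization.
have [->|g0] := eqVneq g 0; first by rewrite size_poly0 big_ord0 horner0.
have -> : \sum_(i < size g) g`_i * (numer P ^+ i * denom P ^+ ((size g).-1 - i)) =
    denom P ^+ (size g).-1 * g.[numer P / denom P].
  rewrite horner_coef mulr_sumr; apply: eq_bigr => i _.
  rewrite exprB ?unitfE //; last by rewrite -ltnS prednK ?size_poly_gt0.
  by rewrite expr_div_n; ring.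
split=> [/eqP|->]; last by rewrite mulr0.
by rewrite mulf_eq0 expf_eq0 (negPf d0) andbF => /eqP.
Qed.

(** [flatK] gives both bracket products the same multidegree, hence all terms of the homogenization
    too. *)
Lemma ratio_locus_closed g : zariski_closed (ratio_locus g).
Proof.
exists [set homogenization g]; split=> [_ ->|]; last first.
  by apply/seteqP; split=> P /= h; [move=> _ ->|exact: h].
pose d i := count (fun l => inord l == i :> 'I_10) (flat K').
exists (fun i => (size g).-1 * d i)%N.
have dK : multidegree d (bracket K (@coordinates C)).
  by apply: multidegree_eq (@multidegree_bracket _ K) => i; exact: (seq.permP flatK).
have dK' : multidegree d (bracket K' (@coordinates C)) := @multidegree_bracket _ K'.
apply: multidegree_sum => i; apply: multidegreeZ.
apply: (@multidegree_eq _ (fun j => i * d j + ((size g).-1 - i) * d j)%N) => [j|].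
  2: by apply: multidegreeM; apply: multidegreeX.
by rewrite -mulnDl subnKC // -ltnS prednK // (leq_trans _ (ltn_ord i)).
Qed.

Definition ratio P := numer P / denom P.

Lemma ratio_equiv (u : 'I_10 -> vec C) (P : dual_tuple R) (M : 'M[C]_3) (c : 'I_10 -> C) :
  M \in unitmx -> (forall i, c i != 0 /\ vmul (mrow (hcoord P) i) M = vscale (c i) (u i)) ->
  exists2 k, k != 0 & numer P = k * bracket K (fun i => u (inord i)) /\
                      denom P = k * bracket K' (fun i => u (inord i)).
Proof.
rewrite unitmxE unitfE => M0 h.
pose e := \prod_(i <- flat K) c (inord i); exists (e / \det M ^+ size K).
  rewrite mulf_neq0 ?invr_eq0 ?expf_neq0 // prodf_seq_neq0.
  by apply/allP => i _; case: (h (inord i)).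
have rowsE : (fun i => vmul (rows P i) M) = fun i => vscale (c (inord i)) (u (inord i)).
  by apply/funext => i; case: (h (inord i)).
have d0 n : \det M ^+ n != 0 by rewrite expf_neq0.
split.
  apply: (mulfI (d0 (size K))); rewrite -bracket_mul rowsE bracket_scale -/e.
  by rewrite mulrA [\det M ^+ _ * _]mulrC divfK.
apply: (mulfI (d0 (size K))); rewrite {1}sizeK -bracket_mul rowsE bracket_scale.
by rewrite -(perm_big _ flatK) /= -/e mulrA [\det M ^+ _ * _]mulrC divfK.
Qed.

(** Projectivities multiply both products by the same scalar, so they preserve the quotient;
    conjugation conjugates it, which preserves the roots of a real [g]. *)
Lemma ratio_stable (T : {set {set 'I_10}}) g :
  map_poly Num.conj g = g -> (forall P, realization_space T P -> denom P != 0) ->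
  stable T (ratio_locus g).
Proof.
move=> gR d0; split=> [P Q /asboolP[M Mu PQ]|P].
  have [TP TQ] := (set_valP P, set_valP Q).
  have h i : exists c : C, c != 0 /\
      vmul (mrow (hcoord (val P)) i) M = vscale c (mrow (hcoord (val Q)) i).
    have u0 : row_of (mrow (hcoord (val P)) i) *m M != 0.
      apply: contraNneq (hcoord_neq0 (val P) i) => /(congr1 (mulmxr (invmx M))).
      by rewrite /= mulmxK // mul0mx => ->.
    have uE : <[row_of (mrow (hcoord (val P)) i) *m M]>%VS =
        <[row_of (mrow (hcoord (val Q)) i)]>%VS.
      by rewrite -val_hcoord PQ val_hcoord limg_line lfunE.
    have [c c0 cE] := eq_vline u0 (hcoord_neq0 (val Q) i) uE.
    by exists c; split=> //; apply: row_of_inj; rewrite row_of_vmul cE row_of_scale.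
  have [c cE] := choice h; have [k k0 [nE dE]] := ratio_equiv Mu cE.
  move/(ratio_locusP _ (d0 _ TP)) => gP; apply/(ratio_locusP _ (d0 _ TQ)).
  have <- : numer (val P) / denom (val P) = numer (val Q) / denom (val Q); last exact: gP.
  by rewrite nE dE -/(numer (val Q)) -/(denom (val Q)) -mulf_div divff // mul1r.
have TP := set_valP P; have TP' := realization_space_conj TP.
move/(ratio_locusP _ (d0 _ TP)) => gP; apply/(ratio_locusP _ (d0 _ TP')).
have [c c0 hE] := hcoord_conj (val P).
have rowE L : bracket L (rows (conj_tuple (val P))) =
    (\prod_(i <- flat L) c 0 (inord i)) * (bracket L (rows (val P)))^*.
  rewrite -bracket_morph -(bracket_scale L (fun i => c 0 (inord i))).
  by congr bracket; apply/funext => i; rewrite /rows hE /mrow !mul_diag_mx !mxE.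
have e0 : \prod_(i <- flat K') c 0 (inord i) != 0.
  by rewrite prodf_seq_neq0; apply/allP => i _; exact: c0.
rewrite /numer /denom !rowE (perm_big _ flatK) /= -mulf_div divff // mul1r.
by rewrite -rmorphV ?unitfE ?d0 // -rmorphM -gR horner_map gP rmorph0.
Qed.

End CrossRatio.

(** * Euclidean algorithm for integer polynomials *)

Section IntegerPolynomials.

Definition zlead (p : seq Z) : Z := last Z0 p.

Definition pseudo_reduce (p q : seq Z) : seq Z :=
  strip (Z.eqb Z0) (ladd Z_ops (map (Z.mul (zlead q)) p)
    (nseq (size p - size q) Z0 ++ map (Z.mul (Z.opp (zlead p))) q)).

(** Euclid's algorithm with pseudo-remainders and fuel [n]. A common root survives each step, so
    soundness needs no invariant on leading coefficients. *)
Fixpoint no_common_root (n : nat) (p q : seq Z) : bool :=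
  if n is n'.+1 then
    match q with
    | [::] => false
    | [:: c] => ~~ Z.eqb Z0 c
    | _ => if (size q <= size p)%N then no_common_root n' (pseudo_reduce p q) q
           else no_common_root n' q p
    end
  else false.

(** Divisibility by [q] up to powers of its leading coefficient, which must be nonzero to conclude
    back from the remainder to [p]. *)
Fixpoint reduces_to_zero (n : nat) (q p : seq Z) : bool :=
  if p is [::] then true else
  if n is n'.+1 then reduces_to_zero n' q (pseudo_reduce p q) else false.

Fixpoint zderiv (p : seq Z) : seq Z :=
  if p is _ :: p' then ladd Z_ops p' (Z0 :: zderiv p') else [::].

Definition zhorner (x : Z) (p : seq Z) : Z :=
  foldr (fun a s => Z.add a (Z.mul s x)) Z0 p.

Section Evaluation.
Variable F : comNzRingType.
Implicit Types (x : F) (p q : seq Z).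

Lemma P1_eval_cons x a p : P1_eval x (a :: p) = scalar F a + P1_eval x p * x.
Proof. by []. Qed.

Lemma P1_eval_strip x p : P1_eval x (strip (Z.eqb Z0) p) = P1_eval x p.
Proof.
rewrite /P1_eval; elim: p => //= a p IH; case: strip IH => [|b q] <- //=.
case: ifP => // a0; rewrite mul0r addr0; have [_ _ _ _ h] := Z_ops_sound F.
by rewrite h.
Qed.

Lemma P1_eval_nseq x n p : P1_eval x (nseq n Z0 ++ p) = x ^+ n * P1_eval x p.
Proof.
elim: n => [|n IH]; first by rewrite mul1r.
by rewrite [nseq _ _ ++ _]/= P1_eval_cons IH scalar0 exprS; ring.
Qed.

Lemma P1_eval_map x c p : P1_eval x (map (Z.mul c) p) = scalar F c * P1_eval x p.
Proof.
have [_ _ _ sM _] := Z_ops_sound F.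
rewrite /P1_eval; elim: p => [|a p IH] /=; first by rewrite mulr0.
by rewrite IH [scalar F (Z.mul _ _)]sM; ring.
Qed.

Lemma P1_eval_add x p q : P1_eval x (ladd Z_ops p q) = P1_eval x p + P1_eval x q.
Proof. by have [_ _ h _ _] := P1_sound x; exact: h. Qed.

Lemma P1_eval_reduce x p q : P1_eval x q = 0 ->
  P1_eval x (pseudo_reduce p q) = scalar F (zlead q) * P1_eval x p.
Proof.
move=> q0; rewrite P1_eval_strip P1_eval_add P1_eval_map P1_eval_nseq P1_eval_map q0.
by rewrite !mulr0 addr0.
Qed.

Lemma zhornerE z p : scalar F (zhorner z p) = P1_eval (scalar F z) p.
Proof.
have [_ _ sD sM _] := Z_ops_sound F.
rewrite /zhorner /P1_eval; elim: p => [|a p IH] /=; first exact: scalar0.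
by rewrite [scalar F (Z.add _ _)]sD [scalar F (Z.mul _ _)]sM IH.
Qed.

Lemma P1_eval_horner x p : P1_eval x p = (Poly (map (@scalar F) p)).[x].
Proof.
rewrite /P1_eval; elim: p => [|a p IH] /=; first by rewrite horner0.
by rewrite IH horner_cons addrC.
Qed.

Lemma P1_eval_deriv x p : P1_eval x (zderiv p) = (Poly (map (@scalar F) p))^`().[x].
Proof.
elim: p => [|a p IH]; first by rewrite /= deriv0 horner0.
rewrite [zderiv _]/= P1_eval_add P1_eval_cons IH scalar0 P1_eval_horner /=.
by rewrite cons_poly_def derivD derivC derivM derivX !hornerE [LHS]/= addr0 addrC.
Qed.

End Evaluation.

Section Fields.
Variable R : realType.
Local Notation C := R[i].

Lemma no_common_rootP n p q (x : C) : no_common_root n p q ->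
  P1_eval x p = 0 -> P1_eval x q = 0 -> False.
Proof.
elim: n p q => // n IH p [//|c [|d q]] /=.
  move=> c0 _; rewrite /P1_eval /= mul0r addr0 => /eqP.
  by rewrite (negPf (scalar_neq0 _ c0)).
case: ifP => _ h p0 q0; last exact: (IH _ _ h).
by apply: (IH _ _ h) => //; rewrite P1_eval_reduce // p0 mulr0.
Qed.

Lemma reduces_to_zeroP n p q (x : C) : ~~ Z.eqb Z0 (zlead q) -> reduces_to_zero n q p ->
  P1_eval x q = 0 -> P1_eval x p = 0.
Proof.
move=> l0; elim: n p => [|n IH] [|a p] // h q0.
have /eqP := IH _ h q0; rewrite P1_eval_reduce // mulf_eq0.
by rewrite (negPf (scalar_neq0 _ l0)) => /eqP.
Qed.

End Fields.
End IntegerPolynomials.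

(* Every realization with parameters x satisfies f(x_v) = 0 for the integral *)
(* polynomial f = [red_poly], where v = [red_var], and x_v is the ratio of   *)
(* the products of determinants [red_num] and [red_den]. Conversely a root y *)
(* of f gives the realization with parameters [red_point](y).                *)
Record reducibility_certificate := ReducibilityCertificate {
  red_frame : nat * nat * nat * nat;
  red_steps : seq step;
  red_poly : seq Z;
  red_low : Z;
  red_high : Z;
  red_var : nat;
  red_mult : seq (block * pexpr);
  red_scale : Z;
  red_noncol : seq block;
  red_num : seq block;
  red_den : seq block;
  red_point : seq (seq Z) }.

Definition horner_expr (p : seq Z) (e : pexpr) : pexpr :=
  foldr (fun a s => Add (Const a) (Mul s e)) (Const Z0) p.

Definition triples10 : seq block :=
  [seq b <- [seq (ij.1, ij.2, k) | ij <- [seq (i, j) | i <- iota 0 10, j <- iota 0 10],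
                                   k <- iota 0 10] | wf_block b].

(** The tests on [f] give degree at least 2, simple roots, and a sign change that yields a real
    root. The last test settles each determinant at all roots of [f] at once: it is either divisible
    by [f] or coprime to it. *)
Definition reducibility_ok (B : seq block) (c : reducibility_certificate) : bool :=
  let t := construction (red_frame c) (red_steps c) in
  let f := red_poly c in
  let v := red_var c in
  let d b := interp P1_ops (nth [::] (red_point c)) (detv t b) in
  [&& [&& all wf_block B, spread_ok B & construction_ok B (red_frame c) (red_steps c)],
      vanishing_ok B t (red_mult c) (red_scale c) (horner_expr f (Var v)) (red_noncol c),
      [&& all (noncolv B) (red_den c), size (red_num c) == size (red_den c),
          perm_eq (flat (red_num c)) (flat (red_den c))
        & peq (pprod (map (detv t) (red_num c)))
              (Mul (Var v) (pprod (map (detv t) (red_den c))))],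
      [&& (2 < size f)%N, ~~ Z.eqb Z0 (zlead f), no_common_root 20 f (strip (Z.eqb Z0) (zderiv f)),
          Z.leb (red_low c) (red_high c), Z.leb (zhorner (red_low c) f) Z0
        & Z.leb Z0 (zhorner (red_high c) f)]
    & (nth [::] (red_point c) v == P1_var) &&
      all (fun b => if collinear B b.1.1 b.1.2 b.2 then reduces_to_zero 20 f (d b)
                    else no_common_root 20 f (strip (Z.eqb Z0) (d b))) triples10].

Section Reducibility.
Variables (R : realType) (B : seq block) (c : reducibility_certificate).
Local Notation C := R[i].
Local Notation t := (construction (red_frame c) (red_steps c)).
Local Notation f := (red_poly c).
Local Notation v := (red_var c).

Lemma sorted_triples (P : nat -> nat -> nat -> Prop) :
  (forall i j k, P i j k -> P j i k) -> (forall i j k, P i j k -> P i k j) ->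
  (forall i j k, wf_block (i, j, k) -> P i j k) ->
  forall i j k, uniq [:: i; j; k] -> all (fun l => l < 10)%N [:: i; j; k] -> P i j k.
Proof.
move=> s1 s2 PS i j k /=; rewrite !inE !negb_or andbT => /andP[/andP[ij ik] jk].
move=> /and4P[i10 j10 k10 _].
have {}PS l m n : (l < m < n)%N -> (n < 10)%N -> P l m n.
  by move=> /andP[lm mn] n10; apply: PS; rewrite /wf_block /= lm mn.
have [o|[o|[o|[o|[o|o]]]]] : (i < j < k \/ i < k < j \/ j < i < k \/ j < k < i \/
    k < i < j \/ k < j < i)%N by lia.
- exact: PS.
- by apply: s2; exact: PS.
- by apply: s1; exact: PS.
- by apply/s1/s2; exact: PS.
- by apply/s2/s1; exact: PS.
- by apply/s1/s2/s1; exact: PS.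
Qed.

Hypothesis cok : reducibility_ok B c.

Let wfB : all wf_block B. Proof. by case/and5P: cok => /and3P[]. Qed.
Let sT : spread (config_of B).
Proof. by case/and5P: cok => /and3P[wf sp _] *; exact: spread_okP. Qed.
Let con : construction_ok B (red_frame c) (red_steps c).
Proof. by case/and5P: cok => /and3P[]. Qed.

Definition point (y : C) : nat -> C := fun i => P1_eval y (nth [::] (red_point c) i).

Lemma good_point y : P1_eval y f = 0 -> good B t (point y).
Proof.
move=> y0; case/and5P: cok => _ _ _ /and5P[_ f0 _ _ _] /andP[_ h].
have dE b : vdet (member t (point y) b.1.1) (member t (point y) b.1.2)
    (member t (point y) b.2) =
    P1_eval y (interp P1_ops (nth [::] (red_point c)) (detv t b)).
  by rewrite (interp_sound _ _ (P1_sound y)) -peval_detv.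
have colC i j k : collinear B i j k = collinear B j i k.
  by apply: eq_has => b; rewrite /= andbCA.
have colA i j k : collinear B i j k = collinear B i k j.
  by apply: eq_has => b; congr (_ && _); exact: andbC.
have main i j k : uniq [:: i; j; k] -> all (fun l => l < 10)%N [:: i; j; k] ->
    if collinear B i j k
    then vdet (member t (point y) i) (member t (point y) j) (member t (point y) k) = 0
    else vdet (member t (point y) i) (member t (point y) j) (member t (point y) k) <> 0.
  move: i j k; apply: sorted_triples => i j k.
  - rewrite colC; case: ifP => _; rewrite (vdet_perm _ _ _).1.
      by move/eqP; rewrite oppr_eq0 => /eqP.
    by move=> h0 d0; apply: h0; rewrite d0 oppr0.
  - rewrite colA; case: ifP => _; rewrite (vdet_perm _ _ _).2.
      by move/eqP; rewrite oppr_eq0 => /eqP.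
    by move=> h0 d0; apply: h0; rewrite d0 oppr0.
  - move=> wf; have /(allP h) : (i, j, k) \in triples10.
      have /and3P[ij jk k10] := wf; rewrite /= in ij jk k10.
      have [i10 j10] : (i < 10)%N /\ (j < 10)%N by lia.
      rewrite mem_filter wf.
      apply/allpairsP; exists ((i, j), k); split=> //; last by rewrite mem_iota.
      by apply/allpairsP; exists (i, j); split; rewrite // mem_iota.
    have := dE (i, j, k); set D := interp _ _ _.
    rewrite -[collinear B i j k]/(collinear B (i, j, k).1.1 (i, j, k).1.2 (i, j, k).2).
    move: D => D; case: (collinear _ _ _ _) => vE hd; rewrite vE.
      exact: (reduces_to_zeroP f0 hd y0).
    by move=> d0; apply: (no_common_rootP hd y0); rewrite P1_eval_strip.
move=> i j k; split=> /and3P[u lt cijk]; have := main i j k u lt.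
  by rewrite cijk.
by rewrite (negPf cijk).
Qed.

Lemma bracket_ratio x : good (R := R) B t x ->
  bracket (red_num c) (member t x) = x v * bracket (red_den c) (member t x) /\
  bracket (red_den c) (member t x) != 0.
Proof.
move=> gx; case/and5P: cok => _ _ /and4P[nc _ _ /(peqP x)] + _ _.
rewrite peval_mul !bracket_peval => nE; split=> //.
by rewrite -bracket_peval; exact: good_prod.
Qed.

Lemma flat_lt : {in flat (red_num c), forall i, i < 10}%N /\
  {in flat (red_den c), forall i, i < 10}%N.
Proof.
case/and5P: cok => _ _ /and4P[nc _ pe _] _ _.
suff h : {in flat (red_den c), forall i, i < 10}%N.
  by split=> // i; rewrite (perm_mem pe); exact: h.
move=> i /flattenP[s /mapP[b bK ->]]; have /and3P[_ /and4P[b1 b2 b3 _] _] := allP nc b bK.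
by rewrite !inE => /or3P[] /eqP ->.
Qed.

Lemma bracket_inord K (a : nat -> vec C) : {in flat K, forall i, i < 10}%N ->
  bracket K (fun i => a (inord i : 'I_10)) = bracket K a.
Proof.
move=> K10; apply: eq_big_seq => b bK.
have m i : i \in [:: b.1.1; b.1.2; b.2] -> (i < 10)%N.
  by move=> ib; apply: K10; apply/flattenP; exists [:: b.1.1; b.1.2; b.2] => //; exact: map_f.
by rewrite !inordK // m // !inE eqxx ?orbT.
Qed.

Let sizeK : size (red_num c) = size (red_den c).
Proof. by case/and5P: cok => _ _ /and4P[_ /eqP]. Qed.

Let flatK : perm_eq (flat (red_num c)) (flat (red_den c)).
Proof. by case/and5P: cok => _ _ /and4P[]. Qed.

Local Notation denom := (denom (red_den c)).
Local Notation ratio := (ratio (red_num c) (red_den c)).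

Lemma ratio_member (P : dual_tuple R) (M : 'M[C]_3) (k : 'I_10 -> C) x :
  good B t x -> M \in unitmx ->
  (forall i, k i != 0 /\ vmul (mrow (hcoord P) i) M = vscale (k i) (member t x i)) ->
  denom P != 0 /\ ratio P = x v.
Proof.
move=> gx Mu h; have [l l0 [nE dE]] := ratio_equiv sizeK flatK Mu h.
have [num10 den10] := flat_lt; have [rE d0] := bracket_ratio gx.
rewrite (bracket_inord (member t x) num10) in nE; rewrite (bracket_inord (member t x) den10) in dE.
split; first by rewrite dE mulf_neq0.
by rewrite /ratio nE dE rE mulrCA mulfK // mulf_neq0.
Qed.

Lemma ratio_root (P : dual_tuple R) : realization_space (config_of B) P ->
  denom P != 0 /\ P1_eval (ratio P) f = 0.
Proof.
move=> TP; have [x gx [M [k [Mu h]]]] := family_matches wfB erefl con TP.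
have [d0 ->] := ratio_member gx Mu h; split=> //.
case/and5P: cok => _ van _ _ _; rewrite -[RHS](vanishing gx van) /horner_expr /P1_eval.
elim: f => [|a p IH]; first by rewrite peval_const scalar0.
by rewrite [foldr _ _ _]/= peval_add peval_mul peval_const -IH.
Qed.

Definition realization_at (y : C) : dual_tuple R :=
  tuple_of (fun i : 'I_10 => member t (point y) i).

Lemma realization_atP y : P1_eval y f = 0 ->
  [/\ realization_space (config_of B) (realization_at y),
       denom (realization_at y) != 0 & ratio (realization_at y) = y].
Proof.
move=> y0; have gy := good_point y0; have Ty := realizes_member wfB gy.
have [k k0 kE] := hcoord_tuple_of (realizes_neq0 sT Ty).
have h i : k i != 0 /\ vmul (mrow (hcoord (realization_at y)) i) 1%:M =
    vscale (k i) (member t (point y) i).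
  by split=> //; rewrite -kE; apply: row_of_inj; rewrite row_of_vmul mulmx1.
have [d0 ->] := ratio_member gy (unitmx1 _ _) h; split=> //.
  exact: tuple_of_realizes.
case/and5P: cok => _ _ _ _ /andP[/eqP vE _]; rewrite /point vE.
by rewrite /P1_eval /= scalar0 scalar1; ring.
Qed.

Theorem reducibility_okP : reducible_realizations R (config_of B).
Proof.
pose toC := real_complex R.
case/and5P: cok => _ _ _ /and5P[f2 l0 simple low_high /andP[low high]] _.
pose fR := Poly (map (@scalar R) f).
have fE (y : C) : P1_eval y f = (map_poly toC fR).[y].
  rewrite P1_eval_horner; congr (_.[_]); rewrite /fR map_Poly ?rmorph0 //.
  by rewrite -map_comp; congr Poly; apply: eq_map => z; rewrite /= /scalar rmorph_int.
have scalar_le (z z' : Z) : Z.leb z z' -> scalar R z <= scalar R z'.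
  move=> zz'; rewrite /scalar ler_int; move: zz'; lia.
have [a _ a0] : exists2 a : R, scalar R (red_low c) <= a <= scalar R (red_high c) & root fR a.
  apply: poly_ivt; first exact: scalar_le.
  by rewrite -!P1_eval_horner -!zhornerE -(scalar0 R) !scalar_le.
have [h hE] := factor_theorem _ _ a0.
have fhE (y : C) : P1_eval y f = (map_poly toC h).[y] * (y - toC a).
  by rewrite fE hE rmorphM /= hornerM map_polyXsubC hornerXsubC.
have fa0 : P1_eval (toC a) f = 0 by rewrite fhE subrr mulr0.
(* Otherwise [a] would be a double root, hence also a root of the derivative, against [simple]. *)
have ha0 : (map_poly toC h).[toC a] <> 0.
  move=> ha0; apply: (no_common_rootP simple fa0); rewrite P1_eval_strip P1_eval_deriv.
  have -> : Poly (map (@scalar C) f) = map_poly toC fR.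
    rewrite /fR map_Poly ?rmorph0 // -map_comp; congr Poly.
    by apply: eq_map => z; rewrite /= /scalar rmorph_int.
  rewrite hE rmorphM /= derivM hornerD !hornerM ha0 mul0r addr0 map_polyXsubC.
  by rewrite hornerXsubC subrr mulr0.
have fR0 : size fR = size f.
  rewrite /fR (@PolyK _ 0) ?size_map //.
  have : zlead f != Z0 by apply: contra l0 => /eqP ->.
  rewrite /zlead; case: f f2 => // b p _ /=; rewrite last_map => l.
  by rewrite /scalar intr_eq0; apply: contra l => /eqP /(congr1 Z_of_int); rewrite int_of_ZK => ->.
have size_h : size (map_poly toC h) != 1.
  rewrite size_map_poly; apply: contraTneq f2 => h1.
  have h0 : h != 0 by rewrite -size_poly_eq0 h1.
  by rewrite -fR0 hE size_Mmonic ?monicXsubC // size_XsubC h1.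
(* The second root may be nonreal: only [h], not its individual roots, has to be real. *)
have [b /rootP hb0] := closed_rootP _ size_h.
have fb0 : P1_eval b f = 0 by rewrite fhE hb0 mul0r.
have ba : b - toC a <> 0 by move/subr0_eq => ba; apply: ha0; rewrite -ba.
have realE (p : {poly R}) : map_poly Num.conj (map_poly toC p) = map_poly toC p.
  rewrite -map_poly_comp; apply: eq_map_poly => z; exact: conjc_real.
have [Ta da ra] := realization_atP fa0; have [Tb db rb] := realization_atP fb0.
have d0 (P : dual_tuple R) (TP : realization_space (config_of B) P) := (ratio_root TP).1.
pose g := 'X - a%:P.
exists (ratio_locus (red_num c) (red_den c) (map_poly toC g)), (ratio_locus (red_num c) (red_den c) (map_poly toC h)).
split; first split.
- exact: ratio_locus_closed.
- exact: ratio_locus_closed.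
- exact: ratio_stable.
- exact: ratio_stable.
- move=> P TP; have [dP] := ratio_root TP; rewrite fhE => /eqP.
  rewrite mulf_eq0 => /orP[/eqP rP|/eqP rP]; [right|left]; apply/ratio_locusP => //.
  by rewrite /g map_polyXsubC hornerXsubC.
- exists (realization_at b : dual_tuple R) => // /(ratio_locusP _ _ db); rewrite -/(ratio _) rb.
  by rewrite /g map_polyXsubC hornerXsubC.
- by exists (realization_at (toC a)) => // /(ratio_locusP _ _ da); rewrite -/(ratio _) ra.
Qed.

End Reducibility.

(** * The nine configurations *)

Delimit Scope Z_scope with BinZ.

Section NineConfigurations.
Local Open Scope nat_scope.

Definition block_of_digits (n : nat) : block :=
  ((n %/ 100 + 9) %% 10, ((n %/ 10) %% 10 + 9) %% 10, (n %% 10 + 9) %% 10).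

Definition blocks_of (s : seq nat) : seq block := map block_of_digits s.

Lemma config_of_digits s : config_of (blocks_of s) = triples_of s.
Proof. by rewrite /config_of /blocks_of -map_comp. Qed.

(** Read off from [nine_configurations] instead of being copied, so the two cannot differ. *)
Definition nine_digits : seq (seq nat) := ltac:(
  let n := eval unfold nine_configurations in nine_configurations in
  match n with map _ ?l => exact l end).

Lemma nine_configurationsE : nine_configurations = map triples_of nine_digits.
Proof. by []. Qed.

Local Open Scope pexpr_scope.
Let r := Var 0.
Let s := Var 1.

(** Coefficients are listed by increasing degree. Each cubic has negative discriminant, hence one
    real root and a conjugate pair; each quadratic has two real roots. In the last certificate the
    other parameter of the sample realizations is set to 2. *)
Definition reducible_certificates : seq reducibility_certificate := [::
   ReducibilityCertificate (3, 1, 2, 4)%N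
  [:: Two 6 3 1 2 4 (- 1, - 1, 0) 1; One 9 4 1 0; Two 0 9 3 1 2 (0, - r -
    1, - 1) 1; Two 5 3 4 9 2 (1, r + 1, r + 1) 1; Two 7 5 0 3 2 (- 1, 0, -
    r) (r + 1); Two 8 0 4 7 1 (1, r * r, r) 1]
  [:: (-1); (-1); 0; 1]%BinZ 0 2 0 [:: ((5, 6, 8)%N, - 1)] 1 [::] [:: (9, 4,
    0); (2, 1, 3)]%N [:: (9, 1, 0); (4, 2, 3)]%N [:: [:: 0; 1]%BinZ];
   ReducibilityCertificate (2, 3, 9, 6)%N
  [:: One 5 9 2 0; Two 4 6 2 5 3 (r, 1, 1) 1; Two 7 2 3 4 9 (r, 1, 0) 1;
    Two 0 5 7 9 3 (0, - 1, 1) r; Two 1 2 0 3 6 (1, - 1, 1) 1; Two 8 1 7 4 0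
    (r, r + 2, - r) 1]
  [:: (-1); 1; 1]%BinZ 0 1 0 [:: ((5, 6, 8)%N, - 1)] 2 [::] [:: (5, 9, 0); (2,
    1, 3)]%N [:: (5, 2, 0); (9, 1, 3)]%N [:: [:: 0; 1]%BinZ];
   ReducibilityCertificate (6, 4, 3, 8)%N
  [:: One 5 3 4 0; Two 0 5 8 3 6 (r, 0, r - 1) 1; One 9 5 6 1; Two 1 8 9 6
    4 (s - 1, r - 1, 0) 1; Two 2 1 0 4 8 (s - 1, - 1, s - 1) (r - 1); Two 7
    6 8 3 1 (- s + 1, - r + 1, - r + 1) 1]
  [:: 1; 1; (-1)]%BinZ (-1) 0 0 [:: ((2, 3, 9)%N, r * s - r); ((2, 5, 7)%N, r
       + 1)] (-1) [:: (1, 2, 3)]%N [:: (5, 3, 0); (4, 6, 7)]%N [:: (5, 4, 0);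
    (3, 6, 7)]%N [:: [:: 0; 1]%BinZ; [:: (-1); 1]%BinZ];
   ReducibilityCertificate (0, 2, 8, 3)%N
  [:: One 4 8 2 0; Two 5 8 0 3 4 (r, 0, r - 1) 1; Two 9 3 8 4 0 (r, r, 1)
    1; Two 6 3 0 2 9 (- r, - 1, - 1) 1; Two 1 4 6 0 2 (- r, r - 1, 0) 1;
    Two 7 5 2 6 8 (- r, - 1, - r + 1) r]
  [:: (-1); 3; (-1)]%BinZ 0 1 0 [:: ((1, 3, 7)%N, 1)] (-1) [::] [:: (4, 8, 0);
    (2, 0, 3)]%N [:: (4, 2, 0); (8, 0, 3)]%N [:: [:: 0; 1]%BinZ];
   ReducibilityCertificate (7, 6, 3, 4)%N
  [:: One 5 6 3 0; Two 0 4 6 7 5 (r, 1, r) 1; Two 1 3 0 4 7 (- r, - 1, - 1)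
    1; Two 8 3 7 5 1 (r, 0, - r + 1) 1; Two 2 6 8 3 4 (r, r, - r + 1) 1;
    Two 9 4 8 6 7 (- 2 * r + 1, - r + 1, 0) 1]
  [:: 1; (-3); 2; 1]%BinZ (-4) 0 0 [:: ((2, 5, 9)%N, - 1)] 1 [::] [:: (5, 6,
    0); (3, 1, 4)]%N [:: (5, 3, 0); (6, 1, 4)]%N [:: [:: 0; 1]%BinZ];
   ReducibilityCertificate (8, 5, 6, 3)%N
  [:: Two 4 3 6 5 8 (1, 1, 0) 1; One 7 3 5 0; Two 1 4 7 6 8 (- r, 0, 1) 1;
    Two 2 5 6 8 7 (0, - r - 1, - 1) 1; Two 0 1 3 2 4 (r * r + r + 1, 1, -
    r) 1; Two 9 7 6 3 8 (1, r + 1, r + 1) 1]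
  [:: 1; 3; 2; 1]%BinZ (-1) 0 0 [:: ((0, 5, 9)%N, 1)] 1 [::] [:: (7, 3, 0);
    (1, 5, 6)]%N [:: (7, 5, 0); (3, 1, 6)]%N [:: [:: 0; 1]%BinZ];
   ReducibilityCertificate (3, 7, 6, 2)%N
  [:: Two 5 3 7 6 2 (- 1, - 1, 0) 1; One 8 7 2 0; Two 4 3 6 8 5 (- 1, 0, r)
    1; Two 0 6 7 2 4 (0, 1, r + 1) 1; Two 1 0 3 6 8 (r, r + 1, r * r + 2 *
    r + 1) 1; Two 9 4 7 8 3 (1, - r - 1, - r) r]
  [:: 2; 4; 4; 1]%BinZ (-3) 0 0 [:: ((1, 5, 9)%N, 1)] 1 [::] [:: (8, 7, 0);
    (3, 2, 4)]%N [:: (8, 2, 0); (7, 3, 4)]%N [:: [:: 0; 1]%BinZ];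
   ReducibilityCertificate (7, 4, 3, 2)%N
  [:: One 9 4 7 0; Two 8 9 3 7 2 (- r, - 1, - 1) 1; Two 5 3 7 4 8 (r, 0, 1)
    1; Two 6 4 3 2 5 (0, r, r - 1) 1; Two 0 4 2 8 6 (r, r + 1, r) (r - 1);
    Two 1 5 9 0 3 (r, r + 1, - r) r]
  [:: 1; 0; (-2)]%BinZ (-1) 0 0 [:: ((1, 6, 7)%N, 1)] (-1) [::] [:: (9, 4, 0);
    (7, 2, 3)]%N [:: (9, 7, 0); (4, 2, 3)]%N [:: [:: 0; 1]%BinZ];
   ReducibilityCertificate (3, 1, 4, 2)%N
  [:: Two 0 4 2 3 1 (1, 1, 0) 1; One 5 1 2 0; One 6 5 0 1; Two 7 2 6 4 3 (-
    1, 0, - s - 1) 1; Two 8 1 4 7 0 (0, 1, - s - 1) 1; Two 9 1 6 5 3 (r +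
    s, r + 1, r) r]
  [:: (-1); 1; 1]%BinZ 0 1 1 [:: ((2, 8, 9)%N, - 1)] 1 [::] [:: (6, 5, 1); (2,
    0, 3)]%N [:: (6, 0, 1); (5, 2, 3)]%N [:: [:: 2]%BinZ; [:: 0; 1]%BinZ]
  ].

End NineConfigurations.

Lemma reducible_certificates_ok :
  all2 reducibility_ok (map blocks_of nine_digits) reducible_certificates.
Proof. by vm_compute. Qed.

Lemma nine_reducible (R : realType) T : T \in nine_configurations ->
  reducible_realizations R T.
Proof.
rewrite nine_configurationsE => /mapP[d dn ->]; rewrite -config_of_digits.
have := reducible_certificates_ok.
elim: nine_digits reducible_certificates dn => // e l IH [|c cs] //.
rewrite inE => de /andP[ok oks]; case/orP: de => [/eqP ->|dl].
  exact: reducibility_okP ok.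
exact: IH dl oks.
Qed.

(** * Classification *)

Section Classification.
Implicit Types (T : {set {set 'I_10}}) (B : seq block) (D : seq nat).

Definition degree T (i : 'I_10) : nat := #|[set t in T | i \in t]%SET|.

Definition linear_space T : Prop :=
  (forall t, t \in T -> #|t| = 3%N) /\
  (forall i j t u, i != j -> t \in T -> u \in T -> i \in t -> j \in t ->
     i \in u -> j \in u -> t = u).

Lemma ten_line_configurationP T : ten_line_configuration T ->
  linear_space T /\ forall i, (3 <= degree T i)%N.
Proof.
case/and3P=> /forall_inP T3 /forallP Tu /forallP Td; split; last exact: Td.
split=> [t /T3 /eqP //|i j t u ij tT uT it jt iu ju].
have /forallP/(_ j)/implyP/(_ ij) := Tu i.
by rewrite leqNgt => /negP h; apply/eqP/negPn/negP => tu; apply: h;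
  apply/card_gt1P; exists t, u; rewrite !inE tT uT it jt iu ju.
Qed.

Lemma degree_relabel T (g : {perm 'I_10}) i : degree (relabel T g) (g i) = degree T i.
Proof.
have ginj : injective (fun t : {set 'I_10} => g @: t) by exact: (imset_inj (@perm_inj _ g)).
rewrite /degree -[RHS](card_imset _ ginj).
suff -> : [set t in relabel T g | g i \in t]%SET =
    [set g @: (t : {set 'I_10}) | t in [set t in T | i \in t]%SET]%SET by [].
apply/setP => t; apply/idP/imsetP => [|[u]].
  rewrite inE => /andP[/imsetP[u uT ->] iu]; exists u; rewrite // inE uT.
  by rewrite (mem_imset _ _ (@perm_inj _ g)) in iu.
move=> + ->; rewrite !inE (mem_imset _ _ (@perm_inj _ g)) => /andP[uT ->].
by rewrite andbT; apply/imsetP; exists u.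
Qed.

Lemma linear_space_relabel T g : linear_space T -> linear_space (relabel T g).
Proof.
move=> [T3 Tu]; split=> [_ /imsetP[t tT ->]|]; first by rewrite (card_imset _ (@perm_inj _ g)) T3.
move=> i j _ _ ij /imsetP[t tT ->] /imsetP[u uT ->].
rewrite -(permKV g i) -(permKV g j) !(mem_imset _ _ (@perm_inj _ g)) => it jt iu ju.
by rewrite (Tu (g^-1%g i) (g^-1%g j) t u) // (inj_eq perm_inj).
Qed.

Definition points b : seq nat := [:: b.1.1; b.1.2; b.2].

Definition valid_block b : bool := uniq (points b) && all (fun l => l < 10)%N (points b).

(* Unlike a conjunction, a conditional is lazy under [vm_compute].             *)
Definition same_block b b' : bool :=
  if in_block b.1.1 b' then if in_block b.1.2 b' then in_block b.2 b' else false else false.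

Lemma same_blockE b b' : same_block b b' = all (in_block^~ b') (points b).
Proof. by rewrite /same_block /= andbT; do 2 case: (in_block _ b'). Qed.

Definition joined B x y : bool := has (fun b => in_block x b && in_block y b) B.

Lemma in_valid_block i b : (i < 10)%N -> valid_block b ->
  (inord i \in set_of_block b) = in_block i b.
Proof.
move=> i10 /andP[_ /and4P[b1 b2 b3 _]]; rewrite /set_of_block /in_block !inE !eqnE -orbA.
by rewrite !inord_eq.
Qed.

Lemma set_of_blockP b i : valid_block b -> i \in set_of_block b ->
  exists2 l, in_block l b & [/\ (l < 10)%N & i = inord l].
Proof.
move=> /andP[_ /and4P[b1 b2 b3 _]]; rewrite /set_of_block !inE -orbA.
by case/or3P=> /eqP ->; [exists b.1.1|exists b.1.2|exists b.2];
  rewrite /in_block ?eqnE ?eqxx ?orbT.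
Qed.

Lemma card_valid_block b : valid_block b -> #|set_of_block b| = 3%N.
Proof.
case/andP; rewrite /= !inE !negb_or andbT => /andP[/andP[b12 b13] b23].
by case/and4P=> b1 b2 b3 _; rewrite card_set3 // inord_eq.
Qed.

Lemma same_blockP b b' : valid_block b -> valid_block b' ->
  reflect (set_of_block b = set_of_block b') (same_block b b').
Proof.
move=> vb vb'; have /andP[_ b10] := vb; rewrite same_blockE; apply: (iffP allP) => [h|e i ib].
  apply/eqP; rewrite eqEcard !card_valid_block // andbT; apply/fintype.subsetP => i.
  case/(set_of_blockP vb) => l lb [l10 ->]; rewrite in_valid_block //; apply: h.
  by move: lb; rewrite /in_block /points !inE !eqnE.
have i10 := allP b10 i ib; rewrite -in_valid_block // -e in_valid_block //.
by move: ib; rewrite /in_block /points !inE !eqnE.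
Qed.

(* B consists of triple points of T, among which are all those on a line of D. *)
Definition partial T D B : Prop :=
  [/\ all valid_block B,
      {in B, forall b, set_of_block b \in T},
      uniq (map set_of_block B)
    & forall t p, t \in T -> p \in D -> inord p \in t -> t \in map set_of_block B].

(** The first candidate [x] lies either in no new triple point on [p], or in one with a later [y].
    The fuel [n] bounds the size of [xs], whose filtered tail is not a structural subterm. *)
Fixpoint extend_with n p (xs : seq nat) B : seq (seq block) :=
  if n is n'.+1 then
    if xs is x :: xs' then
      extend_with n' p xs' B ++
      flatten [seq extend_with n' p [seq z <- xs' | ~~ eqn z y] ((p, x, y) :: B)
              | y <- xs' & ~~ joined B x y]
    else [:: B]
  else [:: B].

(** Lines of [D] are no candidates because their triple points are all known, nor are lines joined
    to [p] because two lines share at most one triple point. *)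
Definition extend p D B : seq (seq block) :=
  extend_with 10 p [seq x <- iota 0 10 | [&& ~~ eqn x p, ~~ has (eqn x) D & ~~ joined B p x]] B.

Definition children lo hi p D B : seq (seq block) :=
  [seq B' <- extend p D B | let k := count (in_block p) B' in leq lo k && leq k hi].

Lemma joinedP T D B x y : partial T D B -> linear_space T -> joined B x y ->
  (x < 10)%N -> (y < 10)%N -> x != y ->
  forall t, t \in T -> inord x \in t -> inord y \in t -> t \in map set_of_block B.
Proof.
move=> [vB BT _ _] [_ Tu] /hasP[b bB /andP[xb yb]] x10 y10 xy t tT xt yt.
have vb := allP vB b bB.
rewrite (Tu (inord x) (inord y) t (set_of_block b)) ?inord_eq //; first exact: map_f.
- exact: BT.
- by rewrite in_valid_block.
- by rewrite in_valid_block.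
Qed.

(** The invariant is the last hypothesis: a triple point on [p] is already listed or is spanned by
    two remaining candidates. *)
Lemma extend_with_complete T D n p xs B : linear_space T -> (p < 10)%N ->
  partial T D B -> (size xs <= n)%N -> uniq xs ->
  {in xs, forall x, [/\ (x < 10)%N, x != p & ~~ joined B p x]} ->
  (forall t, t \in T -> inord p \in t -> t \in map set_of_block B \/
     exists x y, [/\ x \in xs, y \in xs, x != y & t = set_of_block (p, x, y)]) ->
  exists2 B', B' \in extend_with n p xs B & partial T (p :: D) B'.
Proof.
move=> lT p10; elim: n xs B => [|n IH] [|x xs] B pB //= szn uxs xsP cov.
- exists B; rewrite ?inE //; case: pB => vB BT uB DB; split=> // t q tT.
  rewrite inE => /orP[/eqP ->|qD]; last exact: DB.
  by case/(cov t tT) => // -[x [y [//]]].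
- exists B; rewrite ?inE //; case: pB => vB BT uB DB; split=> // t q tT.
  rewrite inE => /orP[/eqP ->|qD]; last exact: DB.
  by case/(cov t tT) => // -[x [y [//]]].
have /andP[xxs uxs'] := uxs; have [x10 xp xB] := xsP x (mem_head _ _).
have [[y [yxs tT]]|no] := pselect (exists y, y \in xs /\ set_of_block (p, x, y) \in T);
    last first.
  have [||||B' B'e pB'] := IH xs B pB => //.
  - by move=> z zxs; apply: xsP; rewrite inE zxs orbT.
  - move=> t tT pt; case: (cov t tT pt) => [|[y [z [yxs zxs yz tE]]]]; first by left.
    have swap a b : set_of_block (p, a, b) = set_of_block (p, b, a).
      by rewrite /set_of_block /= -!finset.setUA [X in _ :|: X]finset.setUC.
    right; move: yxs zxs yz tE; rewrite !inE => /orP[/eqP ->|yxs] /orP[/eqP ->|zxs] yz tE.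
    + by rewrite eqxx in yz.
    + by case: no; exists z; rewrite -tE.
    + by case: no; exists y; rewrite swap -tE.
    + by exists y, z.
  by exists B' => //; rewrite mem_cat B'e.
have [y10 yp yB] := xsP y (mem_behead (s := x :: xs) yxs).
have xy : x != y by apply: contraNneq xxs => ->.
have vb : valid_block (p, x, y).
  by rewrite /valid_block /= !inE !negb_or p10 x10 y10 xy !(eq_sym p) xp yp.
have px : inord p \in set_of_block (p, x, y) by rewrite in_valid_block // /in_block eqnE eqxx.
have xx : inord x \in set_of_block (p, x, y).
  by rewrite in_valid_block // /in_block !eqnE eqxx orbT.
have yy : inord y \in set_of_block (p, x, y).
  by rewrite in_valid_block // /in_block !eqnE eqxx !orbT.
have notB : set_of_block (p, x, y) \notin map set_of_block B.
  apply/mapP => -[b bB bE]; case/negP: xB; apply/hasP; exists b => //.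
  have vb' : valid_block b by case: pB => /allP vB _ _ _; exact: vB.
  by rewrite -!in_valid_block // -bE px xx.
have xyB : ~~ joined B x y.
  apply/negP => j; case/negP: notB.
  exact: (joinedP pB lT j x10 y10 xy tT xx yy).
have pB' : partial T D ((p, x, y) :: B).
  case: pB => vB BT uB DB; split=> /=.
  - by rewrite vb.
  - by move=> b; rewrite inE => /orP[/eqP -> //|/BT].
  - by rewrite notB.
  - by move=> t q tT' qD qt; rewrite inE (DB t q) ?orbT.
have [||||B' B'e pB''] := IH [seq z <- xs | ~~ eqn z y] _ pB'.
- by rewrite size_filter (leq_trans (count_size _ _)).
- exact: filter_uniq.
- move=> z; rewrite mem_filter eqnE => /andP[zy zxs].
  have [z10 zp zB] := xsP z (mem_behead (s := x :: xs) zxs).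
  have zx : z != x by apply: contraNneq xxs => <-.
  split=> //; rewrite /joined /= negb_or; apply/andP; split=> //.
  by rewrite /in_block /= !eqnE eqxx /= (negPf zp) (negPf zx) (negPf zy).
- move=> t tT' pt; case: (cov t tT' pt) => [tB|[a [b [axs bxs ab tE]]]].
    by left; rewrite inE tB orbT.
  have [ta|tn] := eqVneq t (set_of_block (p, x, y)); first by left; rewrite inE ta eqxx.
  have [_ Tu] := lT.
  (* A triple point on [p] other than (p, x, y) contains neither [x] nor [y], so both its other
     lines remain candidates. *)
  have off l : l \in [:: x; y] -> inord l \notin t.
    move=> lxy; apply: contra_neqN tn => lt.
    have lP : [/\ (l < 10)%N, p != l & inord l \in set_of_block (p, x, y)].
      by move: lxy; rewrite in_cons mem_seq1 => /orP[] /eqP ->; split=> //; rewrite eq_sym.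
    case: lP => l10 pl lb; apply: (Tu (inord p) (inord l)) => //.
    by rewrite inord_eq.
  have inxs l : l \in [:: a; b] -> l \in [seq z <- xs | ~~ eqn z y].
    move=> lab; have lxs : l \in x :: xs.
      by move: lab; rewrite !inE => /orP[] /eqP ->; rewrite -in_cons.
    have [l10 lp _] := xsP l lxs; have lt : inord l \in t.
      have [[a10 ap _] [b10 bp _]] := (xsP a axs, xsP b bxs).
      rewrite tE in_valid_block //; last first.
        by rewrite /valid_block /= !inE !negb_or p10 a10 b10 ab !(eq_sym p) ap bp.
      by move: lab; rewrite /in_block /= !inE !eqnE => /orP[] ->; rewrite !orbT.
    rewrite mem_filter eqnE; have ly : l != y.
      by apply: contraTneq lt => ->; apply: off; rewrite !inE eqxx orbT.
    have lx : l != x by apply: contraTneq lt => ->; apply: off; rewrite !inE eqxx.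
    by move: lxs; rewrite inE (negPf lx) ly.
  by right; exists a, b; split=> //; apply: inxs; rewrite !inE eqxx ?orbT.
exists B' => //; rewrite mem_cat; apply/orP; right; apply/flattenP.
exists (extend_with n p [seq z <- xs | ~~ eqn z y] ((p, x, y) :: B)) => //.
by apply/mapP; exists y => //; rewrite mem_filter xyB.
Qed.

Lemma extend_complete T D p B : linear_space T -> (p < 10)%N -> partial T D B ->
  exists2 B', B' \in extend p D B & partial T (p :: D) B'.
Proof.
move=> lT p10 pB; apply: extend_with_complete => //.
- by rewrite size_filter (leq_trans (count_size _ _)) ?size_iota.
- by rewrite filter_uniq ?iota_uniq.
- move=> x; rewrite mem_filter mem_iota eqnE => /andP[/and3P[xp _ xB]] /andP[_ x10].
  by split.
move=> t tT pt; have [tB|tB] := boolP (t \in map set_of_block B); first by left.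
right; have [T3 _] := lT; have [vB BT _ cov] := pB.
have inj (l : nat) (l10 : (l < 10)%N) : inord l \in t -> l != p ->
    l \in [seq x <- iota 0 10 | [&& ~~ eqn x p, ~~ has (eqn x) D & ~~ joined B p x]].
  move=> lt lp; rewrite mem_filter mem_iota l10 eqnE lp !andbT /=; apply/andP; split.
    apply: contra tB => /hasP[d dD /eqP ld].
    by apply: (cov t d) => //; rewrite -ld.
  by apply: contra tB => j; apply: (joinedP pB lT j p10 l10) => //; rewrite eq_sym.
have [x [y [xt yt xy [xp yp]]]] : exists x y : 'I_10,
    [/\ x \in t, y \in t, x != y & x != inord p /\ y != inord p].
  have : (1 < #|(t :\ (inord p : 'I_10))%SET|)%N.
    by have := T3 t tT; rewrite (cardsD1 (inord p)) pt add1n => -[->].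
  case/card_gt1P=> x [y []]; rewrite !in_setD1 => /andP[xp xt] /andP[yp yt] xy.
  by exists x, y.
have nat_neq z : z != inord p -> val z != p by apply: contra_neq => <-; rewrite inord_val.
exists (val x), (val y); split; [..|apply/eqP].
- by apply: inj; rewrite ?ltn_ord ?inord_val ?nat_neq.
- by apply: inj; rewrite ?ltn_ord ?inord_val ?nat_neq.
- by rewrite val_eqE.
rewrite eq_sym eqEcard T3 // card_valid_block; last first.
  by rewrite /valid_block /= !inE !negb_or p10 !ltn_ord val_eqE xy !(eq_sym p) !nat_neq.
rewrite andbT; apply/fintype.subsetP => l; rewrite /set_of_block /= !inord_val !inE.
by rewrite -orbA => /or3P[] /eqP ->.
Qed.

Lemma degree_partial T D p B : (p < 10)%N -> p \in D -> partial T D B ->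
  count (in_block p) B = degree T (inord p).
Proof.
move=> p10 pD [/allP vB BT uB cov]; rewrite /degree.
have u : uniq [seq set_of_block b | b <- B & in_block p b].
  by apply: subseq_uniq uB; apply: map_subseq; exact: filter_subseq.
rewrite -size_filter -(size_map set_of_block) -(card_uniqP u); apply: eq_card => t.
rewrite [RHS]inE; apply/mapP/andP => [[b + ->]|[tT pt]].
  by rewrite mem_filter => /andP[pb bB]; rewrite in_valid_block ?vB ?BT.
have /mapP[b bB tE] := cov t p tT pD pt; exists b => //.
by rewrite mem_filter bB andbT -in_valid_block ?vB // -tE.
Qed.

Lemma children_complete T D p lo hi B : linear_space T -> (p < 10)%N ->
  (lo <= degree T (inord p) <= hi)%N -> partial T D B ->
  exists2 B', B' \in children lo hi p D B & partial T (p :: D) B'.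
Proof.
move=> lT p10 dT pB; have [B' B'e pB'] := extend_complete lT p10 pB.
by exists B' => //; rewrite mem_filter B'e andbT (degree_partial p10 (mem_head _ _) pB').
Qed.

(** Double counting: each triple point on line [i] uses two of the nine other lines, and none is
    used twice. *)
Lemma degree_le4 T i : linear_space T -> (degree T i <= 4)%N.
Proof.
move=> [T3 Tu]; pose A := [set t in T | i \in t]%SET.
have : (\sum_(t in A) 2 <= 9)%N.
  rewrite (eq_bigr (fun t : {set 'I_10} => \sum_(j | j != i) (j \in t : nat)))%N; last first.
    move=> t; rewrite inE => /andP[tT it]; have := T3 t tT.
    rewrite (cardsD1 i) it add1n => -[d2]; transitivity #|t :\ i|%SET; first by rewrite d2.
    rewrite -sum1_card big_mkcond /= [RHS]big_mkcond.
    by apply: eq_bigr => j _; rewrite !inE; case: (j != i); case: (j \in t).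
  rewrite exchange_big /=; apply: (@leq_trans (\sum_(j | j != i) 1)); last first.
    by rewrite sum1_card cardC1 card_ord.
  apply: leq_sum => j ji; rewrite -big_mkcondr sum1_card leqNgt.
  apply/negP => /card_gt1P[t [u []]]; rewrite -!topredE /= !inE => /andP[/andP[tT it] jt].
  move=> /andP[/andP[uT iu] ju] /eqP; apply; apply: (Tu i j) => //.
  by rewrite eq_sym.
by rewrite sum_nat_const => h; rewrite leqNgt; apply/negP => d5;
  have := leq_trans (leq_mul d5 (leqnn 2)) h.
Qed.

Definition image (s : seq nat) (i : nat) : nat := nth 0%N s i.

Definition image_block s b : block := (image s b.1.1, image s b.1.2, image s b.2).

Definition is_perm (s : seq nat) : bool :=
  [&& size s == 10, uniq s & all (fun i => i < 10)%N s]%N.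

Lemma is_permP s : is_perm s ->
  exists g : {perm 'I_10}, forall i, (i < 10)%N -> g (inord i) = inord (image s i).
Proof.
move=> /and3P[/eqP s10 us /allP ls].
have inj : injective (fun i : 'I_10 => inord (image s i) : 'I_10).
  move=> i j /eqP; rewrite inord_eq ?ls ?mem_nth ?s10 //.
  by rewrite nth_uniq ?s10 // => /eqP/val_inj.
by exists (perm inj) => i i10; rewrite permE inordK.
Qed.

Lemma set_of_image_block s (g : {perm 'I_10}) b : valid_block b ->
  (forall i, (i < 10)%N -> g (inord i) = inord (image s i)) ->
  set_of_block (image_block s b) = g @: set_of_block b.
Proof. by move=> /andP[_ /and4P[b1 b2 b3 _]] gE; rewrite imset_set3 !gE. Qed.

Definition carries s B B' : bool :=
  all (fun b => let b' := image_block s b in has (same_block b') B') B.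

Definition proper_blocks B : bool :=
  all valid_block B && pairwise (fun b b' => ~~ same_block b b') B.

Lemma proper_blocks_uniq B : proper_blocks B -> uniq (map set_of_block B).
Proof.
move=> /andP[/allP vB pB]; rewrite uniq_pairwise pairwise_map.
by apply: sub_in_pairwise pB => //= b b' bB bB'; apply: contraNneq => e; apply/same_blockP;
  rewrite ?vB.
Qed.

Lemma partial_config D B : proper_blocks B -> partial (config_of B) D B.
Proof.
move=> pB; have /andP[vB _] := pB; split=> //; last by move=> t p; rewrite inE.
  by move=> b bB; rewrite inE map_f.
exact: proper_blocks_uniq.
Qed.

Lemma config_of_partial T B : linear_space T -> partial T (iota 0 10) B -> T = config_of B.
Proof.
move=> [T3 _] [_ BT _ cov]; apply/setP => t; rewrite inE; apply/idP/mapP => [tT|[b bB ->]].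
  have /card_gt0P[i it] : (0 < #|t|)%N by rewrite T3.
  by apply/mapP; apply: (cov t (val i)); rewrite ?mem_iota ?ltn_ord ?inord_val.
exact: BT.
Qed.

(** Both inclusions between the blocks are tested: one keeps [B'] inside the relabelled
    configuration, the other makes it complete on the lines of [D']. *)
Definition reduction s D B D' B' : bool :=
  [&& is_perm s, carries s B B',
      all (fun b' => has (fun b => same_block (image_block s b) b') B) B',
      all (fun p => has (fun d => (d < 10) && (image s d == p)) D) D'
    & proper_blocks B']%N.

Lemma valid_image_block s b : is_perm s -> valid_block b -> valid_block (image_block s b).
Proof.
move=> /and3P[/eqP s10 us /allP ls] /andP[u l]; apply/andP; rewrite -[points _]/(map (image s) (points b)).
split; last by apply/allP => _ /mapP[i /(allP l) i10 ->]; rewrite ls ?mem_nth ?s10.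
rewrite map_inj_in_uniq // => i j /(allP l) i10 /(allP l) j10 /eqP.
by rewrite nth_uniq ?s10 // => /eqP.
Qed.

Lemma reductionP T s D B D' B' : reduction s D B D' B' -> partial T D B ->
  exists g, partial (relabel T g) D' B'.
Proof.
case/and5P=> ps BB' B'B DD' pB' [/allP vB BT _ cov].
have [g gE] := is_permP ps; exists g; have /andP[vB' _] := pB'.
have sE b : b \in B -> set_of_block (image_block s b) = g @: set_of_block b.
  by move=> bB; exact: set_of_image_block (vB b bB) gE.
split=> //.
- move=> b' b'B; have /hasP[b bB] := allP B'B b' b'B.
  move/(same_blockP (valid_image_block ps (vB b bB)) (allP vB' b' b'B)) => <-.
  by rewrite sE //; apply/imsetP; exists (set_of_block b) => //; exact: BT.
- exact: proper_blocks_uniq.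
move=> t p /imsetP[u uT ->] /(allP DD')/hasP[d dD /andP[d10 /eqP <-]].
rewrite -gE // (mem_imset _ _ (@perm_inj _ g)) => du.
have /mapP[b bB ->] := cov u d uT dD du.
have /hasP[b' b'B] := allP BB' b bB.
move/(same_blockP (valid_image_block ps (vB b bB)) (allP vB' b' b'B)) => e.
by rewrite -sE // e map_f.
Qed.

End Classification.

(** * Search for relabellings *)

Section Search.
Implicit Types (T : {set {set 'I_10}}) (B C : seq block) (D : seq nat).

Fixpoint first_some A A' (f : A -> option A') (s : seq A) : option A' :=
  if s is x :: s' then if f x is Some y then Some y else first_some f s' else None.

Definition value (a : seq (nat * nat)) x : option nat :=
  first_some (fun e => if eqn e.1 x then Some e.2 else None) a.

(** A block with a point not yet assigned passes, so the test can be used during the search. *)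
Definition carried B' a b : bool :=
  if (value a b.1.1, value a b.1.2, value a b.2) is (Some i, Some j, Some k)
  then has (same_block (i, j, k)) B' else true.

(* An entry of the search order consists of a point, of its possible images,   *)
(* and of the blocks to be tested once its image is chosen.                    *)
Definition entry := (nat * (seq nat * seq block))%type.

Fixpoint find_perm B' (order : seq entry) a : option (seq (nat * nat)) :=
  if order is (x, (vs, bs)) :: order' then
    first_some (fun v => if has (fun e => eqn e.2 v) a then None else
      if all (carried B' ((x, v) :: a)) bs then find_perm B' order' ((x, v) :: a)
      else None) vs
  else Some a.

(** [undup] keeps last occurrences, hence the two reversals. *)
Definition first_occurrences (s : seq nat) : seq nat := rev (undup (rev s)).

Definition search_order K B (c c' : seq Z) : seq entry :=
  let l := first_occurrences (K ++ flatten (map points (rev B)) ++ iota 0 10) in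
  [seq (x, ([seq v <- iota 0 10 | Z.eqb (nth Z0 c x) (nth Z0 c' v)],
     [seq b <- B | in_block x b && all (fun y => leq (index y l) (index x l)) (points b)]))
  | x <- l].

Definition find_colour_perm K B (c : seq Z) B' (c' : seq Z) : option (seq (nat * nat)) :=
  find_perm B' (search_order K B c c') [::].

Definition unjoined B p : seq nat :=
  let s := p :: flatten [seq (if in_block p b then points b else [::]) | b <- B] in
  [seq x <- iota 0 10 | ~~ has (eqn x) s].

(** Twice the number of triangles through each point in the graph of pairs that share no triple
    point. *)
Definition antitriangles B : seq nat :=
  let n := [seq unjoined B p | p <- iota 0 10] in
  [seq sumn [seq count (fun y => has (eqn y) (nth [::] n x)) s | x <- s] | s <- n].

(** One round of colour refinement: squaring makes the contribution of a block nonlinear in its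
    colours, and the modulus bounds each increment. *)
Definition refine_colours B (c : seq Z) : seq Z :=
  let m := [seq (b, let n := foldr (fun y => Z.add (nth Z0 c y)) Z0 (points b) in Z.mul n n)
           | b <- B] in
  [seq Z.add (nth Z0 c p) (Z.modulo (foldr (fun e n => if in_block p e.1 then Z.add e.2 n
     else n) Z0 m) 1009%BinZ) | p <- iota 0 10].

(* Any colouring is sound here; this one is preserved by relabellings that     *)
(* fix the points of K, and separates enough points to make the backtracking   *)
(* short.                                                                      *)
Definition colours K B : seq Z :=
  let n := antitriangles B in
  iter 3 (refine_colours B)
    [seq Z.of_nat (count (in_block p) B + 3 * nth 0 n p + 40 * find (eqn p) K)%N
    | p <- iota 0 10].

(** Under [vm_compute] the disjunction in [has] would run the search for all remaining targets
    too. *)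
Fixpoint lazy_has A (p : A -> bool) (s : seq A) : bool :=
  if s is x :: s' then if p x then true else lazy_has p s' else false.

Definition target := (seq nat * seq block)%type.

Definition coloured K (t : target) : target * seq Z := (t, colours K t.2).

Definition sumz (c : seq Z) : Z := foldr Z.add Z0 c.

Definition perm_list (a : seq (nat * nat)) : seq nat :=
  [seq odflt 0%N (value a i) | i <- iota 0 10].

(** Sizes and colour sums only reject hopeless targets early; correctness rests on [reduction],
    applied to the permutation found. *)
Definition reduces_to K D B (c : seq Z) (t : target * seq Z) : bool :=
  if eqn (size B) (size t.1.2) && Z.eqb (sumz c) (sumz t.2) then
    if find_colour_perm K B c t.1.2 t.2 is Some a then
      reduction (perm_list a) D B t.1.1 t.1.2
    else false
  else false.

Definition reduces K (ts : seq (target * seq Z)) D B : bool :=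
  let c := colours K B in lazy_has (reduces_to K D B c) ts.

Fixpoint search ts hi (order : seq nat) D B : bool :=
  if order is p :: order' then
    (p < 10)%N && all (search ts hi order' (p :: D)) (children 3 hi p D B)
  else reduces [::] ts D B.

Definition configurations : seq (seq block) :=
  map blocks_of nine_digits ++ map cert_blocks irreducible_certificates.

Definition star_perm B : seq nat :=
  let l := first_occurrences (flatten (map points B) ++ iota 0 10) in
  [seq index i l | i <- iota 0 10].

Definition search_all hi star (reps : seq (seq block * seq nat)) : bool :=
  let ts := [seq coloured [::] (iota 0 10, C) | C <- configurations] in
  let d1 := [:: 0%N] in let d2 := [:: 9; 0]%N in
  let pairs := [seq coloured d2 (d2, r.1 ++ star) | r <- reps] in
  [&& all (fun B => reduction (star_perm B) d1 B d1 star) (children hi hi 0 [::] [::]),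
      all (reduces d2 pairs d2) (children 3 hi 9 d1 star)
    & all (fun r => search ts hi r.2 d2 (r.1 ++ star)) reps].

(* The triple points on the line 0, those on the line 9 up to symmetry, and the *)
(* order in which the triple points on the other lines are chosen.             *)
Definition star3 : seq block := [:: (0, 1, 2); (0, 3, 4); (0, 5, 6)]%N.

Definition star4 : seq block := (0, 7, 8)%N :: star3.

Definition reps4 : seq (seq block * seq nat) := [::
  ([:: (3,5,9); (4,7,9); (6,8,9)], [:: 7; 3; 6; 1; 2; 4; 8; 5]);
  ([:: (2,3,9); (5,7,9); (6,8,9)], [:: 6; 7; 2; 4; 1; 3; 5; 8]);
  ([:: (2,3,9); (4,5,9); (6,7,9)], [:: 4; 2; 6; 8; 1; 5; 7; 3]);
  ([:: (1,3,9); (2,4,9); (5,7,9); (6,8,9)], [:: 8; 5; 2; 3; 4; 6; 7; 1]);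
  ([:: (1,3,9); (2,5,9); (4,7,9); (6,8,9)], [:: 7; 6; 2; 3; 1; 4; 5; 8])]%N.

Definition reps3 : seq (seq block * seq nat) := [::
  ([:: (3,5,9); (4,6,9); (7,8,9)], [:: 6; 3; 1; 8; 5; 7; 4; 2]);
  ([:: (3,5,9); (4,7,9); (6,8,9)], [:: 4; 5; 8; 2; 6; 1; 3; 7]);
  ([:: (2,3,9); (5,7,9); (6,8,9)], [:: 3; 5; 8; 1; 7; 6; 4; 2]);
  ([:: (2,3,9); (4,5,9); (7,8,9)], [:: 4; 2; 6; 7; 8; 1; 3; 5]);
  ([:: (2,3,9); (4,5,9); (6,7,9)], [:: 3; 5; 8; 2; 7; 1; 6; 4]);
  ([:: (2,3,9); (4,7,9); (6,8,9)], [:: 2; 5; 4; 8; 3; 7; 1; 6]);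
  ([:: (2,7,9); (3,5,9); (4,6,9)], [:: 4; 5; 2; 8; 1; 6; 7; 3]);
  ([:: (1,3,9); (2,5,9); (4,6,9)], [:: 6; 2; 7; 8; 5; 4; 1; 3])]%N.

Lemma search_all4 : search_all 4 star4 reps4.
Proof. by vm_compute. Qed.

Lemma search_all3 : search_all 3 star3 reps3.
Proof. by vm_compute. Qed.

End Search.

(** * Completeness of the classification and of the search *)

Section Completeness.
Implicit Types (T : {set {set 'I_10}}) (B C : seq block) (D : seq nat).

Lemma partial_nil T : partial T [::] [::].
Proof. by []. Qed.

Lemma first_some_none (A : eqType) A' (f : A -> option A') s :
  first_some f s = None -> {in s, forall x, f x = None}.
Proof.
elim: s => //= x s IH; case e: (f x) => [//|] /IH h y.
by rewrite in_cons => /orP[/eqP ->|/h].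
Qed.

Lemma valueP a x y : value a x = Some y -> (x, y) \in a.
Proof.
rewrite /value; elim: a => //= e a IH; rewrite eqnE; case: eqP => [<- [<-]|_ /IH h].
  by rewrite in_cons -surjective_pairing eqxx.
by rewrite in_cons h orbT.
Qed.

Lemma lazy_hasE A (p : A -> bool) s : lazy_has p s = has p s.
Proof. by elim: s => //= x s ->; case: (p x). Qed.

Lemma reduces_toP K D B c t : reduces_to K D B c t ->
  exists s, reduction s D B t.1.1 t.1.2.
Proof.
rewrite /reduces_to; case: (_ && _); last by [].
by case: (find_colour_perm K B c t.1.2 t.2) => [a|]; first by exists (perm_list a).
Qed.

Lemma reducesP T K ts D B : reduces K (map (coloured K) ts) D B -> partial T D B ->
  exists2 t, t \in ts & exists g, partial (relabel T g) t.1 t.2.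
Proof.
rewrite /reduces lazy_hasE => /hasP[_ /mapP[t tts ->] /reduces_toP[s rs]] pB.
by exists t => //; apply: reductionP rs pB.
Qed.

Lemma searchP T ts hi order D B : linear_space T ->
  (forall i, 3 <= degree T i <= hi)%N ->
  search (map (coloured [::]) ts) hi order D B -> partial T D B ->
  exists2 t, t \in ts & exists g, partial (relabel T g) t.1 t.2.
Proof.
move=> lT dT; elim: order D B => [|p o IH] D B /=; first exact: reducesP.
move=> /andP[p10 /allP ok] pB; have [B' B'c pB'] := children_complete lT p10 (dT _) pB.
exact: (IH _ _ (ok B' B'c) pB').
Qed.

Lemma search_allP T hi star reps : linear_space T ->
  (forall i, 3 <= degree T i <= hi)%N -> (exists i, degree T i = hi) ->
  search_all hi star reps -> exists2 C, C \in configurations & isomorphic T (config_of C).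
Proof.
move=> lT dT [i dTi] /and3P[ok0 ok9 ok].
have relabelled g : linear_space (relabel T g) /\ forall j, (3 <= degree (relabel T g) j <= hi)%N.
  split; first exact: linear_space_relabel.
  by move=> j; rewrite -(permKV g j) degree_relabel.
(* A transposition brings a line of maximal degree to position 0, and a second relabelling
   normalizes the triple points on it. *)
have [g pg] : exists g, partial (relabel T g) [:: 0%N] star.
  pose g := tperm i (inord 0); have [lg dg] := relabelled g.
  have d0 : (hi <= degree (relabel T g) (inord 0) <= hi)%N.
    by rewrite -(tpermL i (inord 0)) degree_relabel dTi leqnn.
  have [B Bc pB] := children_complete (p := 0) lg isT d0 (partial_nil _).
  have [g' pg'] := reductionP (allP ok0 B Bc) pB.
  by exists (g * g')%g; rewrite -relabel_comp.
have [lg dg] := relabelled g.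
have [B Bc pB] := children_complete (p := 9) lg isT (dg _) pg.
have := allP ok9 B Bc; rewrite (map_comp (coloured _) (fun r => ([:: 9; 0]%N, r.1 ++ star))).
move=> /reducesP /(_ pB)[t /mapP[r rr ->] [g' /= pg']].
rewrite relabel_comp in pg'; have [lg' dg'] := relabelled (g * g')%g.
have := allP ok r rr; rewrite (map_comp (coloured _) (fun C => (iota 0 10, C))).
move=> /(searchP lg' dg') /(_ pg')[_ /mapP[C CC ->] [g'' /= pg'']].
exists C => //; apply/isomorphicP; exists (g * g' * g'')%g.
rewrite relabel_comp in pg''; apply: config_of_partial pg''.
by have [] := relabelled (g * g' * g'')%g.
Qed.

Lemma classification T : ten_line_configuration T ->
  exists2 C, C \in configurations & isomorphic T (config_of C).
Proof.
move=> /ten_line_configurationP[lT dT].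
have [[i di]|no4] := pselect (exists i, degree T i = 4%N).
  by apply: search_allP search_all4 => //; [move=> j; rewrite dT degree_le4|exists i].
have d3 i : degree T i = 3%N.
  apply/eqP; rewrite eqn_leq dT andbT -ltnS ltn_neqAle degree_le4 // andbT.
  by apply/eqP => d4; apply: no4; exists i.
by apply: search_allP search_all3 => //; [move=> j; rewrite d3|exists ord0].
Qed.

(** The branch following [f] passes every test, so the search cannot fail; conversely a failure
    excludes every such [f]. *)
Lemma find_perm_complete B' (order : seq entry) a (f : nat -> nat) :
  (forall e, e \in a -> e.2 = f e.1) ->
  uniq (map fst a ++ map fst order) ->
  {in map fst a ++ map fst order &, injective f} ->
  all (fun e => (f e.1 \in e.2.1) &&
    all (fun b => has (same_block (f b.1.1, f b.1.2, f b.2)) B') e.2.2) order ->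
  find_perm B' order a <> None.
Proof.
elim: order a => [|[x [vs bs]] order IH] a fa u finj fo //; move: fo => /= /andP[/andP[fx /allP fbs] fo].
move=> /first_some_none none.
move: (none _ fx); rewrite ifF; last first.
  apply/hasP => -[e ea]; rewrite eqnE (fa e ea) => /eqP /finj ex.
  have exx : e.1 = x by apply: ex; rewrite mem_cat ?map_f //= in_cons eqxx orbT.
  move: u; rewrite cat_uniq /= => /and3P[_ + _]; by rewrite -exx map_f.
rewrite ifT; last first.
  apply/allP => b /fbs hb; rewrite /carried.
  have va y w : value ((x, f x) :: a) y = Some w -> w = f y.
    by move/valueP; rewrite in_cons => /orP[/eqP[-> ->] //|/fa].
  case e1: value => [i|//]; case e2: value => [j|//]; case e3: value => [k|//].
  by rewrite (va _ _ e1) (va _ _ e2) (va _ _ e3).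
have perm : perm_eq (map fst ((x, f x) :: a) ++ map fst order)
    (map fst a ++ map fst ((x, (vs, bs)) :: order)).
  by rewrite /= perm_sym perm_catC /= perm_cons perm_catC.
apply: IH.
- by move=> e; rewrite in_cons => /orP[/eqP -> //|/fa].
- by rewrite (perm_uniq perm).
- by move=> y z; rewrite !(perm_mem perm); exact: finj.
- exact: fo.
Qed.

(** Used in place of [colours], since invariance under isomorphism has to be proved here. *)
Definition degrees B : seq Z := [seq Z.of_nat (count (in_block p) B) | p <- iota 0 10].

Lemma find_colour_perm_complete B B' : proper_blocks B -> proper_blocks B' ->
  isomorphic (config_of B) (config_of B') ->
  find_colour_perm [::] B (degrees B) B' (degrees B') <> None.
Proof.
move=> pB pB' /isomorphicP[g gT]; pose f i := val (g (inord i)).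
have [/allP vB _] := andP pB; have [/allP vB' _] := andP pB'.
pose l := first_occurrences ([::] ++ flatten (map points (rev B)) ++ iota 0 10); have lE : l =i iota 0 10.
  move=> i; rewrite /l /first_occurrences mem_rev mem_undup mem_rev cat0s mem_cat.
  rewrite orbC; have [//|i10] := boolP (i \in iota 0 10); apply: contraNF i10.
  case/flattenP=> _ /mapP[b + ->]; rewrite mem_rev => /vB/andP[_ /allP ib] /ib.
  by rewrite mem_iota.
have fst_order c c' : map fst (search_order [::] B c c') = l.
  by rewrite /search_order -map_comp map_id.
apply: (find_perm_complete (f := f)) => //=; rewrite ?fst_order.
- by rewrite rev_uniq undup_uniq.
- move=> i j; rewrite !lE !mem_iota /= => i10 j10 /val_inj/perm_inj/eqP.
  by rewrite inord_eq // => /eqP.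
rewrite /search_order -/l all_map; apply/allP => i; rewrite lE mem_iota => i10.
apply/andP; split; last first.
  apply/allP => b; rewrite mem_filter => /andP[_ bB]; have vb := vB b bB.
  have /andP[_ /and4P[b1 b2 b3 _]] := vb.
  have : g @: set_of_block b \in config_of B' by rewrite -gT imset_f // inE map_f.
  rewrite inE => /mapP[b' b'B gb]; apply/hasP; exists b' => //.
  rewrite same_blockE /= /f -!in_valid_block ?ltn_ord ?vB' // !inord_val -gb.
  rewrite !(mem_imset _ _ (@perm_inj _ g)) !in_valid_block // /in_block !eqnE !eqxx.
  by rewrite !orbT.
rewrite mem_filter mem_iota ltn_ord andbT.
have nthE C j : (j < 10)%N -> nth Z0 (degrees C) j = Z.of_nat (count (in_block j) C).
  by move=> j10; rewrite (nth_map 0%N) ?size_iota // nth_iota.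
have degE C j : proper_blocks C -> (j < 10)%N ->
    count (in_block j) C = degree (config_of C) (inord j).
  by move=> pC j10; apply: (degree_partial (D := iota 0 10));
    rewrite ?mem_iota //; exact: partial_config.
rewrite !nthE ?ltn_ord // !degE ?ltn_ord // -gT inord_val degree_relabel.
by rewrite BinInt.Z.eqb_refl.
Qed.

End Completeness.

(** * Checks on the nine configurations *)

Section FinalChecks.
Implicit Types (T : {set {set 'I_10}}) (B : seq block).

(** Of two further lines, at most one completes [i] and [j] to a triple point. *)
Lemma linear_space_spread T : linear_space T -> spread T.
Proof.
move=> [_ Tu] i j ij; have : (1 < #|~: [set i; j]%SET|)%N.
  by rewrite -(ltn_add2l #|[set i; j]%SET|) cardsC cards2 ij card_ord.
case/card_gt1P=> k [l [+ + kl]]; rewrite !inE !negb_or ![_ == i]eq_sym ![_ == j]eq_sym.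
move=> /andP[ik jk] /andP[il jl].
have [kT|kT] := boolP (triple_point T i j k); last by exists k.
exists l; split=> //; apply/negP => lT.
have := Tu i j _ _ ij kT lT; rewrite !inE !eqxx !orbT => /(_ isT isT isT isT)/setP/(_ k).
by rewrite !inE eqxx orbT ![k == _]eq_sym (negPf ik) (negPf jk) eq_sym (negPf kl).
Qed.

Definition ten_line_blocks B : bool :=
  [&& proper_blocks B,
      all (fun b => all (fun b' => same_block b b' || (count (in_block^~ b') (points b) <= 1)%N) B) B
    & all (fun p => (3 <= count (in_block p) B)%N) (iota 0 10)].

Lemma ten_line_blocksP B : ten_line_blocks B -> ten_line_configuration (config_of B).
Proof.
case/and3P=> pB linB degB; have [/allP vB _] := andP pB; apply/and3P; split.
- by apply/forall_inP => t; rewrite inE => /mapP[b /vB vb ->]; rewrite card_valid_block.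
- apply/forallP => i; apply/forallP => j; apply/implyP => ij; rewrite leqNgt.
  apply/negP => /card_gt1P[t [u []]]; rewrite !inE.
  case/and3P=> /mapP[b bB ->] ib jb /and3P[/mapP[b' b'B ->] ib' jb'] /eqP; apply.
  have [vb vb'] := (vB b bB, vB b' b'B).
  apply/same_blockP => //; have /orP[//|] := allP (allP linB b bB) b' b'B.
  rewrite leqNgt => /negP []; rewrite -size_filter.
  have on k b0 : valid_block b0 -> k \in set_of_block b0 -> in_block (val k) b0.
    by move=> v0; rewrite -in_valid_block ?ltn_ord // inord_val.
  have memE k b0 : in_block k b0 = (k \in points b0).
    by rewrite /in_block !in_cons !eqnE in_nil orbF.
  (* The distinct lines [i] and [j] lie in both blocks, so at least two points of [b] belong to
     [b']. *)
  apply: (@uniq_leq_size _ [:: val i; val j]); first by rewrite /= in_cons orbF val_eqE ij.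
  move=> k; rewrite !in_cons orbF mem_filter -memE => /orP[] /eqP ->; rewrite !on //.
- apply/forallP => i; rewrite -/(degree _ _) -(inord_val i).
  rewrite -(degree_partial (D := iota 0 10) _ _ (partial_config _ pB)) ?ltn_ord ?mem_iota ?ltn_ord //.
  by apply: (allP degB); rewrite mem_iota ltn_ord.
Qed.

Lemma nine_ten_line : all ten_line_configuration nine_configurations.
Proof.
have ten_line (s : seq (seq nat)) : all ten_line_blocks (map blocks_of s) ->
    all ten_line_configuration (map triples_of s).
  rewrite !all_map; apply: sub_all => d /ten_line_blocksP.
  by rewrite config_of_digits.
by rewrite nine_configurationsE; apply: ten_line; vm_compute.
Qed.

Definition apart B B' : bool :=
  ~~ isSome (find_colour_perm [::] B (degrees B) B' (degrees B')).

Lemma apart_not_isomorphic (s : seq (seq nat)) :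
  pairwise apart (map blocks_of s) -> all proper_blocks (map blocks_of s) ->
  pairwise (fun T T' => ~~ isomorphic T T') (map triples_of s).
Proof.
rewrite !pairwise_map all_map => ok prop.
apply: (sub_in_pairwise _ prop ok) => d d' pd pd' ap.
apply/negP; rewrite -!config_of_digits => /(find_colour_perm_complete pd pd'); apply.
by move: ap; rewrite /= /apart; case: (find_colour_perm _ _ _ _ _).
Qed.

Lemma nine_not_isomorphic : pairwise (fun T T' => ~~ isomorphic T T') nine_configurations.
Proof. by rewrite nine_configurationsE; apply: apart_not_isomorphic; vm_compute. Qed.

Lemma certified_not_reducible (R : realType) (cs : seq certificate) B :
  all certificate_ok cs -> B \in map cert_blocks cs ->
  ~ reducible_realizations R (config_of B).
Proof.
elim: cs => //= c cs IH /andP[ok oks]; rewrite in_cons => /orP[/eqP ->|]; last exact: IH.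
exact: certificate_okP.
Qed.

End FinalChecks.

Theorem theorem5p3 (R : realType) :
  [/\ all ten_line_configuration nine_configurations,
      pairwise (fun T T' => ~~ isomorphic T T') nine_configurations
    & forall T : {set {set 'I_10}}, ten_line_configuration T ->
        (potential_zariski_pair R T <->
         exists2 T', T' \in nine_configurations & isomorphic T T')].
Proof.
split; [exact: nine_ten_line|exact: nine_not_isomorphic|] => T tT.
have [lT _] := ten_line_configurationP tT.
rewrite (potential_zariski_pairP R (linear_space_spread lT)); split=> [rT|[T' nT' iT]].
  have [C + iC] := classification tT; rewrite mem_cat => /orP[/mapP[s sn CE]|Cc].
    exists (triples_of s); first by rewrite nine_configurationsE map_f.
    by rewrite -config_of_digits -CE.
  case: (certified_not_reducible (R := R) irreducible_certificates_ok Cc).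
  exact: reducible_isomorphic rT.
by apply: (reducible_isomorphic (isomorphic_sym iT)); exact: nine_reducible.
Qed.
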